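(* Let $\mathbf{L}^N=(L_1^N,\ldots,L_m^N)\in\mathbb{Z}_+^m$, $N=1,2,\ldots$, be a sequence with $\frac1N\mathbf{L}^N\to\mathbf{a}=(a_1,\ldots,a_m)\neq\mathbf{0}$ as $N\to\infty$. Consider the sequence of fusion modules $(\mathbf{C}^2)^{\ast L_1^N}\ast\cdots\ast(\mathbf{C}^{m+1})^{\ast L_m^N}$ of the current algebra $\mathfrak{sl}_2\otimes\mathbf{C}[t]$, and their central string functions $\tilde T(\mathbf{L}^N,s_N)(q)$, where $s_N=\lfloor\frac12\sum_{i=1}^m iL_i^N\rfloor$. Let $X_N$ be a random variable with probability generating function $\mathbb{E}(q^{X_N})=\tilde T(\mathbf{L}^N,s_N)(q)/\tilde T(\mathbf{L}^N,s_N)(1)$. Then $X_N$ is asymptotically normal, i.e. $$\frac{X_N-\mathbb{E}(X_N)}{\sqrt{\mathrm{Var}(X_N)}}\longrightarrow\mathcal{N}(0,1)\quad\text{in distribution as }N\to\infty,$$ with asymptotic mean $$\frac1{N^2}\mathbb{E}(X_N)\to\sum_{i=1}^m\Bigg[\Big(\frac i2+i^2\Big)\Big(\sum_{k=i}^m\frac{a_k}{k+1}\Big)^2+i\Big(\sum_{k=i}^m\frac{a_k}{k+1}\Big)\Big(\sum_{k=1}^{i-1}a_k\Big)\Bigg],$$ and asymptotic variance $$\frac1{N^3}\mathrm{Var}(X_N)\to\tfrac14\,\mathbf{f}\,\Sigma\,\mathbf{f}^t+v(\mathbf{a},\mathbf{b}).$$ Here $b_0=b_{m+1}=0$ and, for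 $1\le i,j\le m$, $$b_i=i\sum_{\ell=i}^m\frac{a_\ell}{\ell+1},\qquad f_i=a_i+b_{i+1}+b_{i-1}+2b_i+2\sum_{\ell=1}^{i-1}a_\ell,$$ $$v(\mathbf{a},\mathbf{b})=\frac1{12}\sum_{i=1}^m(a_i+b_{i+1}-b_i)\,b_i\,(a_i+b_{i+1}),$$ $$\Sigma_{i,j}=-\frac{ij}{2\sigma^2(\mathbf{a})}c(i)c(j)+\min(i,j)\sum_{k=\max(i,j)}^m\frac{a_k}{k+1}-ij\sum_{k=\max(i,j)}^m\frac{a_k}{(k+1)^2},$$ where $\sigma^2(\mathbf{a})=\frac1{12}\sum_{k=1}^m k(k+2)a_k$, $c(i)=\sum_{k=i}^m\frac{k+1-i}{k+1}a_k$, and $\mathbf{f}=(f_1,\ldots,f_m)$ is a row vector.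
   Context: $\mathbb{Z}_+$ denotes the nonnegative integers. For $\mathbf{L}=(L_1,\ldots,L_m)\in\mathbb{Z}_+^m$ and an integer $a$, the $q$-supernomial is $$\tilde T(\mathbf{L},a)(q)=\sum_{j_1+\cdots+j_m=a}q^{\sum_{i=1}^m j_i\left(j_i+\sum_{\ell=1}^{i-1}L_\ell\right)}\prod_{\ell=1}^m\genfrac{[}{]}{0pt}{}{L_\ell+j_{\ell+1}}{j_\ell}_q,$$ where the sum is over $(j_1,\ldots,j_m)\in\mathbb{Z}_+^m$, $j_{m+1}=0$, and $\genfrac{[}{]}{0pt}{}{n}{k}_q$ is the Gaussian binomial coefficient (zero unless $0\le k\le n$). It is zero unless $0\le a\le\sum_i iL_i$. The fusion module $\mathcal{F}(\mathbf{L})=(\mathbf{C}^2)^{\ast L_1}\ast\cdots\ast(\mathbf{C}^{m+1})^{\ast L_m}$ is the Feigin--Loktev fusion product of $L_i$ copies of the $(i+1)$-dimensional irreducible $\mathfrak{sl}_2$-module, $i=1,\ldots,m$. In the normalization of the grading used here, its graded character is $\chi(\mathcal{F}(\mathbf{L}))(z,q)=\sum_{a\in\mathbf{Z}}z^a\,\tilde T(\mathbf{L},a)(q)$ (a theorem of Feigin and Feigin). The coefficients $\tilde T(\mathbf{L},a)(q)$ of $z^a$ are called string functions; the central one is that with $a=\lfloor\frac12\sum_i iL_i\rfloor$. The claim concerns the probability distribution defined by the coefficients of this polynomial.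
   Formalization: In Σ_{i,j} the first term is taken with denominator 4σ²(a) instead of the printed 2σ²(a); with 2σ² the claim is false: for m=1, L^N=(N), a=(1) it gives limit variance −11/48 < 0, while the true value is 1/48. *)

(* Defs.v *)
From HB Require Import structures.
From mathcomp Require Import all_boot all_order all_algebra.
From mathcomp Require Import ring.
From mathcomp Require Import all_classical all_reals all_analysis.
Import Order.TTheory GRing.Theory Num.Theory.
Import numFieldNormedType.Exports.

Set Implicit Arguments.
Unset Strict Implicit.
Unset Printing Implicit Defensive.

Local Open Scope classical_set_scope.
Local Open Scope ring_scope.

(* [ent v i] is the coordinate v_i of v = (v_1, ..., v_m), numbered from 1;
   it is 0 when i is not in 1..m. *)
Definition ent (V : nmodType) (m : nat) (v : 'rV[V]_m) (i : nat) : V :=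
  if i is k.+1 then oapp (v 0) 0 (insub k) else 0.

Section Supernomial.
Variable R : fieldType.

Definition qint (n : nat) : {poly R} := \sum_(i < n) 'X^i.

Definition qfact (n : nat) : {poly R} := \prod_(i < n) qint i.+1.

(* The Euclidean division is exact, see [qbinom_fact]. *)
Definition qbinom (n k : nat) : {poly R} :=
  if (k <= n)%N then qfact n %/ (qfact k * qfact (n - k)) else 0.

(* A tuple of nonnegative integers with sum a has all its entries at most a,
   so j ranges over a finite type. *)
Definition supernomial (m : nat) (L : 'rV[nat]_m) (a : nat) : {poly R} :=
  \sum_(j : 'rV['I_a.+1]_m | (\sum_(i < m) j 0%R i == a)%N)
    let J := ent (map_mx (@nat_of_ord a.+1) j) in
    'X^(\sum_(1 <= i < m.+1) J i * (J i + \sum_(1 <= l < i) ent L l))%N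
    * \prod_(1 <= l < m.+1) qbinom (ent L l + J l.+1) (J l).

Lemma qint_neq0 n : qint n.+1 != 0.
Proof.
apply/eqP => /(congr1 (fun p : {poly R} => p`_0)) /eqP.
rewrite coef0 coef_sum big_ord_recl expr0 coef1 big1 /= ?addr0 ?oner_eq0 // => i _.
by rewrite coefXn.
Qed.

Lemma qfact_neq0 n : qfact n != 0.
Proof. by apply/prodf_neq0 => i _; exact: qint_neq0. Qed.

Lemma qintD m n : qint (m + n) = qint m + 'X^m * qint n.
Proof.
rewrite /qint big_split_ord /=; congr (_ + _).
by rewrite mulr_sumr; apply: eq_bigr => i _; rewrite exprD.
Qed.

Lemma qfactS n : qfact n.+1 = qfact n * qint n.+1.
Proof. by rewrite /qfact big_ord_recr. Qed.

Lemma qfact_dvdp j k : qfact j * qfact k %| qfact (j + k).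
Proof.
elim: j k => [|j IHj] k; first by rewrite /qfact big_ord0 mul1r dvdpp.
elim: k => [|k IHk]; first by rewrite {2}/qfact big_ord0 mulr1 addn0 dvdpp.
rewrite addnS (qfactS (j.+1 + k)).
have -> : (j.+1 + k).+1 = (j.+1 + k.+1)%N by rewrite addnS.
rewrite qintD mulrDr dvdp_add //.
  by rewrite qfactS mulrAC dvdp_mul2r ?qint_neq0 // addSnnS; exact: IHj.
rewrite mulrCA [qfact k.+1]qfactS mulrA dvdp_mull //.
by rewrite dvdp_mul2r ?qint_neq0.
Qed.

Lemma qbinom_fact n k : (k <= n)%N ->
  qbinom n k * (qfact k * qfact (n - k)) = qfact n.
Proof.
move=> kn; rewrite /qbinom kn divpK //.
by rewrite -{2}(subnKC kn) qfact_dvdp.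
Qed.

End Supernomial.

Definition central_index (m : nat) (L : 'rV[nat]_m) : nat :=
  (\sum_(1 <= i < m.+1) i * ent L i)%N./2.

Definition central_string (R : fieldType) (m : nat) (L : 'rV[nat]_m) :
  {poly R} := supernomial R L (central_index L).

Section Limits.
Variables (R : realType) (m : nat) (av : 'rV[R]_m).
Local Notation a := (ent av).

Definition limit_mean : R :=
  \sum_(1 <= i < m.+1)
    ((i%:R / 2 + i%:R ^+ 2) * (\sum_(i <= k < m.+1) a k / k.+1%:R) ^+ 2
     + i%:R * (\sum_(i <= k < m.+1) a k / k.+1%:R) * (\sum_(1 <= k < i) a k)).

(* b_ 0 = b_ m.+1 = 0 by this formula. *)
Definition b_ (i : nat) : R := i%:R * \sum_(i <= l < m.+1) a l / l.+1%:R.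

Definition f_ (i : nat) : R :=
  a i + b_ i.+1 + b_ i.-1 + 2 * b_ i + 2 * \sum_(1 <= l < i) a l.

Definition v_ : R :=
  12^-1 * \sum_(1 <= i < m.+1) (a i + b_ i.+1 - b_ i) * b_ i * (a i + b_ i.+1).

Definition sigma2 : R := 12^-1 * \sum_(1 <= k < m.+1) (k * (k + 2))%:R * a k.

Definition c_ (i : nat) : R :=
  \sum_(i <= k < m.+1) (k.+1 - i)%:R / k.+1%:R * a k.

(* This is the covariance of the Gaussian limit of (j_1, ..., j_m), conditioned
   on j_1 + ... + j_m: the unconditioned covariance of j_i with the total is
   (i / 2) c(i) and the total has variance sigma2, so the correction is
   (i c(i) / 2) (j c(j) / 2) / sigma2, with denominator 4 sigma2.  A denominator
   2 sigma2, as is found in print, is a misprint: for m = 1 the limit variance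
   would then be - 11 / 48 * a_1 ^ 3 < 0. *)
Definition Sigma (i j : nat) : R :=
  - ((i * j)%:R / (4 * sigma2) * c_ i * c_ j)
  + (minn i j)%:R * (\sum_(maxn i j <= k < m.+1) a k / k.+1%:R)
  - (i * j)%:R * (\sum_(maxn i j <= k < m.+1) a k / k.+1%:R ^+ 2).

Definition f_row : 'rV[R]_m := \row_(i < m) f_ i.+1.

Definition Sigma_mx : 'M[R]_m := \matrix_(i < m, j < m) Sigma i.+1 j.+1.

Definition limit_variance : R :=
  4^-1 * (f_row *m Sigma_mx *m f_row^T) 0 0 + v_.

End Limits.

(* The Z N need not live on the same probability space. *)
Definition cvg_in_distribution (R : realType) (d : nat -> measure_display)
    (Omega : forall N, measurableType (d N))
    (P : forall N, probability (Omega N) R)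
    (Z : forall N, Omega N -> R) (mu : probability (measurableTypeR R) R) : Prop :=
  forall x : R, {for x, continuous (fun y : R => mu `]-oo, y]%classic)} ->
    P N (Z N @^-1` `]-oo, x]%classic) @[N --> \oo] --> mu `]-oo, x]%classic.

(* E(q^X) converges for every Z_+-valued X when 0 <= q <= 1, and its values there
   determine the distribution of X. *)
Definition has_pgf (R : realType) (d : measure_display)
    (Omega : measurableType d) (P : probability Omega R)
    (X : {RV P >-> nat}) (g : R -> R) : Prop :=
  forall q : R, 0 <= q <= 1 -> ('E_P[fun w => (q ^+ X w)%R] = (g q)%:E)%E.

Definition toR (R : realType) (d : measure_display)
    (Omega : measurableType d) (P : probability Omega R)
    (X : {RV P >-> nat}) : Omega -> R := fun w => (X w)%:R.

Definition standardize (R : realType) (d : measure_display)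
    (Omega : measurableType d) (P : probability Omega R) (Y : Omega -> R) :
    Omega -> R :=
  fun w => (Y w - fine 'E_P[Y]%E) / Num.sqrt (fine 'V_P[Y]%E).

(* Main.v *)
Require Import Defs.
From mathcomp Require Import all_boot all_order all_algebra.
From mathcomp Require Import ring lra complex.
From mathcomp Require Import all_classical all_reals all_analysis.
From mathcomp Require Import measurable_realfun.
Import Order.TTheory GRing.Theory Num.Theory.
Import numFieldNormedType.Exports.
Import Normc.

Set Implicit Arguments.
Unset Strict Implicit.
Unset Printing Implicit Defensive.

Local Open Scope classical_set_scope.
Local Open Scope ring_scope.

(** Put [t = theta / N ^ (3/2)] for a real [theta].  The theorem follows once the
    moment generating function of [(X_N - mu_N) / N ^ (3/2)], with [mu_N] the
    [limit_mean] of the vector [L N] itself, is known to converge to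
    [exp (theta ^ 2 * V / 2)], where [V > 0] is [limit_variance a]: convergence of
    moment generating functions on the whole real line implies convergence of the
    first two moments and of the distribution functions ([Ex_id_cvg],
    [Ex_sqr_cvg], [cdf_cvg]).  The generating function of [X_N] is given on
    [0, 1] only, so its coefficients are first identified with the atoms of [X_N]
    ([atom_coef]); then [X_N] is bounded and its moment generating function is a
    polynomial in [exp t].

    At [q = exp t] the string function is a sum over the tuples [J] with the
    prescribed total.  A Gaussian binomial coefficient is the ordinary one times
    the moment generating function of a variable of mean [k * (n - k) / 2] and
    variance [k * (n - k) * (n + 1) / 12], whose higher cumulants are negligible
    at this scale ([horner_qbinom], [qbinom_exponent_error]).  Hence the moment
    generating function of [X_N] is close to the average of
    [exp (t * energy J + t ^ 2 / 2 * spread J)] over the tuples, taken with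
    probabilities proportional to their weights at [q = 1].  There [J] stays
    within [O (sqrt N)] of the point [b_ (L N)], so that the spread may be
    replaced by its value [v_] at that point, while the energy is linearized
    there; its value is the mean and its gradient is [f_ / 2] ([energy_expand],
    [remainder_le]).  The two terms of the limit variance are thus the variance
    [v_] of the Gaussian binomials and the variance of the linear statistic
    [f_ / 2] of the fluctuations of [J].

    It remains to prove a central limit theorem for [J] ([slice_mgf_cvg]).  The
    weight of [J] counts choices of one of the [i + 1] basis vectors in each of
    the [L_i] copies of the [(i + 1)]-dimensional module, so without the
    condition on the total [J] is a sum of independent vectors, and the
    exponential of a linear statistic still factors over the copies
    ([weight_gf]).  The condition on the total is a coefficient extraction, to
    which a local limit theorem applies, proved by Fourier inversion and
    dominated convergence ([local_limit]).  The condition removes the part of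
    the variance that is explained by the total: adding a multiple of the total
    to a linear statistic changes nothing on the slice, and the right multiple
    makes it uncorrelated with the total ([decorrelated]).  This produces the
    negative rank one term of the covariance matrix. *)

(** * Taylor remainders and limits of real sequences *)

Section TaylorRemainder.
Variable R : realType.
Implicit Types x y t : R.

Lemma series_exp_coeff_le y n : 0 <= y -> series (exp_coeff y) n <= expR y.
Proof.
move=> y0; rewrite /expR; apply: nondecreasing_cvgn_le.
  apply/nondecreasing_seqP => k; rewrite -subr_ge0 seriesSB.
  exact: exp_coeff_ge0.
exact: is_cvg_series_exp_coeff.
Qed.

(** Since [(n + k)`! >= n`! * k`!], the tail of the exponential series past rank
    [n] is at most its [n]-th term times the whole series; this controls exp,
    sin and cos at once. *)
Lemma exp_series_tail (u : nat -> R) (l : R) y n :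
  series u @ \oo --> l -> (forall k, `|u k| <= exp_coeff `|y| k) ->
  `|l - series u n| <= `|y| ^+ n / n`!%:R * expR `|y|.
Proof.
move=> ul uy; rewrite distrC.
apply: (@cvgr_to_le _ \oo _ R (fun M => `|series u n - series u M|)).
  by apply: cvg_norm; apply: cvgB => //; exact: cvg_cst.
near=> M; have nM : (n <= M)%N by near: M; exact: nbhs_infty_ge.
rewrite distrC sub_series_geq//; apply: le_trans (ler_norm_sum _ _ _) _.
have H : \sum_(n <= i < M) `|u i| <=
    `|y| ^+ n / n`!%:R * series (exp_coeff `|y|) (M - n)%N.
  rewrite /series /= -{1}(add0n n) big_addn mulr_sumr; apply: ler_sum => i _.
  apply: le_trans (uy _) _; rewrite /exp_coeff /= addnC exprD mulf_div.
  rewrite ler_wpM2l ?mulr_ge0 ?exprn_ge0//.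
  rewrite lef_pV2 ?posrE -?natrM ?ltr0n ?muln_gt0 ?fact_gt0// ler_nat.
  have /(bin_fact) := leq_addr i n; rewrite addKn => <-.
  by rewrite leq_pmull// bin_gt0 leq_addr.
apply: le_trans H _; apply: ler_wpM2l; last exact: series_exp_coeff_le.
by rewrite mulr_ge0 ?exprn_ge0 ?invr_ge0.
Unshelve. all: by end_near. Qed.

Lemma expR_taylor y n :
  `|expR y - series (exp_coeff y) n| <= `|y| ^+ n / n`!%:R * expR `|y|.
Proof.
apply: exp_series_tail => [|k]; first exact: is_cvg_series_exp_coeff.
by rewrite /exp_coeff /= normrM normrX normfV normr_nat.
Qed.

Lemma sin_taylor y n :
  `|sin y - series (sin_coeff y) n| <= `|y| ^+ n / n`!%:R * expR `|y|.
Proof.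
rewrite sin.unlock; apply: exp_series_tail => [|k]; first exact: is_cvg_series_sin_coeff.
rewrite /sin_coeff /exp_coeff /= !normrM !normrX normrN normr1 expr1n mulr1.
rewrite normfV !normr_nat.
by case: odd => /=; rewrite ?mul1r// !mul0r mulr_ge0 ?exprn_ge0 ?invr_ge0.
Qed.

Lemma cos_taylor y n :
  `|cos y - series (cos_coeff y) n| <= `|y| ^+ n / n`!%:R * expR `|y|.
Proof.
rewrite cos.unlock; apply: exp_series_tail => [|k]; first exact: is_cvg_series_cos_coeff.
rewrite /cos_coeff /exp_coeff /= !normrM -exprnP !normrX normrN normr1 expr1n mulr1.
rewrite normfV !normr_nat.
by case: odd => /=; rewrite ?mul1r// !mul0r mulr_ge0 ?exprn_ge0 ?invr_ge0.
Qed.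

Lemma divr_fact_le x n : 0 <= x -> x ^+ n / n`!%:R <= x ^+ n.
Proof.
move=> x0; rewrite ler_pdivrMr ?ltr0n ?fact_gt0// ler_peMr ?exprn_ge0//.
by rewrite ler1n fact_gt0.
Qed.

Lemma expR_taylor1 y : `|expR y - 1| <= `|y| * expR `|y|.
Proof.
have := expR_taylor y 1; rewrite /series /= big_nat1 /exp_coeff /= !fact0.
by rewrite expr0 expr1 !divr1.
Qed.

Lemma expR_taylor2 y : `|expR y - 1 - y| <= `|y| ^+ 2 * expR `|y|.
Proof.
have := expR_taylor y 2; rewrite /series /= !big_nat_recr//= big_nil add0r.
rewrite /exp_coeff /= expr0 expr1 !divr1 opprD addrA => /le_trans; apply.
apply: ler_wpM2r; first exact: expR_ge0.
exact: divr_fact_le.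
Qed.

Lemma expR_taylor3 y :
  `|expR y - 1 - y - y ^+ 2 / 2| <= `|y| ^+ 3 * expR `|y|.
Proof.
have := expR_taylor y 3; rewrite /series /= !big_nat_recr//= big_nil add0r.
rewrite /exp_coeff /= expr0 expr1 !divr1 !opprD !addrA => /le_trans; apply.
apply: ler_wpM2r; first exact: expR_ge0.
exact: divr_fact_le.
Qed.

Lemma sin_taylor3 y : `|sin y - y| <= `|y| ^+ 3 * expR `|y|.
Proof.
have := sin_taylor y 3; rewrite /series /= !big_nat_recr//= big_nil add0r.
rewrite /sin_coeff /= !expr0 expr1 !mul0r !mul1r !divr1 addr0 add0r => /le_trans; apply.
apply: ler_wpM2r; first exact: expR_ge0.
exact: divr_fact_le.
Qed.

Lemma cos_taylor3 y :
  `|cos y - 1 + y ^+ 2 / 2| <= `|y| ^+ 3 * expR `|y|.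
Proof.
have := cos_taylor y 3; rewrite /series /= !big_nat_recr//= big_nil add0r.
have -> : cos y - (cos_coeff y 0 + cos_coeff y 1 + cos_coeff y 2) =
    cos y - 1 + y ^+ 2 / 2.
  rewrite /cos_coeff /= -[0`!]/1%N -[1`!]/1%N -[2`!]/2%N !expr0z !expr1z.
  by rewrite expr0 !mul0r !mul1r; lra.
move=> /le_trans; apply.
apply: ler_wpM2r; first exact: expR_ge0.
exact: divr_fact_le.
Qed.

Lemma le_of_eq x y : x = y -> x <= y.
Proof. by move=> ->. Qed.

Lemma bernoulli_ge y n : 0 <= y -> 1 + n%:R * y <= (1 + y) ^+ n.
Proof.
move=> y0; elim: n => [|n IH]; first by rewrite mul0r addr0 expr0.
rewrite exprS -natr1; apply: le_trans (ler_wpM2l _ IH); last lra.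
have : 0 <= n%:R * y * y by rewrite !mulr_ge0.
nra.
Qed.

Lemma bernoulli_le y n : 0 <= y -> y <= 1 -> 1 - n%:R * y <= (1 - y) ^+ n.
Proof.
move=> y0 y1; elim: n => [|n IH]; first by rewrite mul0r subr0 expr0.
rewrite exprS -natr1; apply: le_trans (ler_wpM2l _ IH); last lra.
have : 0 <= n%:R * y * y by rewrite !mulr_ge0.
nra.
Qed.

Lemma cvgn_near_le (u : nat -> R) l b : u @ \oo --> l -> l < b ->
  \forall n \near \oo, u n <= b.
Proof. by move=> ul lb; exact: (cvgr_le l ul). Qed.

Lemma cvgn_ex_le (u : nat -> R) l b : u @ \oo --> l -> l < b ->
  exists n, forall k, (n <= k)%N -> u k <= b.
Proof. by move=> ul /(cvgn_near_le ul)[n _ nu]; exists n => k; exact: nu. Qed.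

End TaylorRemainder.

Section RealLimits.
Variable R : realType.

Lemma cvgn_le0 (u v : nat -> R) : v @ \oo --> 0 ->
  (\forall n \near \oo, 0 <= u n <= v n) -> u @ \oo --> 0.
Proof.
move=> v0 uv; apply: (@squeeze_cvgr _ _ _ _ (fun=> 0) v) => //.
exact: cvg_cst.
Qed.

Lemma cvgn_dist0 (u v : nat -> R) l : v @ \oo --> 0 ->
  (\forall n \near \oo, `|u n - l| <= v n) -> u @ \oo --> l.
Proof.
move=> v0 uv; apply/cvgrPdist_le => e e0.
have nv := cvgn_near_le v0 e0; near=> n.
rewrite distrC; apply: (@le_trans _ _ (v n)); near: n => //.
Unshelve. all: by end_near. Qed.

Lemma cvgn_norm0 (u v : nat -> R) : v @ \oo --> 0 ->
  (forall n, `|u n| <= v n) -> u @ \oo --> 0.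
Proof.
move=> v0 uv; apply: cvgn_dist0 v0 _; apply: nearW => n.
by rewrite subr0.
Qed.

Lemma cvgn_eq (u v : nat -> R) (l : R) : (forall n, u n = v n) ->
  v @ \oo --> l -> u @ \oo --> l.
Proof. by move=> /funext ->. Qed.

Lemma cvgn_sum I (s : seq I) (P : pred I) (F : nat -> I -> R) (l : I -> R) :
  (forall i, P i -> F ^~ i @ \oo --> l i) ->
  \sum_(i <- s | P i) F n i @[n --> \oo] --> \sum_(i <- s | P i) l i.
Proof.
move=> Fl; elim: s => [|i s IH].
  rewrite big_nil; apply: cvgn_eq (@cvg_cst _ _ _ _ _) => n; exact: big_nil.
rewrite big_cons; case: ifP => Pi; last first.
  by apply: cvgn_eq IH => n; rewrite big_cons Pi.
apply: (@cvgn_eq _ (fun n => F n i + \sum_(i <- s | P i) F n i)).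
  by move=> n; rewrite big_cons Pi.
by apply: cvgD => //; exact: Fl.
Qed.

Lemma cvgn_sum_nat (a b : nat) (F : nat -> nat -> R) (l : nat -> R) :
  (forall i, (a <= i < b)%N -> F ^~ i @ \oo --> l i) ->
  \sum_(a <= i < b) F n i @[n --> \oo] --> \sum_(a <= i < b) l i.
Proof.
move=> Fl; rewrite big_nat_cond.
apply: (cvgn_eq (fun n => big_nat_cond _ _ _ _ _ _)).
by apply: cvgn_sum => i; rewrite andbT; exact: Fl.
Qed.

Lemma cvgn_shift k (u : nat -> R) (l : R) :
  u @ \oo --> l -> u (n + k)%N @[n --> \oo] --> l.
Proof. by move=> ul; rewrite -(cvg_shiftn k) in ul. Qed.

Lemma cvgn_unshift k (u : nat -> R) (l : R) :
  u (n + k)%N @[n --> \oo] --> l -> u @ \oo --> l.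
Proof. by move=> ul; rewrite -(cvg_shiftn k). Qed.

Lemma cvgn0D (u v : nat -> R) : u @ \oo --> 0 -> v @ \oo --> 0 ->
  u n + v n @[n --> \oo] --> 0.
Proof. by move=> u0 v0; rewrite -(addr0 0); exact: cvgD. Qed.

Lemma cvgn0Ml (u : nat -> R) (c : R) : u @ \oo --> 0 -> c * u n @[n --> \oo] --> 0.
Proof. by move=> u0; rewrite -(mulr0 c); apply: cvgM => //; exact: cvg_cst. Qed.

Lemma cvgn0M (u v : nat -> R) (l : R) : u @ \oo --> 0 -> v @ \oo --> l ->
  u n * v n @[n --> \oo] --> 0.
Proof. by move=> u0 vl; rewrite -(mul0r l); exact: cvgM. Qed.

Lemma cvg_expR_comp (u : nat -> R) (a : R) : u @ \oo --> a ->
  expR (u n) @[n --> \oo] --> expR a.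
Proof. by apply: continuous_cvg; exact: continuous_expR. Qed.

Lemma cvg_cos_comp (u : nat -> R) (a : R) : u @ \oo --> a ->
  cos (u n) @[n --> \oo] --> cos a.
Proof. by apply: continuous_cvg; exact: continuous_cos. Qed.

Lemma cvg_sin_comp (u : nat -> R) (a : R) : u @ \oo --> a ->
  sin (u n) @[n --> \oo] --> sin a.
Proof. by apply: continuous_cvg; exact: continuous_sin. Qed.

Lemma cvgn_invn : n%:R^-1 @[n --> \oo] --> (0 : R).
Proof. by rewrite -cvg_shiftS; exact: cvg_harmonic. Qed.

Lemma cvgn_invsqrt : (Num.sqrt n%:R)^-1 @[n --> \oo] --> (0 : R).
Proof.
apply: (@cvgn_eq _ (fun n => Num.sqrt n%:R^-1)).
  by move=> n; rewrite sqrtrV.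
rewrite -[X in _ --> X](sqrtr0 R); apply: continuous_cvg cvgn_invn.
exact: sqrt_continuous.
Qed.

End RealLimits.

(** * Convergence of moment generating functions *)

Section ExponentialMoments.
Variable R : realType.

Definition tame (f : R -> R) := measurable_fun setT f /\
  exists C K : R, forall x, `|f x| <= C * expR (K * `|x|).

(** The condition under which all tame functions of [W] have an expectation. *)
Definition expmom d (T : measurableType d) (P : probability T R) (W : T -> R) :=
  measurable_fun setT W /\
  forall t, P.-integrable setT (fun w => (expR (t * W w))%:E).

Definition Ex d (T : measurableType d) (P : probability T R) (W : T -> R)
  (f : R -> R) : R := \int[P]_(w in setT) f (W w).

Lemma expR_norm_le (K x : R) :
  expR (K * `|x|) <= expR (K * x) + expR (- K * x).
Proof.
case: (ger0P x) => x0; first by rewrite lerDl expR_ge0.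
by rewrite mulrN mulNr lerDr expR_ge0.
Qed.

Lemma tameP f : tame f -> exists C K : R, [/\ 0 <= C, 0 <= K &
  forall x, `|f x| <= C * expR (K * `|x|)].
Proof.
move=> [_ [C [K fCK]]]; exists `|C|, `|K|; split=> // x.
apply: le_trans (fCK x) _; apply: (@le_trans _ _ (`|C| * expR (K * `|x|))).
  by rewrite ler_wpM2r ?expR_ge0 ?ler_norm.
by rewrite ler_wpM2l// ler_expR ler_wpM2r// ler_norm.
Qed.

Lemma tameM f g : tame f -> tame g -> tame (fun x => f x * g x).
Proof.
move=> tf tg; have [C1 [K1 [C10 _ f1]]] := tameP tf.
have [C2 [K2 [C20 _ g2]]] := tameP tg.
split; first by apply: measurable_funM; [exact: tf.1|exact: tg.1].
exists (C1 * C2), (K1 + K2) => x; rewrite normrM mulrDl expRD mulrACA.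
by apply: ler_pM.
Qed.

Lemma tameD f g : tame f -> tame g -> tame (fun x => f x + g x).
Proof.
move=> tf tg; have [C1 [K1 [C10 K10 f1]]] := tameP tf.
have [C2 [K2 [C20 K20 g2]]] := tameP tg.
split; first by apply: measurable_funD; [exact: tf.1|exact: tg.1].
exists (C1 + C2), (K1 + K2) => x; apply: le_trans (ler_normD _ _) _.
rewrite mulrDl; apply: lerD.
  apply: le_trans (f1 x) _; rewrite ler_wpM2l// ler_expR ler_wpM2r//.
  by rewrite lerDl.
apply: le_trans (g2 x) _; rewrite ler_wpM2l// ler_expR ler_wpM2r//.
by rewrite lerDr.
Qed.

Lemma tame_cst c : tame (fun=> c).
Proof.
split; first exact: measurable_cst.
by exists `|c|, 0 => x; rewrite mul0r expR0 mulr1.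
Qed.

Lemma tame_exp t : tame (fun x => expR (t * x)).
Proof.
split.
  by apply: measurableT_comp => //; apply: measurable_funM => //; exact: measurable_id.
exists 1, `|t| => x; rewrite mul1r ger0_norm ?expR_ge0// ler_expR -normrM.
exact: ler_norm.
Qed.

Lemma tame_id : tame id.
Proof.
split; first exact: measurable_id.
exists 1, 1 => x; rewrite !mul1r; apply: le_trans (expR_ge1Dx _).
by rewrite lerDr.
Qed.

Lemma tame_indic (A : set R) : measurable A -> tame (\1_A : R -> R).
Proof.
move=> mA; split; first exact: measurable_indic.
by exists 1, 0 => x; rewrite mul0r expR0 mulr1 ger0_norm.
Qed.

Section OneVariable.
Context d (T : measurableType d) (P : probability T R) (W : T -> R).
Hypothesis eW : expmom P W.

Lemma integrable_tame f : tame f -> P.-integrable setT (EFin \o (f \o W)).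
Proof.
move=> tf; have [C [K [C0 K0 fCK]]] := tameP tf.
have H : P.-integrable setT
    (fun w => (C%:E * ((expR (K * W w))%:E + (expR (- K * W w))%:E))%E).
  by apply: integrableZl => //; apply: integrableD => //; exact: eW.2.
apply: le_integrable H => //.
  by apply/measurable_EFinP; apply: measurableT_comp; [exact: tf.1|exact: eW.1].
move=> w _ /=; rewrite lee_fin; apply: le_trans (fCK _) _.
rewrite [leRHS]ger0_norm ?mulr_ge0 ?addr_ge0 ?expR_ge0//.
by rewrite ler_wpM2l// expR_norm_le.
Qed.

Lemma ExD f g : tame f -> tame g ->
  Ex P W (fun x => f x + g x) = Ex P W f + Ex P W g.
Proof. by move=> tf tg; apply: RintegralD => //; exact: integrable_tame. Qed.

Lemma ExZ c f : tame f -> Ex P W (fun x => c * f x) = c * Ex P W f.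
Proof. by move=> tf; apply: RintegralZl => //; exact: integrable_tame. Qed.

Lemma ler_Ex f g : tame f -> tame g -> (forall x, f x <= g x) ->
  Ex P W f <= Ex P W g.
Proof. by move=> tf tg fg; apply: le_Rintegral => //; exact: integrable_tame. Qed.

Lemma Ex_cst c : Ex P W (fun=> c) = c.
Proof.
transitivity (c * fine (P setT)); first exact: Rintegral_cst.
by rewrite probability_setT mulr1.
Qed.

Lemma Ex_indic (A : set R) : measurable A ->
  Ex P W \1_A = fine (P (W @^-1` A)).
Proof.
move=> mA; rewrite /Ex /Rintegral; congr fine.
transitivity (\int[P]_(w in setT) (\1_(W @^-1` A) w)%:E)%E.
  by apply: eq_integral => w _; rewrite !indicE; congr (_%:R%:E); apply/idP/idP;
    rewrite !inE.
rewrite integral_indic//; first by rewrite setIT.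
by rewrite -[W @^-1` A]setTI; exact: eW.1.
Qed.

(** The form in which weighted approximation enters: an error at most
    [e * expR (K `|x|)] costs at most [e] times an exponential moment. *)
Lemma Ex_dist t f g (e K : R) : tame f -> tame g -> 0 <= e ->
  (forall x, `|f x - g x| <= e * expR (K * `|x|)) ->
  `|Ex P W (fun x => expR (t * x) * f x) - Ex P W (fun x => expR (t * x) * g x)|
  <= e * (Ex P W (fun x => expR ((t + K) * x)) + Ex P W (fun x => expR ((t - K) * x))).
Proof.
move=> tf tg e0 fg.
have te := tame_exp.
rewrite -ExD// -ExZ; last exact: tameD.
have tN : tame (fun x => expR (t * x) * f x + -1 * (expR (t * x) * g x)).
  by apply: tameD; [|apply: tameM; [exact: tame_cst|]]; exact: tameM.
have -> : Ex P W (fun x => expR (t * x) * f x) - Ex P W (fun x => expR (t * x) * g x)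
    = Ex P W (fun x => expR (t * x) * f x + -1 * (expR (t * x) * g x)).
  rewrite ExD ?ExZ ?mulN1r//; try exact: tameM.
  by apply: tameM; [exact: tame_cst|exact: tameM].
apply: le_trans (le_normr_Rintegral _ (integrable_tame tN)) _ => //.
apply: le_Rintegral => //.
- exact: integrable_abse (integrable_tame tN).
- apply: (@integrable_tame
    (fun x => e * (expR ((t + K) * x) + expR ((t - K) * x)))).
  by apply: tameM; [exact: tame_cst|exact: tameD].
move=> w _ /=; rewrite mulN1r -mulrBr normrM ger0_norm ?expR_ge0//.
apply: le_trans (ler_wpM2l (expR_ge0 _) (fg _)) _.
rewrite mulrCA ler_wpM2l// !mulrDl !expRD -mulrDr ler_wpM2l ?expR_ge0//.
exact: expR_norm_le.
Qed.

End OneVariable.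

End ExponentialMoments.

Section MgfConvergence.
Variable R : realType.
Context (d_ : nat -> measure_display) (T_ : forall N, measurableType (d_ N))
  (P_ : forall N, probability (T_ N) R) (W_ : forall N, T_ N -> R)
  (d : measure_display) (T : measurableType d) (P : probability T R) (Z : T -> R).
Hypothesis eW : forall N, expmom (P_ N) (@W_ N).
Hypothesis eZ : expmom P Z.
Hypothesis mgf_cvg : forall t : R,
  Ex (P_ N) (@W_ N) (fun x => expR (t * x)) @[N --> \oo] -->
  Ex P Z (fun x => expR (t * x)).

Let conv (f : R -> R) := Ex (P_ N) (@W_ N) f @[N --> \oo] --> Ex P Z f.

Let convexp f := tame f /\ forall t, conv (fun x => expR (t * x) * f x).

(** The functions that preserve, under multiplication, the class of those whose
    exponentially tilted expectations converge.  Unlike the class itself, the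
    multipliers visibly form an algebra. *)
Let mult f := tame f /\ forall g, convexp g -> convexp (fun x => f x * g x).

Let convexpD f g : convexp f -> convexp g -> convexp (fun x => f x + g x).
Proof.
move=> [tf cf] [tg cg]; split; first exact: tameD.
move=> t; rewrite /conv.
have E d' (T' : measurableType d') (P' : probability T' R) (W : T' -> R) :
    expmom P' W -> Ex P' W (fun x => expR (t * x) * (f x + g x)) =
    Ex P' W (fun x => expR (t * x) * f x) + Ex P' W (fun x => expR (t * x) * g x).
  move=> e; rewrite -ExD//; try by apply: tameM => //; exact: tame_exp.
  by congr Ex; apply/funext => x; rewrite mulrDr.
under eq_cvg do rewrite E//.
by rewrite E//; apply: cvgD; [exact: cf|exact: cg].
Qed.

Let convexpZ c f : convexp f -> convexp (fun x => c * f x).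
Proof.
move=> [tf cf]; split; first by apply: tameM => //; exact: tame_cst.
move=> t; rewrite /conv.
have E d' (T' : measurableType d') (P' : probability T' R) (W : T' -> R) :
    expmom P' W -> Ex P' W (fun x => expR (t * x) * (c * f x)) =
    c * Ex P' W (fun x => expR (t * x) * f x).
  move=> e; rewrite -ExZ//; try by apply: tameM => //; exact: tame_exp.
  by congr Ex; apply/funext => x; rewrite mulrCA.
under eq_cvg do rewrite E//.
by rewrite E//; apply: cvgM; [exact: cvg_cst|exact: cf].
Qed.

Let convexp_lim f (K : R) : tame f ->
  (forall e : R, 0 < e -> exists2 g, convexp g &
     forall x, `|f x - g x| <= e * expR (K * `|x|)) -> convexp f.
Proof.
move=> tf fg; split=> // t; apply/cvgrPdist_le => e e0.
pose B := Ex P Z (fun x => expR ((t + K) * x)) + Ex P Z (fun x => expR ((t - K) * x)).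
have B0 : 0 <= B.
  by rewrite addr_ge0//; apply: Rintegral_ge0 => ? _; exact: expR_ge0.
have B3 : 0 < 2 * B + 2 by lra.
pose h := e / (2 * B + 2).
have h0 : 0 < h by rewrite divr_gt0.
have [g [tg cg] fgh] := fg _ h0.
have cB : (Ex (P_ N) (@W_ N) (fun x => expR ((t + K) * x)) +
    Ex (P_ N) (@W_ N) (fun x => expR ((t - K) * x))) @[N --> \oo] --> B.
  by apply: cvgD.
have /cvgrPdist_le /(_ _ h0) H2 := cg t.
have BB : B < B + 1 by lra.
have H1 := cvgn_near_le cB BB; near=> N.
have h1 : Ex (P_ N) (@W_ N) (fun x => expR ((t + K) * x)) +
    Ex (P_ N) (@W_ N) (fun x => expR ((t - K) * x)) <= B + 1.
  by near: N; exact: H1.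
have h2 : `|Ex P Z (fun x => expR (t * x) * g x) -
  Ex (P_ N) (@W_ N) (fun x => expR (t * x) * g x)| <= h by near: N.
have d1 := Ex_dist (eW N) t tf tg (ltW h0) fgh.
have d2 := Ex_dist eZ t tf tg (ltW h0) fgh.
have d3 := ler_wpM2l (ltW h0) h1.
have eh : e = h * B + h + h * (B + 1).
  by rewrite -[LHS](divfK (lt0r_neq0 B3)) -/h; ring.
rewrite eh.
set a1 := Ex P Z _ in d2 h2 *; set b1 := Ex (P_ N) _ _ in d1 h2 *.
set a2 := Ex P Z _ in d2 h2 *; set b2 := Ex (P_ N) _ _ in d1 h2 *.
rewrite (_ : _ - _ = (a1 - a2) + (a2 - b2) + - (b1 - b2)); last by ring.
apply: le_trans (ler_normD _ _) _; rewrite normrN; apply: lerD; last first.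
  exact: le_trans d1 d3.
by apply: le_trans (ler_normD _ _) _; apply: lerD.
Unshelve. all: by end_near. Qed.

Let multD f g : mult f -> mult g -> mult (fun x => f x + g x).
Proof.
move=> [tf mf] [tg mg]; split=> [|h ch]; first exact: tameD.
under eq_fun do rewrite mulrDl.
by apply: convexpD; [exact: mf|exact: mg].
Qed.

Let multZ c f : mult f -> mult (fun x => c * f x).
Proof.
move=> [tf mf]; split=> [|h ch]; first by apply: tameM => //; exact: tame_cst.
under eq_fun do rewrite -mulrA.
by apply: convexpZ; exact: mf.
Qed.

Let multM f g : mult f -> mult g -> mult (fun x => f x * g x).
Proof.
move=> [tf mf] [tg mg]; split=> [|h ch]; first exact: tameM.
under eq_fun do rewrite -mulrA.
by apply: mf; exact: mg.
Qed.

Let mult_exp t : mult (fun x => expR (t * x)).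
Proof.
split=> [|g [tg cg]]; first exact: tame_exp.
split=> [|s]; first by apply: tameM => //; exact: tame_exp.
under eq_fun do rewrite mulrA -expRD -mulrDl.
exact: cg.
Qed.

Let mult_cst c : mult (fun=> c).
Proof.
rewrite (_ : (fun=> c) = fun x => c * expR (0 * x)).
  by apply: multZ; exact: mult_exp.
by apply/funext => x; rewrite mul0r expR0 mulr1.
Qed.

Let mult_lim f (K : R) : tame f ->
  (forall e : R, 0 < e -> exists2 g, mult g &
     forall x, `|f x - g x| <= e * expR (K * `|x|)) -> mult f.
Proof.
move=> tf fg; split=> // h ch; have [th _] := ch.
have [C [L [C0 L0 hCL]]] := tameP th.
apply: (@convexp_lim _ (K + L)); first exact: tameM.
move=> e e0; have e1 : 0 < e / (C + 1) by rewrite divr_gt0//; lra.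
have [g mg fge] := fg _ e1.
exists (fun x => g x * h x); first exact: mg.2.
move=> x; rewrite -mulrBl normrM mulrDl expRD mulrA.
apply: le_trans (ler_pM _ _ (fge x) (hCL x)) _ => //.
rewrite (_ : e / (C + 1) * _ * _ =
  C / (C + 1) * (e * expR (K * `|x|) * expR (L * `|x|))); last by field; lra.
rewrite ler_piMl ?mulr_ge0 ?expR_ge0 ?(ltW e0)//.
by rewrite ler_pdivrMr; lra.
Qed.

(** The identity is the derivative at 0 of the exponentials in the multiplier
    algebra. *)
Let mult_id : mult id.
Proof.
apply: (@mult_lim _ 2); first exact: tame_id.
move=> e e0; pose h := Num.min 1 (e / 2).
have h0 : 0 < h by rewrite lt_min ltr01/=; lra.
have h1 : h <= 1 by rewrite ge_min lexx.
have h2 : h <= e / 2 by rewrite ge_min lexx orbT.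
exists (fun x => h^-1 * (expR (h * x) + -1)).
  by apply: multZ; apply: multD; [exact: mult_exp|exact: mult_cst].
move=> x; rewrite -[x in `|x - _|](mulKf (lt0r_neq0 h0)) -mulrBr normrM.
rewrite ger0_norm ?invr_ge0 ?(ltW h0)// distrC addrAC -addrA addrC -addrA.
rewrite (_ : - (h * x) + _ = expR (h * x) - 1 - h * x); last by lra.
rewrite mulrC ler_pdivrMr//; apply: le_trans (expR_taylor2 _) _.
rewrite normrM (ger0_norm (ltW h0)).
have : `|x| ^+ 2 <= 2 * expR `|x|.
  have := expR_ge1Dxn 1 (normr_ge0 x); rewrite -[2`!]/2%N; lra.
have : expR (h * `|x|) <= expR `|x| by rewrite ler_expR ler_piMl.
have := expR_ge0 `|x|; have := expR_ge0 (h * `|x|).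
rewrite mulrDl mul1r -mulr2n mulr_natl mulr2n expRD.
set a := expR `|x|; set b := expR (h * `|x|) => b0 a0 ba xa.
rewrite exprMn expr2 -!mulrA mulrC -!mulrA.
apply: le_trans (_ : h * ((`|x| ^+ 2 * b) * h) <= _); first by apply: le_of_eq; ring.
have xb : `|x| ^+ 2 * b <= (a + a) * a by apply: ler_pM => //; rewrite exprn_ge0.
apply: (@le_trans _ _ (h * ((a + a) * a * h))).
  by rewrite ler_wpM2l ?(ltW h0)// ler_wpM2r ?(ltW h0).
have aah : 0 <= a * a * h by rewrite !mulr_ge0// ltW.
nra.
Qed.

Let multX f k : mult f -> mult (fun x => f x ^+ k).
Proof.
move=> mf; elim: k => [|k IH]; first exact: mult_cst.
by under eq_fun do rewrite exprS; exact: multM.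
Qed.

Let mult_sum n (f : nat -> R -> R) : (forall k, mult (f k)) ->
  mult (fun x => \sum_(0 <= k < n) f k x).
Proof.
move=> mf; elim: n => [|n IH].
  by under eq_fun do rewrite big_nil; exact: mult_cst.
by under eq_fun do rewrite big_nat_recr//=; exact: multD.
Qed.

Let mult_tame f : mult f -> tame f. Proof. by case. Qed.

(** An entire function of exponential type is approximated by its Taylor
    polynomials, with an error uniformly small against a larger exponential. *)
Let mult_entire (u : R -> nat -> R) (f : R -> R) t :
  measurable_fun setT f -> (forall k, mult (u ^~ k)) ->
  (forall x n, `|f x - series (u x) n| <=
     `|t * x| ^+ n / n`!%:R * expR `|t * x|) -> mult f.
Proof.
move=> mf mu fu.
have tail x n : `|f x - series (u x) n| <= 2^-1 ^+ n * expR (3 * `|t| * `|x|).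
  apply: le_trans (fu x n) _.
  have -> : 3 * `|t| * `|x| = 2 * `|t * x| + `|t * x| by rewrite normrM; ring.
  rewrite expRD mulrA ler_wpM2r ?expR_ge0//.
  rewrite -(@ler_pM2l _ (2 ^+ n)) ?exprn_gt0// !mulrA -exprMn.
  rewrite -exprMn divff ?pnatr_eq0// expr1n mul1r.
  case: n => [|n].
    by rewrite expr0 divr1 -expR0 ler_expR mulr_ge0.
  apply: le_trans (expR_ge1Dxn n _); last by rewrite mulr_ge0.
  by rewrite lerDr.
apply: (@mult_lim _ (3 * `|t|)).
  split=> //; exists 1, (3 * `|t|) => x.
  by have := tail x 0; rewrite /series /= big_geq// subr0 expr0.
move=> e e0.
have [n ne] : exists n, 2^-1 ^+ n <= e.
  have h : (2^-1 : R) ^+ n @[n --> \oo] --> 0.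
    by apply: cvg_expr; rewrite ger0_norm ?invr_ge0//; lra.
  have [n /(_ n (leqnn n)) hn] := cvgn_ex_le h e0.
  by exists n.
exists (fun x => series (u x) n).
  by rewrite /series /=; exact: (@mult_sum n (fun k x => u x k)).
by move=> x; apply: le_trans (tail x n) _; rewrite ler_wpM2r ?expR_ge0.
Qed.

Let mult_monomial c t k : mult (fun x => c * (t * x) ^+ k).
Proof. by apply: multZ; apply: multX; apply: multZ; exact: mult_id. Qed.

Let mult_sin t : mult (fun x => sin (t * x)).
Proof.
apply: (@mult_entire (fun x => sin_coeff (t * x)) _ t).
- apply: (@measurableT_comp _ _ _ _ _ _ (@sin R)).
  by apply: continuous_measurable_fun; exact: continuous_sin.
  by apply: measurable_funM => //; exact: measurable_cst.
- move=> k; rewrite /sin_coeff /=.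
  by under eq_fun do rewrite mulrAC; exact: mult_monomial.
- by move=> x n; exact: sin_taylor.
Qed.

Let mult_cos t : mult (fun x => cos (t * x)).
Proof.
apply: (@mult_entire (fun x => cos_coeff (t * x)) _ t).
- apply: (@measurableT_comp _ _ _ _ _ _ (@cos R)).
  by apply: continuous_measurable_fun; exact: continuous_cos.
  by apply: measurable_funM => //; exact: measurable_cst.
- move=> k; rewrite /cos_coeff /=.
  by under eq_fun do rewrite mulrAC; exact: mult_monomial.
- by move=> x n; exact: cos_taylor.
Qed.

Let mult_cvg f : mult f -> conv f.
Proof.
move=> [tf mf].
have c1 : convexp (fun=> 1).
  split=> [|t]; first exact: tame_cst.
  have -> : (fun x => expR (t * x) * 1) = (fun x => expR (t * x)).
    by apply/funext => x; rewrite mulr1.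
  exact: mgf_cvg.
have [_ /(_ 0)] := mf _ c1.
have -> // : (fun x => expR (0 * x) * (f x * 1)) = f.
by apply/funext => x; rewrite mul0r expR0 mul1r mulr1.
Qed.

Lemma Ex_id_cvg : Ex (P_ N) (@W_ N) id @[N --> \oo] --> Ex P Z id.
Proof. exact: (mult_cvg mult_id). Qed.

Lemma Ex_sqr_cvg : Ex (P_ N) (@W_ N) (fun x => x ^+ 2) @[N --> \oo] -->
  Ex P Z (fun x => x ^+ 2).
Proof. exact: (mult_cvg (multX 2 mult_id)). Qed.

(** A smoothed indicator of a half-line inside the multiplier algebra.  The
    polynomials [(1 - y ^+ n) ^+ (2 ^ n)] tend to the indicator of
    [y < 1/2] on [0, 1], and [y] is taken to be a slow sine wave that increases
    through 1/2 at [c]; beyond a quarter period the quadratic term takes over. *)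
Let mult_step (c dl h L : R) : 0 < dl -> dl < L -> 0 < h ->
  exists2 H, mult H & forall w,
    \1_(`]-oo, c - dl]%classic : set R) w - h - (w - c) ^+ 2 / L ^+ 2 <= H w /\
    H w <= \1_(`]-oo, c + dl]%classic : set R) w + h + (w - c) ^+ 2 / L ^+ 2.
Proof.
move=> d0 dL h0.
have L0 : 0 < L by lra.
pose k := pi / 2 / L : R.
have k0 : 0 < k by rewrite !divr_gt0// pi_gt0.
pose s := sin (k * dl).
have kL : k * L = pi / 2 by rewrite /k; field; lra.
have kdl : k * dl < pi / 2 by rewrite -kL ltr_pM2l.
have s0 : 0 < s by apply: sin_gt0_pihalf; rewrite mulr_gt0.
have s1 : s <= 1 by exact: sin_le1.
have [n [n0 nh]] : exists n, (0 < n)%N /\ ((1 + s) ^+ n)^-1 <= h.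
  have q1 : `|(1 + s)^-1| < 1.
    by rewrite ger0_norm ?invr_ge0 ?invf_lt1//; lra.
  have [n hn] := cvgn_ex_le (cvg_expr q1) h0.
  by exists n.+1; split=> //; rewrite -exprVn; exact: hn.
pose y w := (1 + sin (k * (w - c))) / 2 : R.
have y0 w : 0 <= y w by rewrite /y divr_ge0//; have := sin_geN1 (k * (w - c)); lra.
have y1 w : y w <= 1 by rewrite /y; have := sin_le1 (k * (w - c)); lra.
pose H w := (1 - y w ^+ n) ^+ (2 ^ n).
have ynb w : 0 <= 1 - y w ^+ n <= 1.
  by rewrite subr_ge0 exprn_ile1// lerBlDr lerDl exprn_ge0.
have H0 w : 0 <= H w by have /andP[a b] := ynb w; exact: exprn_ge0.
have H1 w : H w <= 1 by have /andP[a b] := ynb w; exact: exprn_ile1.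
have Hup w : (1 + s) / 2 <= y w -> H w <= h.
  move=> yw; apply: le_trans nh.
  rewrite -[leRHS]mul1r ler_pdivlMr ?exprn_gt0//; last lra.
  apply: (@le_trans _ _ (H w * (1 + y w ^+ n) ^+ (2 ^ n))).
    rewrite ler_wpM2l//; apply: le_trans (_ : 1 + (2 ^ n)%:R * y w ^+ n <= _).
      rewrite natrX -exprMn; apply: le_trans (_ : (2 * y w) ^+ n <= _).
        by apply: lerXn2r; rewrite ?nnegrE; lra.
      by rewrite lerDr.
    by apply: bernoulli_ge; exact: exprn_ge0.
  rewrite /H -exprMn exprn_ile1//.
    by have /andP[a b] := ynb w; rewrite mulr_ge0// addr_ge0// exprn_ge0.
  have := exprn_ge0 n (y0 w); set z := y w ^+ n => z0; nra.
have Hlow w : y w <= (1 - s) / 2 -> 1 - h <= H w.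
  move=> yw; apply: le_trans (_ : 1 - (2 ^ n)%:R * y w ^+ n <= _).
    rewrite lerD2l lerN2 natrX -exprMn; apply: le_trans nh.
    rewrite -exprVn; apply: lerXn2r; rewrite ?nnegrE ?mulr_ge0 ?invr_ge0//; first lra.
    apply: (@le_trans _ _ (1 - s)); first lra.
    rewrite -[leRHS]mul1r ler_pdivlMr; nra.
  by apply: bernoulli_le; [exact: exprn_ge0|exact: exprn_ile1].
exists H.
  rewrite /H /y; apply: multX.
  under eq_fun do rewrite -mulN1r.
  apply: multD; first exact: mult_cst.
  apply: multZ; apply: multX; under eq_fun do rewrite mulrC.
  apply: multZ; apply: multD; first exact: mult_cst.
  under eq_fun do rewrite mulrBr sinB.
  under eq_fun do rewrite mulrC [X in _ - X]mulrC -mulNr.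
  by apply: multD; apply: multZ; [exact: mult_sin|exact: mult_cos].
have sinmon a b : - (pi / 2) <= a -> a <= b -> b <= pi / 2 -> sin a <= sin b.
  move=> h1 h2 h3; rewrite le_eqVlt; have [->|ab] := eqVneq a b; first by rewrite eqxx.
  apply/orP; right; rewrite ltr_sin ?in_itv/= ?lt_neqAle ?ab//; apply/andP; split; lra.
move=> w; have q0 : 0 <= (w - c) ^+ 2 / L ^+ 2 by rewrite divr_ge0 ?sqr_ge0.
have i1 (A : set R) x : \1_A x <= 1 :> R by rewrite indicE; case: (_ \in _).
have i0 (A : set R) x : 0 <= \1_A x :> R by rewrite indicE; case: (_ \in _).
have [wL|wL] := leP `|w - c| L; last first.
  have q1 : 1 <= (w - c) ^+ 2 / L ^+ 2.
    rewrite ler_pdivlMr ?exprn_gt0// mul1r -(real_normK (num_real (w - c))).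
    by apply: lerXn2r; rewrite ?nnegrE ?normr_ge0// ltW.
  have := i1 `]-oo, c - dl]%classic w; have := i0 `]-oo, c + dl]%classic w.
  by have := H0 w; have := H1 w; split; lra.
have := wL; rewrite ler_norml => /andP[wL1 wL2].
split.
  rewrite indicE; case: (boolP (w \in _)) => /=; last first.
    by move=> _; have := H0 w; lra.
  rewrite inE /= in_itv/= => wc.
  suff : y w <= (1 - s) / 2 by move/Hlow; lra.
  rewrite /y /s -(opprK (sin (k * dl))) -sinN.
  have : sin (k * (w - c)) <= sin (- (k * dl)).
    apply: sinmon; rewrite -?kL -?mulrN ler_pM2l//; lra.
  lra.
rewrite indicE; case: (boolP (w \in _)) => /=.
  by move=> _; have := H1 w; lra.
rewrite notin_setE /= in_itv/= => /negP; rewrite -ltNge => wc.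
suff : (1 + s) / 2 <= y w by move/Hup; lra.
rewrite /y /s.
have : sin (k * dl) <= sin (k * (w - c)).
  apply: sinmon; rewrite -?kL ?ler_pM2l//; last lra.
  by apply: (@le_trans _ _ 0); [rewrite oppr_le0 mulr_ge0 ?ltW|rewrite mulr_ge0 ?ltW].
lra.
Qed.

Let F y := fine (P (Z @^-1` `]-oo, y]%classic)).
Let F_ N y := fine (P_ N (@W_ N @^-1` `]-oo, y]%classic)).

Let tame_quad c h L : tame (fun w : R => h + (w - c) ^+ 2 / L ^+ 2).
Proof.
apply: mult_tame; apply: multD; first exact: mult_cst.
under eq_fun do rewrite mulrC.
by apply: multZ; apply: multX; apply: multD; [exact: mult_id|exact: mult_cst].
Qed.

Let cdf_sandwich c (dl e : R) : 0 < dl -> 0 < e -> \forall N \near \oo,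
  F_ N (c - dl) <= F (c + dl) + e /\ F (c - dl) <= F_ N (c + dl) + e.
Proof.
move=> d0 e0.
pose B := Ex P Z (fun x => (x - c) ^+ 2).
have mB : mult (fun x => (x - c) ^+ 2).
  by apply: multX; apply: multD; [exact: mult_id|exact: mult_cst].
have B0 : 0 <= B by apply: Rintegral_ge0 => ? _; exact: sqr_ge0.
have h0 : 0 < e / 8 by lra.
set h := e / 8 in h0.
pose L := dl + 1 + (B + 1) / h.
have q0 : 0 <= (B + 1) / h by rewrite divr_ge0 ?ltW//; lra.
have dL : dl < L by rewrite /L; lra.
have L1 : 1 <= L by rewrite /L; lra.
have LB : (B + 1) / L ^+ 2 <= h.
  rewrite ler_pdivrMr ?exprn_gt0//; last lra.
  apply: (@le_trans _ _ (h * L)).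
    have -> : B + 1 = h * ((B + 1) / h) by field; lra.
    by rewrite ler_pM2l// /L; lra.
  by rewrite ler_pM2l// expr2 ler_peMl//; lra.
have [H mH HH] := mult_step c d0 dL h0.
have tH := mult_tame mH.
have mI y : measurable (`]-oo, y]%classic : set R) by exact: measurable_itv.
have tI y := tame_indic (mI y).
have tq := tame_quad c h L.
have up d' (T' : measurableType d') (P' : probability T' R) (W : T' -> R) :
    expmom P' W -> Ex P' W H <= fine (P' (W @^-1` `]-oo, c + dl]%classic)) +
      (h + Ex P' W (fun x => (x - c) ^+ 2) / L ^+ 2) /\
    fine (P' (W @^-1` `]-oo, c - dl]%classic)) <= Ex P' W H +
      (h + Ex P' W (fun x => (x - c) ^+ 2) / L ^+ 2).
  move=> ep; have Eq : Ex P' W (fun x => h + (x - c) ^+ 2 / L ^+ 2) =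
      h + Ex P' W (fun x => (x - c) ^+ 2) / L ^+ 2.
    have := ExD ep (tame_cst h) (tameM (mult_tame mB) (tame_cst (L ^+ 2)^-1)).
    move=> ->; rewrite Ex_cst//; congr (_ + _).
    under eq_fun do rewrite mulrC.
    by rewrite ExZ; [exact: mulrC|by []|exact: mult_tame].
  rewrite -!Ex_indic// -Eq -!ExD//; split; apply: ler_Ex => //; try exact: tameD.
    by move=> w; have [_] := HH w; rewrite addrA.
  by move=> w; have [] := HH w; lra.
have BB : B < B + 1 by lra.
have nB := cvgn_near_le (mult_cvg mB) BB.
have /cvgrPdist_le /(_ _ h0) nH := mult_cvg mH.
near=> N.
have h1 : Ex (P_ N) (@W_ N) (fun x => (x - c) ^+ 2) <= B + 1 by near: N; exact: nB.
have h2 : `|Ex P Z H - Ex (P_ N) (@W_ N) H| <= h by near: N; exact: nH.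
have [u1 u2] := up _ _ _ _ eZ; have [u3 u4] := up _ _ _ _ (eW N).
move: h2; rewrite ler_norml => /andP[h2 h3].
have L20 : 0 < L ^+ 2 by rewrite exprn_gt0//; lra.
have v1 : B / L ^+ 2 <= h by apply: le_trans LB; rewrite ler_pM2r ?invr_gt0//; lra.
have v2 : Ex (P_ N) (@W_ N) (fun x => (x - c) ^+ 2) / L ^+ 2 <= h.
  by apply: le_trans LB; rewrite ler_pM2r ?invr_gt0.
rewrite -/B in u1 u2; rewrite /F /F_.
have -> : e = 8 * h by rewrite /h; field.
by split; lra.
Unshelve. all: by end_near. Qed.

Let F_mono_ N y z : y <= z -> F_ N y <= F_ N z.
Proof.
move=> yz; rewrite /F_ -!Ex_indic//; try exact: measurable_itv.
apply: ler_Ex => //; try by apply: tame_indic; exact: measurable_itv.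
move=> x; rewrite !indicE ler_nat; case: (boolP (x \in `]-oo, y]%classic)) => //.
by rewrite !inE /= !in_itv/= => xy; rewrite mem_set//= in_itv/= (le_trans xy yz).
Qed.

(** The points [x_ N] may move because a variable that is standardized with its
    exact mean and variance passes [x] when the variable rescaled with their
    predicted values passes a nearby point. *)
Theorem cdf_cvg (x_ : nat -> R) x : x_ @ \oo --> x ->
  {for x, continuous (fun y => fine (P (Z @^-1` `]-oo, y]%classic)))} ->
  fine (P_ N (@W_ N @^-1` `]-oo, x_ N]%classic)) @[N --> \oo] -->
  fine (P (Z @^-1` `]-oo, x]%classic)).
Proof.
move=> xx cF; apply/cvgrPdist_le => e e0.
have e2 : 0 < e / 2 by lra.
have /cvgrPdist_le /(_ _ e2) := cF => -[r /= r0 Fr].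
have r4 : 0 < r / 4 by lra.
have /cvgrPdist_le /(_ _ r4) nx := xx.
have n1 := cdf_sandwich (x + r / 2) r4 e2.
have n2 := cdf_sandwich (x - r / 2) r4 e2.
near=> N.
have : `|x - x_ N| <= r / 4 by near: N; exact: nx.
rewrite ler_norml => /andP[x1 x2].
have [h1 _] : F_ N (x + r / 2 - r / 4) <= F (x + r / 2 + r / 4) + e / 2 /\
   F (x + r / 2 - r / 4) <= F_ N (x + r / 2 + r / 4) + e / 2 by near: N; exact: n1.
have [_ h2] : F_ N (x - r / 2 - r / 4) <= F (x - r / 2 + r / 4) + e / 2 /\
   F (x - r / 2 - r / 4) <= F_ N (x - r / 2 + r / 4) + e / 2 by near: N; exact: n2.
have a1 : F_ N (x_ N) <= F_ N (x + r / 2 - r / 4) by apply: F_mono_; lra.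
have a2 : F_ N (x - r / 2 + r / 4) <= F_ N (x_ N) by apply: F_mono_; lra.
have b1 : `|F x - F (x + r / 2 + r / 4)| <= e / 2.
  by apply: Fr; rewrite /= ltr_norml; apply/andP; split; lra.
have b2 : `|F x - F (x - r / 2 - r / 4)| <= e / 2.
  by apply: Fr; rewrite /= ltr_norml; apply/andP; split; lra.
move: b1 b2; rewrite !ler_norml -/(F x) -/(F_ N (x_ N)).
by move=> /andP[b1 b1'] /andP[b2 b2']; apply/andP; split; lra.
Unshelve. all: by end_near. Qed.

End MgfConvergence.

(** * Complex exponentials *)

Section ComplexExponential.
Variable R : realType.
Local Notation C := (complex R).
Local Notation Re := (@complex.Re R).
Local Notation Im := (@complex.Im R).
Implicit Types z w : C.

Definition cis (u : R) : C := Complex (cos u) (sin u).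
Definition cexp (a b : R) : C := Complex (expR a * cos b) (expR a * sin b).

Lemma cexpD a b a' b' : cexp (a + a') (b + b') = cexp a b * cexp a' b'.
Proof.
apply/eqP; rewrite eq_complex /= expRD cosD sinD; apply/andP; split; apply/eqP; ring.
Qed.

Lemma cexp0 : cexp 0 0 = 1.
Proof. by rewrite /cexp expR0 cos0 sin0 mul1r mulr0. Qed.

Lemma cisE u : cis u = cexp 0 u.
Proof. by rewrite /cexp expR0 !mul1r. Qed.

Lemma cexp_sum I (s : seq I) (P : pred I) (F G : I -> R) :
  cexp (\sum_(i <- s | P i) F i) (\sum_(i <- s | P i) G i) =
  \prod_(i <- s | P i) cexp (F i) (G i).
Proof.
elim: s => [|x s IH]; first by rewrite !big_nil cexp0.
by rewrite !big_cons; case: ifP => _; rewrite ?cexpD IH.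
Qed.

Lemma cexpX a b n : cexp a b ^+ n = cexp (n%:R * a) (n%:R * b).
Proof.
elim: n => [|n IH]; first by rewrite !mul0r cexp0.
by rewrite exprSr IH -cexpD -natr1 !mulrDl !mul1r.
Qed.

Lemma cisX u n : cis u ^+ n = cis (n%:R * u).
Proof. by rewrite !cisE cexpX mulr0. Qed.

Lemma normc_cexp a b : normc (cexp a b) = expR a.
Proof.
rewrite /normc /= !exprMn -mulrDr cos2Dsin2 mulr1 sqrtr_sqr.
by rewrite ger0_norm ?expR_ge0.
Qed.

Lemma normc_cis u : normc (cis u) = 1.
Proof. by rewrite cisE normc_cexp expR0. Qed.

Lemma normcX z n : normc (z ^+ n) = normc z ^+ n.
Proof.
by elim: n => [|n IH]; rewrite ?expr0 ?normc1// !exprS normcM IH.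
Qed.

Lemma normc_ge0 z : 0 <= normc z.
Proof. by case: z => a b; exact: sqrtr_ge0. Qed.

Lemma normc_prod I (s : seq I) (P : pred I) (F : I -> C) :
  normc (\prod_(i <- s | P i) F i) = \prod_(i <- s | P i) normc (F i).
Proof.
elim: s => [|x s IH]; first by rewrite !big_nil normc1.
by rewrite !big_cons; case: ifP => _; rewrite ?normcM IH.
Qed.

Lemma normc_sum I (s : seq I) (P : pred I) (F : I -> C) :
  normc (\sum_(i <- s | P i) F i) <= \sum_(i <- s | P i) normc (F i).
Proof.
elim: s => [|x s IH]; first by rewrite !big_nil normc0.
rewrite !big_cons; case: ifP => _ //.
by apply: le_trans (le_normcD _ _) _; rewrite lerD2l.
Qed.

Lemma normc_real (x : R) : normc (Complex x 0) = `|x|.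
Proof. by rewrite /normc expr0n addr0 sqrtr_sqr. Qed.

Lemma Re_le_normc z : `|Re z| <= normc z.
Proof.
case: z => a b /=; rewrite -sqrtr_sqr ler_wsqrtr// lerDl; exact: sqr_ge0.
Qed.

Lemma Im_le_normc z : `|Im z| <= normc z.
Proof.
case: z => a b /=; rewrite -sqrtr_sqr ler_wsqrtr// lerDr; exact: sqr_ge0.
Qed.

Lemma normc_le z : normc z <= `|Re z| + `|Im z|.
Proof.
case: z => a b /=; rewrite -[leRHS]ger0_norm ?addr_ge0// -sqrtr_sqr ler_wsqrtr//.
rewrite -(real_normK (num_real a)) -(real_normK (num_real b)).
have := mulr_ge0 (normr_ge0 a) (normr_ge0 b); nra.
Qed.

Lemma ReD z w : Re (z + w) = Re z + Re w. Proof. by case: z w => a b []. Qed.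
Lemma ImD z w : Im (z + w) = Im z + Im w. Proof. by case: z w => a b []. Qed.
Lemma ReB z w : Re (z - w) = Re z - Re w. Proof. by case: z w => a b []. Qed.
Lemma ImB z w : Im (z - w) = Im z - Im w. Proof. by case: z w => a b []. Qed.
Lemma ReM z w : Re (z * w) = Re z * Re w - Im z * Im w.
Proof. by case: z w => a b []. Qed.
Lemma ImM z w : Im (z * w) = Re z * Im w + Im z * Re w.
Proof. by case: z w => a b []. Qed.

Lemma Re_sum I (s : seq I) (P : pred I) (F : I -> C) :
  Re (\sum_(i <- s | P i) F i) = \sum_(i <- s | P i) Re (F i).
Proof. by elim/big_rec2 : _ => // i x y _ <-; rewrite ReD. Qed.

Lemma Im_sum I (s : seq I) (P : pred I) (F : I -> C) :
  Im (\sum_(i <- s | P i) F i) = \sum_(i <- s | P i) Im (F i).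
Proof. by elim/big_rec2 : _ => // i x y _ <-; rewrite ImD. Qed.

Lemma cexp_taylor : exists2 K : R, 0 <= K & forall a b, `|a| + `|b| <= 1 ->
  `|expR a * cos b - (1 + a + (a ^+ 2 - b ^+ 2) / 2)| <= K * (`|a| + `|b|) ^+ 3 /\
  `|expR a * sin b - (b + a * b)| <= K * (`|a| + `|b|) ^+ 3.
Proof.
pose e := expR 1 : R; have e0 : 0 <= e by exact: expR_ge0.
exists (1 + 4 * e + e ^+ 2); first by rewrite !addr_ge0 ?exprn_ge0//; lra.
move=> a b; have := normr_ge0 a; have := normr_ge0 b.
set M := `|a| + `|b| => b0 a0 M1.
have M0 : 0 <= M by rewrite /M; lra.
have aM : `|a| <= M by rewrite /M; lra.
have bM : `|b| <= M by rewrite /M; lra.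
have pw (x : R) n : `|x| <= M -> `|x| ^+ n * expR `|x| <= M ^+ n * e.
  move=> xM; apply: ler_pM; rewrite ?exprn_ge0 ?expR_ge0//.
    by apply: lerXn2r; rewrite ?nnegrE.
  by rewrite ler_expR; lra.
have r1 := le_trans (expR_taylor3 a) (pw _ 3%N aM).
have r2 := le_trans (cos_taylor3 b) (pw _ 3%N bM).
have r3 := le_trans (sin_taylor3 b) (pw _ 3%N bM).
have r4 := le_trans (expR_taylor2 a) (pw _ 2%N aM).
have c1 := cos_max b.
have ea : expR a <= e by rewrite ler_expR; have := ler_norm a; lra.
have M3 : 0 <= M ^+ 3 by rewrite exprn_ge0.
split.
  set r := expR a - 1 - a - a ^+ 2 / 2 in r1.
  set t := cos b - 1 + b ^+ 2 / 2 in r2.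
  have -> : expR a * cos b - (1 + a + (a ^+ 2 - b ^+ 2) / 2) =
    r * cos b + (1 + a + a ^+ 2 / 2) * t + - (a * b ^+ 2 / 2) +
    - (a ^+ 2 * b ^+ 2 / 4) by rewrite /r /t; field.
  have x1 : `|r * cos b| <= M ^+ 3 * e.
    rewrite normrM -[leRHS]mulr1; exact: ler_pM.
  have x2 : `|(1 + a + a ^+ 2 / 2) * t| <= 3 * (M ^+ 3 * e).
    rewrite normrM; apply: ler_pM => //.
    have : `|a ^+ 2 / 2| <= 1.
      rewrite normrM normrX (_ : `|2^-1| = 2^-1 :> R); last by rewrite ger0_norm.
      have : `|a| ^+ 2 <= 1 by rewrite exprn_ile1//; lra.
      lra.
    have := ler_normD (1 + a) (a ^+ 2 / 2); have := ler_normD 1 a.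
    rewrite normr1; lra.
  have x3 : `|a * b ^+ 2 / 2| <= M ^+ 3 / 2.
    rewrite (normrM _ 2^-1) (normrM a) normrX (_ : `|2^-1| = 2^-1 :> R); last by rewrite ger0_norm.
    rewrite ler_pM2r// (exprS M 2); apply: ler_pM => //.
    by apply: lerXn2r; rewrite ?nnegrE.
  have x4 : `|a ^+ 2 * b ^+ 2 / 4| <= M ^+ 3 / 4.
    rewrite (normrM _ 4^-1) (normrM (a ^+ 2)) !normrX (_ : `|4^-1| = 4^-1 :> R); last by rewrite ger0_norm.
    rewrite ler_pM2r// (exprSr M 2); apply: ler_pM; rewrite ?exprn_ge0//.
      by apply: lerXn2r; rewrite ?nnegrE.
    by apply: le_trans (bM); rewrite expr2 ler_piMl// (le_trans bM M1).
  have e2 : 0 <= e ^+ 2 * M ^+ 3 by rewrite mulr_ge0 ?exprn_ge0.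
  apply: (@le_trans _ _ (M ^+ 3 * e + 3 * (M ^+ 3 * e) + M ^+ 3 / 2 + M ^+ 3 / 4)).
    do 2 (apply: le_trans (ler_normD _ _) _; rewrite normrN; apply: lerD => //).
    by apply: le_trans (ler_normD _ _) _; apply: lerD.
  lra.
have -> : expR a * sin b - (b + a * b) =
  expR a * (sin b - b) + b * (expR a - 1 - a) by ring.
have x1 : `|expR a * (sin b - b)| <= e * (M ^+ 3 * e).
  by rewrite normrM (ger0_norm (expR_ge0 a)); apply: ler_pM => //; exact: expR_ge0.
have x2 : `|b * (expR a - 1 - a)| <= M * (M ^+ 2 * e).
  by rewrite normrM; apply: ler_pM.
apply: le_trans (ler_normD _ _) _; apply: le_trans (lerD x1 x2) _.
have : 0 <= e * M ^+ 3 by rewrite mulr_ge0.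
rewrite !exprS expr0 mulr1; nra.
Qed.

End ComplexExponential.

(** * Powers close to one *)

Section ComplexLimits.
Variable R : realType.
Local Notation C := (complex R).
Local Notation Re := (@complex.Re R).
Local Notation Im := (@complex.Im R).

(** Convergence is taken coordinatewise, so that only real limits occur. *)
Definition ccvg (z : nat -> C) (l : C) :=
  Re (z N) @[N --> \oo] --> Re l /\ Im (z N) @[N --> \oo] --> Im l.

Lemma ccvg_cst l : ccvg (fun=> l) l. Proof. by split; exact: cvg_cst. Qed.

Lemma ccvgM z w k l : ccvg z k -> ccvg w l -> ccvg (fun N => z N * w N) (k * l).
Proof.
move=> [z1 z2] [w1 w2]; split.
  rewrite ReM; apply: (cvgn_eq (fun n => ReM _ _)).
  by apply: cvgB; exact: cvgM.
rewrite ImM; apply: (cvgn_eq (fun n => ImM _ _)).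
by apply: cvgD; exact: cvgM.
Qed.

Lemma ccvg_prod_nat (a b : nat) (F : nat -> nat -> C) (l : nat -> C) :
  (forall i, (a <= i < b)%N -> ccvg (F ^~ i) (l i)) ->
  ccvg (fun N => \prod_(a <= i < b) F N i) (\prod_(a <= i < b) l i).
Proof.
move=> Fl; rewrite big_nat_cond.
rewrite (_ : (fun N => _) = fun N => \prod_(a <= i < b | (a <= i < b)%N && true) F N i).
  elim: (index_iota a b) => [|i s IH].
    by rewrite big_nil; under eq_fun do rewrite big_nil; exact: ccvg_cst.
  rewrite big_cons; under eq_fun do rewrite big_cons.
  case: ifP => //; rewrite andbT => abi; apply: ccvgM => //; exact: Fl.
by apply/funext => N; rewrite big_nat_cond.
Qed.

Lemma ccvg_cexp (u v : nat -> R) (a b : R) : u @ \oo --> a -> v @ \oo --> b ->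
  ccvg (fun N => cexp (u N) (v N)) (cexp a b).
Proof.
move=> ua vb.
by split=> /=; apply: cvgM; [exact: cvg_expR_comp|exact: cvg_cos_comp|
  exact: cvg_expR_comp|exact: cvg_sin_comp].
Qed.

Lemma ccvg_close z w l : normc (z N - w N) @[N --> \oo] --> 0 ->
  ccvg w l -> ccvg z l.
Proof.
move=> zw [w1 w2]; split.
  rewrite -[Re l]addr0 (_ : (fun N => _) = fun N => Re (w N) + Re (z N - w N)).
    apply: cvgD => //; apply: cvgn_norm0 zw _ => N; exact: Re_le_normc.
  by apply/funext => N; rewrite ReB addrC subrK.
rewrite -[Im l]addr0 (_ : (fun N => _) = fun N => Im (w N) + Im (z N - w N)).
  apply: cvgD => //; apply: cvgn_norm0 zw _ => N; exact: Im_le_normc.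
by apply/funext => N; rewrite ImB addrC subrK.
Qed.

Lemma normc_subX (z w : C) (M : R) n : 1 <= M -> normc z <= M -> normc w <= M ->
  normc (z ^+ n - w ^+ n) <= n%:R * normc (z - w) * M ^+ n.
Proof.
move=> M1 zM wM; have M0 : 0 <= M by lra.
elim: n => [|n IH]; first by rewrite !expr0 subrr normc0 !mul0r.
have -> : z ^+ n.+1 - w ^+ n.+1 = z * (z ^+ n - w ^+ n) + (z - w) * w ^+ n.
  by rewrite !exprS; ring.
apply: le_trans (le_normcD _ _) _; rewrite !normcM.
rewrite -natr1 !mulrDl mul1r; apply: lerD.
  apply: (@le_trans _ _ (M * (n%:R * normc (z - w) * M ^+ n))).
    by apply: ler_pM; rewrite ?normc_ge0.
  by rewrite exprS mulrCA.
apply: ler_pM; rewrite ?normc_ge0// normcX.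
apply: (@le_trans _ _ (M ^+ n)); first by apply: lerXn2r; rewrite ?nnegrE ?normc_ge0.
by rewrite exprS ler_peMl ?exprn_ge0.
Qed.

(** The complex form of [(1 + c / N) ^+ L -> exp (alpha * c)] for [L / N -> alpha],
    by comparison with the powers of [exp (c / N)]. *)
Lemma ccvg_pow (z : nat -> C) (c : C) (L : nat -> nat) (al : R) :
  N%:R * (Re (z N) - 1) @[N --> \oo] --> Re c ->
  N%:R * Im (z N) @[N --> \oo] --> Im c ->
  (L N)%:R / N%:R @[N --> \oo] --> al ->
  ccvg (fun N => z N ^+ L N) (cexp (al * Re c) (al * Im c)).
Proof.
move=> z1 z2 La; case: c z1 z2 => p q /= z1 z2.
pose w N := cexp (p / N%:R) (q / N%:R).
have inv0 := @cvgn_invn R.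
have wX N : w N ^+ L N = cexp ((L N)%:R / N%:R * p) ((L N)%:R / N%:R * q).
  by rewrite /w cexpX; congr cexp; ring.
apply: (@ccvg_close _ (fun N => w N ^+ L N)); last first.
  under eq_fun do rewrite wX.
  by apply: ccvg_cexp; apply: cvgM => //; exact: cvg_cst.
have [K K0 ct] := cexp_taylor R.
pose B := (`|p| + `|q|) : R; have B0 : 0 <= B by rewrite addr_ge0.
have small : \forall N \near \oo, B / N%:R <= 1.
  by apply: cvgn_near_le (_ : B * 0 < 1); [apply: cvgM => //; exact: cvg_cst|rewrite mulr0].
have w12 : N%:R * (Re (w N) - 1) @[N --> \oo] --> p /\
           N%:R * Im (w N) @[N --> \oo] --> q.
  pose er (N : nat) := `|(p ^+ 2 - q ^+ 2) / 2| * N%:R^-1 + `|p * q| * N%:R^-1 +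
      K * B ^+ 3 * (N%:R^-1 * N%:R^-1).
  have e0 : er N @[N --> \oo] --> 0.
    apply: cvgn0D; last by apply: cvgn0Ml; exact: (cvgn0M inv0 inv0).
    by apply: cvgn0D; exact: cvgn0Ml.
  suff H : \forall N \near \oo, `|N%:R * (Re (w N) - 1) - p| <= er N /\
      `|N%:R * Im (w N) - q| <= er N.
    by split; apply: cvgn_dist0 e0 _; apply: filterS H => N [].
  near=> N; rewrite /er.
  have N0 : 0 < N%:R :> R by rewrite ltr0n; near: N; exact: nbhs_infty_gt.
  have Nn0 : N%:R != 0 :> R by rewrite gt_eqF.
  have BN : `|p / N%:R| + `|q / N%:R| = B / N%:R.
    by rewrite !normrM !normfV normr_nat mulrDl.
  have BN1 : `|p / N%:R| + `|q / N%:R| <= 1 by rewrite BN; near: N; exact: small.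
  have [t1 t2] := ct _ _ BN1; rewrite BN in t1 t2.
  have nn (x : R) : `|N%:R * x| = N%:R * `|x| by rewrite normrM normr_nat.
  have K3 : N%:R * (K * (B / N%:R) ^+ 3) = K * B ^+ 3 * (N%:R^-1 * N%:R^-1).
    by field.
  have n1 : 0 <= `|(p ^+ 2 - q ^+ 2) / 2| * N%:R^-1 by rewrite mulr_ge0 ?invr_ge0.
  have n2 : 0 <= `|p * q| * N%:R^-1 by rewrite mulr_ge0 ?invr_ge0.
  split.
    have -> : N%:R * (Re (w N) - 1) - p = (p ^+ 2 - q ^+ 2) / 2 * N%:R^-1 +
       N%:R * (expR (p / N%:R) * cos (q / N%:R) -
         (1 + p / N%:R + ((p / N%:R) ^+ 2 - (q / N%:R) ^+ 2) / 2)).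
      by rewrite /w /=; field.
    apply: le_trans (ler_normD _ _) _; rewrite nn.
    have := ler_wpM2l (ltW N0) t1; rewrite K3.
    rewrite [`|_ * N%:R^-1|]normrM normfV normr_nat; lra.
  have -> : N%:R * Im (w N) - q = p * q * N%:R^-1 +
       N%:R * (expR (p / N%:R) * sin (q / N%:R) -
         (q / N%:R + (p / N%:R) * (q / N%:R))).
    by rewrite /w /=; field.
  apply: le_trans (ler_normD _ _) _; rewrite nn.
  have := ler_wpM2l (ltW N0) t2; rewrite K3.
  rewrite [`|_ * N%:R^-1|]normrM normfV normr_nat; lra.
have [w1 w2] := w12.
(* Both bases have modulus at most [exp (G / N)], so the powers stay bounded. *)
pose G := B + 2.
have bound (y : nat -> C) : N%:R * (Re (y N) - 1) @[N --> \oo] --> p ->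
    N%:R * Im (y N) @[N --> \oo] --> q ->
    \forall N \near \oo, normc (y N) <= expR (G / N%:R).
  move=> y1 y2.
  have yy : (`|N%:R * (Re (y N) - 1)| + `|N%:R * Im (y N)|) @[N --> \oo] --> B.
    by apply: cvgD; exact: cvg_norm.
  have BG : B < G by rewrite /G; lra.
  have nyy := cvgn_near_le yy BG; near=> N.
  have N0 : 0 < N%:R :> R by rewrite ltr0n; near: N; exact: nbhs_infty_gt.
  have h : `|N%:R * (Re (y N) - 1)| + `|N%:R * Im (y N)| <= G by near: N; exact: nyy.
  apply: le_trans (expR_ge1Dx _); rewrite -[y N](subrK 1) addrC.
  apply: le_trans (le_normcD _ _) _; rewrite normc1 lerD2l.
  apply: le_trans (normc_le _) _; rewrite ler_pdivlMr// mulrC mulrDr.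
  by rewrite ReB ImB /= subr0 -[X in X * _ + _](normr_nat R) -[X in _ + X * _](normr_nat R) -!normrM.
have zw : (`|N%:R * (Re (z N) - 1) - N%:R * (Re (w N) - 1)| +
   `|N%:R * Im (z N) - N%:R * Im (w N)|) @[N --> \oo] --> (0 : R).
  rewrite -[X in _ --> X](_ : `|p - p| + `|q - q| = 0); last first.
    by rewrite !subrr normr0 addr0.
  by apply: cvgD; apply: cvg_norm; apply: cvgB.
have big : ((L N)%:R / N%:R * (`|N%:R * (Re (z N) - 1) - N%:R * (Re (w N) - 1)| +
   `|N%:R * Im (z N) - N%:R * Im (w N)|) * expR (G * ((L N)%:R / N%:R)))
     @[N --> \oo] --> (0 : R).
  rewrite -[X in _ --> X](_ : al * 0 * expR (G * al) = 0); last by rewrite mulr0 mul0r.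
  apply: cvgM; first by apply: cvgM.
  apply: cvg_expR_comp.
  by apply: cvgM => //; exact: cvg_cst.
apply: cvgn_le0 big _.
have bz := bound _ z1 z2; have bw := bound _ w1 w2.
near=> N.
have N0 : 0 < N%:R :> R by rewrite ltr0n; near: N; exact: nbhs_infty_gt.
have E1 : 1 <= expR (G / N%:R).
  by rewrite -expR0 ler_expR divr_ge0// /G; lra.
have q1 : normc (z N) <= expR (G / N%:R) by near: N; exact: bz.
have q2 : normc (w N) <= expR (G / N%:R) by near: N; exact: bw.
rewrite normc_ge0/=; apply: le_trans (normc_subX (L N) E1 q1 q2) _.
rewrite -expRM_natl (_ : (L N)%:R * (G / N%:R) = G * ((L N)%:R / N%:R)); last by ring.
rewrite ler_wpM2r ?expR_ge0// -mulrA ler_wpM2l// mulrC ler_pdivlMr//.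
apply: le_trans (ler_wpM2r (ltW N0) (normc_le _)) _.
rewrite ReB ImB mulrDl.
have nn (x y : R) : `|N%:R * x - N%:R * y| = `|x - y| * N%:R.
  by rewrite -mulrBr normrM normr_nat mulrC.
by rewrite !nn opprB addrA subrK.
Unshelve. all: by end_near. Qed.

End ComplexLimits.

(** * A local limit theorem *)

Section LocalLimit.
Variable R : realType.
Local Notation C := (complex R).
Local Notation Re := (@complex.Re R).
Local Notation Im := (@complex.Im R).
Local Notation mu := (@lebesgue_measure R).

Definition avg (i : nat) (f : nat -> R) : R := i.+1%:R^-1 * \sum_(r < i.+1) f r.

Definition rt (N : nat) : R := Num.sqrt N%:R.

Lemma rt_gt0 N : (0 < N)%N -> 0 < rt N.
Proof. by move=> N0; rewrite sqrtr_gt0 ltr0n. Qed.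

Lemma rt_sqr N : rt N ^+ 2 = N%:R. Proof. by rewrite sqr_sqrtr. Qed.

(** The first-order terms are subtracted because they average to 0 over a
    centered summand. *)
Lemma cexp_second_order (h u : R) :
  N%:R * (expR (h / rt N) * cos (u / rt N) - 1 - h / rt N) @[N --> \oo] -->
    (h ^+ 2 - u ^+ 2) / 2 /\
  N%:R * (expR (h / rt N) * sin (u / rt N) - u / rt N) @[N --> \oo] --> h * u.
Proof.
have [K K0 ct] := cexp_taylor R.
pose B := `|h| + `|u|; have B0 : 0 <= B by rewrite addr_ge0.
have small : \forall N \near \oo, B * (rt N)^-1 <= 1.
  apply: cvgn_near_le (_ : 0 < 1) => //; apply: cvgn0Ml; exact: cvgn_invsqrt.
have e0 : K * B ^+ 3 * (rt N)^-1 @[N --> \oo] --> 0.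
  by apply: cvgn0Ml; exact: cvgn_invsqrt.
suff H : \forall N \near \oo,
    `|N%:R * (expR (h / rt N) * cos (u / rt N) - 1 - h / rt N) -
      (h ^+ 2 - u ^+ 2) / 2| <= K * B ^+ 3 * (rt N)^-1 /\
    `|N%:R * (expR (h / rt N) * sin (u / rt N) - u / rt N) - h * u| <=
      K * B ^+ 3 * (rt N)^-1.
  by split; apply: cvgn_dist0 e0 _; apply: filterS H => N [].
near=> N.
have N0 : (0 < N)%N by near: N; exact: nbhs_infty_gt.
have r0 := rt_gt0 N0; have rn0 : rt N != 0 by rewrite gt_eqF.
have BN : `|h / rt N| + `|u / rt N| = B * (rt N)^-1.
  by rewrite !normrM normfV (ger0_norm (ltW r0)) mulrDl.
have BN1 : `|h / rt N| + `|u / rt N| <= 1 by rewrite BN; near: N; exact: small.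
have [t1 t2] := ct _ _ BN1; rewrite BN in t1 t2.
have nn (x : R) : `|N%:R * x| = N%:R * `|x| by rewrite normrM normr_nat.
have K3 : N%:R * (K * (B * (rt N)^-1) ^+ 3) = K * B ^+ 3 * (rt N)^-1.
  by rewrite -(rt_sqr N); field.
split; rewrite -K3.
  apply: le_trans (ler_wpM2l _ t1) => //; rewrite -nn; apply: le_of_eq.
  by congr `|_|; rewrite -(rt_sqr N); field.
apply: le_trans (ler_wpM2l _ t2) => //; rewrite -nn; apply: le_of_eq.
by congr `|_|; rewrite -(rt_sqr N); field.
Unshelve. all: by end_near. Qed.

Lemma avgD i f g : avg i (fun r => f r + g r) = avg i f + avg i g.
Proof. by rewrite /avg big_split mulrDr. Qed.

Lemma avgZ i c f : avg i (fun r => c * f r) = c * avg i f.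
Proof. by rewrite /avg -mulr_sumr mulrCA. Qed.

Lemma eq_avg i f g : (forall r, f r = g r) -> avg i f = avg i g.
Proof. by move=> fg; rewrite /avg; congr (_ * _); apply: eq_bigr => r _. Qed.

Lemma avg_cst i c : avg i (fun=> c) = c.
Proof.
by rewrite /avg sumr_const card_ord -[c *+ _]mulr_natl mulKf// pnatr_eq0.
Qed.

Lemma sum_nat_ord n : \sum_(i < n.+1) i%:R = n%:R * n.+1%:R / 2 :> R.
Proof.
elim: n => [|n IH]; first by rewrite big_ord1 !mul0r.
by rewrite big_ord_recr /= IH -!natr1; field.
Qed.

Lemma sum_sqr_ord n :
  \sum_(i < n.+1) i%:R ^+ 2 = n%:R * n.+1%:R * (2 * n%:R + 1) / 6 :> R.
Proof.
elim: n => [|n IH]; first by rewrite big_ord1 expr0n !mul0r.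
by rewrite big_ord_recr /= IH -!natr1; field.
Qed.

Lemma avg_nat i : avg i (fun r => r%:R) = i%:R / 2.
Proof. by rewrite /avg sum_nat_ord; field; rewrite nat1r pnatr_eq0. Qed.

Lemma avg_sqr i : avg i (fun r => (r%:R - i%:R / 2) ^+ 2) = (i * (i + 2))%:R / 12.
Proof.
rewrite (_ : avg i _ = avg i (fun r => r%:R ^+ 2) + (- i%:R) * avg i (fun r => r%:R)
  + avg i (fun=> (i%:R / 2) ^+ 2)).
  rewrite avg_nat avg_cst /avg sum_sqr_ord natrM natrD.
  by field; rewrite nat1r pnatr_eq0.
by rewrite -avgZ -!avgD; apply: eq_avg => r; field.
Qed.

Lemma avg_centered i : avg i (fun r => r%:R - i%:R / 2) = 0.
Proof. by rewrite avgD avg_nat avg_cst subrr. Qed.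

Lemma cvg_avg i (F : nat -> nat -> R) (l : nat -> R) :
  (forall r, F ^~ r @ \oo --> l r) -> avg i (F n) @[n --> \oo] --> avg i l.
Proof.
move=> Fl; apply: cvgM; first exact: cvg_cst.
by apply: cvgn_sum => r _; exact: Fl.
Qed.

(** The characteristic function of one centered summand, tilted by [h], is
    [1 + c / N] up to [o (1 / N)] because the first-order terms cancel; it is
    raised to the number of summands of its kind. *)
Lemma ccvg_avg_pow i (h : nat -> R) (x : R) (L : nat -> nat) (al : R) :
  avg i h = 0 -> (L N)%:R / N%:R @[N --> \oo] --> al ->
  ccvg (fun N => (Complex (avg i (fun r => expR (h r / rt N) *
                            cos ((r%:R - i%:R / 2) * x / rt N)))
                          (avg i (fun r => expR (h r / rt N) *
                            sin ((r%:R - i%:R / 2) * x / rt N)))) ^+ L N)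
    (cexp (al * ((avg i (fun r => h r ^+ 2) - x ^+ 2 * ((i * (i + 2))%:R / 12)) / 2))
          (al * (x * avg i (fun r => h r * (r%:R - i%:R / 2))))).
Proof.
move=> h0 La.
have e2 : avg i (fun r => (h r ^+ 2 - ((r%:R - i%:R / 2) * x) ^+ 2) / 2) =
    (avg i (fun r => h r ^+ 2) - x ^+ 2 * ((i * (i + 2))%:R / 12)) / 2.
  rewrite (eq_avg i (g := fun r => 2^-1 * (h r ^+ 2 +
    (- x ^+ 2) * (r%:R - i%:R / 2) ^+ 2))); last by move=> r; ring.
  by rewrite avgZ avgD avgZ avg_sqr; ring.
have e3 : avg i (fun r => h r * ((r%:R - i%:R / 2) * x)) =
    x * avg i (fun r => h r * (r%:R - i%:R / 2)).
  by rewrite -avgZ; apply: eq_avg => r; ring.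
rewrite -e2 -e3.
apply: (@ccvg_pow R _ (Complex (avg i (fun r => (h r ^+ 2 - ((r%:R - i%:R / 2) * x) ^+ 2) / 2)) (avg i (fun r => h r * ((r%:R - i%:R / 2) * x)))) L al) => //=.
  have H : avg i (fun r => N%:R * (expR (h r / rt N) *
      cos ((r%:R - i%:R / 2) * x / rt N) - 1 - h r / rt N)) @[N --> \oo] -->
      avg i (fun r => (h r ^+ 2 - ((r%:R - i%:R / 2) * x) ^+ 2) / 2).
    by apply: cvg_avg => r; exact: (cexp_second_order _ _).1.
  apply: cvgn_eq H => N; rewrite avgZ; congr (_ * _).
  rewrite [in RHS](eq_avg i (g := fun r => expR (h r / rt N) * cos ((r%:R - i%:R / 2) * x / rt N) + -1 + (- (rt N)^-1) * h r)).
    by rewrite !avgD avgZ h0 mulr0 addr0 avg_cst.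
  by move=> r; ring.
have H : avg i (fun r => N%:R * (expR (h r / rt N) *
    sin ((r%:R - i%:R / 2) * x / rt N) - (r%:R - i%:R / 2) * x / rt N)) @[N --> \oo] -->
    avg i (fun r => h r * ((r%:R - i%:R / 2) * x)).
  by apply: cvg_avg => r; exact: (cexp_second_order _ _).2.
apply: cvgn_eq H => N; rewrite avgZ; congr (_ * _).
rewrite [in RHS](eq_avg i (g := fun r => expR (h r / rt N) * sin ((r%:R - i%:R / 2) * x / rt N) + (- (x / rt N)) * (r%:R - i%:R / 2))).
  by rewrite !avgD avgZ avg_centered mulr0 addr0.
by move=> r; ring.
Qed.

(** A crude constant suffices: the bound only has to make the Gaussian
    domination uniform over a full period. *)
Lemma one_sub_cos_ge (u : R) : `|u| <= pi -> u ^+ 2 / 128 <= 1 - cos u.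
Proof.
move=> upi.
pose v := `|u| / 2.
have v0 : 0 <= v by rewrite divr_ge0.
have vpi : v <= pi / 2 by rewrite /v ler_pM2r.
have sv : v / 8 <= sin v.
  have e2 : expR (2^-1) <= 2 :> R.
    have := expR_ge1Dx (- 2^-1 : R); rewrite expRN => h.
    have h2 := expR_gt0 (2^-1 : R).
    rewrite -(ler_pM2l (_ : 0 < 2^-1 :> R))// mulVf ?pnatr_eq0//.
    have : 2^-1 <= (expR 2^-1)^-1 :> R by lra.
    by rewrite -[X in _ <= X -> _]mul1r ler_pdivlMr.
  have small (w : R) : 0 <= w -> w <= 2^-1 -> w / 2 <= sin w.
    move=> w0 w1; have := sin_taylor3 w; rewrite (ger0_norm w0).
    have e3 : expR w <= 2 by apply: le_trans e2; rewrite ler_expR.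
    have : w ^+ 3 * expR w <= w ^+ 2 * w * 2.
      by rewrite -exprSr; apply: ler_wpM2l => //; exact: exprn_ge0.
    have w2 : w ^+ 2 <= 4^-1.
      rewrite (_ : 4^-1 = 2^-1 ^+ 2 :> R); last by field.
      by apply: lerXn2r; rewrite ?nnegrE.
    have : w ^+ 2 * w <= 4^-1 * w by apply: ler_wpM2r.
    by rewrite ler_norml => h1 h2 /andP[h3 _]; lra.
  have [v1|v1] := leP v 2^-1; first by have := small _ v0 v1; lra.
  have p2 := @pihalf_lt2 R.
  have h : 2^-1 / 2 <= sin 2^-1 :> R by apply: small; rewrite ?invr_ge0.
  have : sin 2^-1 <= sin v.
    have p1 := @pihalf_ge1 R.
    rewrite ltW// ltr_sin ?in_itv/=//; apply/andP; split; lra.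
  lra.
have -> : cos u = 1 - 2 * sin v ^+ 2.
  rewrite -(cos_norm u) (_ : `|u| = v *+ 2); last by rewrite /v mulr2n; field.
  rewrite cos_mulr2n cos2sin2 mulr2n; ring.
have : (v / 8) ^+ 2 <= sin v ^+ 2.
  by apply: lerXn2r; rewrite ?nnegrE; lra.
have -> : (v / 8) ^+ 2 = u ^+ 2 / 256 by rewrite /v !exprMn real_normK ?num_real//; field.
lra.
Qed.

(** Two masses at distance one, each at least [k], already force the
    characteristic function away from modulus [p + q]. *)
Lemma normc_two_point (p q k u : R) : 0 < k -> k <= p -> k <= q ->
  normc (Complex p 0 + Complex q 0 * cis u) <= p + q - k / 2 * (1 - cos u).
Proof.
move=> k0 kp kq; have c1 := cos_le1 u; have c2 := cos_geN1 u.
have r0 : 0 <= p + q - k / 2 * (1 - cos u) by nra.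
have -> : Complex p 0 + Complex q 0 * cis u = Complex (p + q * cos u) (q * sin u).
  by apply/eqP; rewrite eq_complex /=; apply/andP; split; apply/eqP; ring.
rewrite /normc -[leRHS]ger0_norm// -sqrtr_sqr ler_wsqrtr//.
have -> : (p + q * cos u) ^+ 2 + (q * sin u) ^+ 2 =
   (p + q) ^+ 2 - 2 * (p * q) * (1 - cos u).
  by rewrite exprMn sin2cos2; ring.
set t := 1 - cos u; have t0 : 0 <= t by rewrite /t; lra.
have pq : k * (p + q) <= 2 * (p * q) by nra.
have := ler_wpM2r t0 pq; have := sqr_ge0 (k / 2 * t); nra.
Qed.

Lemma sin_natpi n : sin (n%:R * pi) = 0 :> R.
Proof. by rewrite mulr_natl -[pi *+ n]add0r (alternatingn (@sinDpi R)) sin0 mulr0. Qed.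

Lemma integrable_cos (c A : R) :
  mu.-integrable `[- A, A]%classic (EFin \o (fun x => cos (c * x))).
Proof.
apply: continuous_compact_integrable; first exact: segment_compact.
apply: continuous_subspaceT => x.
apply: (@continuous_comp _ _ _ (fun x : R => c * x) cos); last exact: continuous_cos.
by apply: cvgM; [exact: cvg_cst|exact: cvg_id].
Qed.

Lemma Rintegral_cos (c A : R) : 0 < A -> c != 0 ->
  \int[mu]_(x in `[- A, A]) cos (c * x) = 2 * sin (c * A) / c.
Proof.
move=> A0 c0; pose F x := c^-1 * sin (c * x).
have dF (x : R) : is_derive x (1 : R) F (cos (c * x)).
  rewrite /F.
  have d1 : is_derive x (1 : R) (fun x : R => c * x) c.
    by rewrite -[X in is_derive _ _ _ X]mulr1; exact: is_deriveZ.
  have d2 : is_derive x (1 : R) (fun x => sin (c * x)) (c * cos (c * x)).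
    rewrite mulrC; exact: (@is_derive1_comp _ sin (fun x => c * x)).
  rewrite -[X in is_derive _ _ _ X](mulKf c0); exact: is_deriveZ.
rewrite /Rintegral (@continuous_FTC2 _ _ F).
- by rewrite /= /F mulrN sinN; field.
- lra.
- apply: continuous_subspaceT => x.
  apply: (@continuous_comp _ _ _ (fun x : R => c * x) cos); last exact: continuous_cos.
  by apply: cvgM; [exact: cvg_cst|exact: cvg_id].
- have cF : continuous F.
    by move=> x; apply/differentiable_continuous/derivable1_diffP; have [] := dF x.
  split; first by move=> x _; have [] := dF x.
  + by apply: cvg_at_right_filter; exact: cF.
  + by apply: cvg_at_left_filter; exact: cF.
- by move=> x _; rewrite derive1E; have [] := dF x.
Qed.

Lemma gauss_fun_pdf (c : R) : 0 < c -> exists2 s : R, s != 0 &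
  (fun x => expR (- (c * x ^+ 2))) =
  (fun x => (normal_peak s)^-1 * normal_pdf 0 s x).
Proof.
move=> c0; pose s := Num.sqrt (2 * c)^-1.
have s0 : s != 0 by rewrite gt_eqF// sqrtr_gt0 invr_gt0 mulr_gt0.
exists s => //; apply/funext => x.
rewrite normal_pdfE// mulKf ?gt_eqF ?normal_peak_gt0// /normal_fun subr0.
rewrite /s sqr_sqrtr ?invr_ge0 ?mulr_ge0 ?(ltW c0)//; congr expR.
by rewrite -mulr_natr; field; lra.
Qed.

Lemma integrable_gauss (c : R) : 0 < c ->
  mu.-integrable setT (EFin \o (fun x => expR (- (c * x ^+ 2)))).
Proof.
move=> c0; have [s s0 ->] := gauss_fun_pdf c0.
rewrite (_ : _ \o _ = fun x => ((normal_peak s)^-1%:E * (normal_pdf 0 s x)%:E)%E)//.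
by apply: integrableZl => //; exact: integrable_normal_pdf.
Qed.

Lemma Rintegral_gauss_gt0 (c : R) : 0 < c ->
  0 < \int[mu]_x expR (- (c * x ^+ 2)).
Proof.
move=> c0; have [s s0 ->] := gauss_fun_pdf c0.
rewrite RintegralZl//; last exact: integrable_normal_pdf.
by rewrite /Rintegral integral_normal_pdf mulr1 invr_gt0 normal_peak_gt0.
Qed.

Section ArrayOfSummands.
Context (m : nat) (a : nat -> R) (L : nat -> nat -> nat) (s : nat -> nat) (i0 : nat).
Hypothesis La : forall i, (1 <= i < m.+1)%N ->
  (L N i)%:R / N%:R @[N --> \oo] --> a i.
Hypothesis i0m : (1 <= i0 < m.+1)%N.
Hypothesis ai0 : 0 < a i0.
Hypothesis s_mid :
  ((s N)%:R - (\sum_(1 <= i < m.+1) (i * L N i)%N%:R) / 2) / rt N @[N --> \oo] --> 0.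
Variable h : nat -> nat -> R.
Hypothesis h_centered : forall i, (1 <= i < m.+1)%N -> avg i (h i) = 0.

(** The unnormalized generating function of a sum of independent values, [L N i] of
    them taken in [0, ..., i] with the uniform probabilities tilted by
    [exp (h i r / rt N)]. *)
Definition tilted_gf (N : nat) : {poly R} := \prod_(1 <= i < m.+1)
  (\sum_(r < i.+1) (i.+1%:R^-1 * expR (h i r / rt N)) *: 'X^r) ^+ L N i.

(** The characteristic function of that sum, recentred at [s N], at the scale
    [(rt N)^-1]. *)
Let cf (N : nat) (x : R) : C :=
  (map_poly (real_complex R) (tilted_gf N)).[cis (x / rt N)] *
  cis (- ((s N)%:R * (x / rt N))).

Let Re_cf N x : Re (cf N x) =
  \sum_(k < size (tilted_gf N)) (tilted_gf N)`_k *
    cos ((k%:R - (s N)%:R) * (x / rt N)).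
Proof.
rewrite /cf horner_coef size_map_poly mulr_suml Re_sum; apply: eq_bigr => k _.
rewrite coef_map cisX -mulrA.
have -> : cis (k%:R * (x / rt N)) * cis (- ((s N)%:R * (x / rt N))) =
    cis ((k%:R - (s N)%:R) * (x / rt N)).
  by rewrite !cisE -cexpD addr0 mulrBl.
by rewrite ReM /= mul0r subr0.
Qed.

Let factor i N x : C := \sum_(r < i.+1)
  Complex (i.+1%:R^-1 * expR (h i r / rt N)) 0 * cis (r%:R * (x / rt N)).

Let cfE N x : cf N x = \prod_(1 <= i < m.+1) factor i N x ^+ L N i *
  cis (- ((s N)%:R * (x / rt N))).
Proof.
rewrite /cf /tilted_gf rmorph_prod horner_prod; congr (_ * _).
apply: eq_bigr => i _; rewrite rmorphXn horner_exp; congr (_ ^+ _).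
rewrite rmorph_sum horner_sum; apply: eq_bigr => r _.
by rewrite /= map_polyZ map_polyXn hornerZ hornerXn cisX.
Qed.

Let sigma := 12^-1 * \sum_(1 <= i < m.+1) (i * (i + 2))%:R * a i.
Let vh := \sum_(1 <= i < m.+1) a i * avg i (fun r => h i r ^+ 2).
Hypothesis h_orth :
  \sum_(1 <= i < m.+1) a i * avg i (fun r => h i r * (r%:R - i%:R / 2)) = 0.

Let cf_cvg x : Re (cf N x) @[N --> \oo] --> expR (vh / 2) * expR (- (sigma * x ^+ 2 / 2)).
Proof.
pose z i N := Complex
  (avg i (fun r => expR (h i r / rt N) * cos ((r%:R - i%:R / 2) * x / rt N)))
  (avg i (fun r => expR (h i r / rt N) * sin ((r%:R - i%:R / 2) * x / rt N))).
have fz i N : factor i N x = z i N * cis (i%:R / 2 * (x / rt N)).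
  rewrite /factor /z.
  rewrite (_ : Complex _ _ = \sum_(r < i.+1) Complex (i.+1%:R^-1 *
     (expR (h i r / rt N) * cos ((r%:R - i%:R / 2) * x / rt N)))
     (i.+1%:R^-1 * (expR (h i r / rt N) * sin ((r%:R - i%:R / 2) * x / rt N)))); last first.
    apply/eqP; rewrite eq_complex Re_sum Im_sum /= /avg !mulr_sumr.
    by rewrite !eqxx.
  rewrite mulr_suml; apply: eq_bigr => r _.
  have -> : r%:R * (x / rt N) = (r%:R - i%:R / 2) * x / rt N + i%:R / 2 * (x / rt N).
    by ring.
  rewrite [cis (_ + _)](_ : _ = cis ((r%:R - i%:R / 2) * x / rt N) * cis (i%:R / 2 * (x / rt N))).
    rewrite mulrA; congr (_ * _); apply/eqP; rewrite eq_complex /=.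
    by apply/andP; split; apply/eqP; ring.
  by rewrite !cisE -cexpD addr0.
have E N : cf N x = \prod_(1 <= i < m.+1) z i N ^+ L N i *
   cexp 0 (- x * (((s N)%:R - (\sum_(1 <= i < m.+1) (i * L N i)%N%:R) / 2) / rt N)).
  rewrite cfE (eq_bigr (fun i => z i N ^+ L N i * cexp 0 ((i * L N i)%N%:R / 2 * (x / rt N)))).
    rewrite big_split /= -cexp_sum -mulrA cisE -cexpD big1_eq addr0; congr (_ * cexp _ _).
    by rewrite -mulr_suml -mulr_suml; ring.
  move=> i _; rewrite fz exprMn cisE cexpX mulr0; congr (_ * cexp _ _).
  by rewrite natrM; ring.
have H : ccvg (cf ^~ x) (cexp (vh / 2 + - (sigma * x ^+ 2 / 2)) 0).
  rewrite (_ : cf ^~ x = fun N => \prod_(1 <= i < m.+1) z i N ^+ L N i *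
   cexp 0 (- x * (((s N)%:R - (\sum_(1 <= i < m.+1) (i * L N i)%N%:R) / 2) / rt N))).
    rewrite (_ : cexp _ _ = cexp (vh / 2 + - (sigma * x ^+ 2 / 2)) 0 * cexp 0 0); last first.
      by rewrite cexp0 mulr1.
    apply: ccvgM; last first.
      by apply: ccvg_cexp; [exact: cvg_cst|exact: cvgn0Ml].
    rewrite (_ : cexp _ _ = \prod_(1 <= i < m.+1)
       cexp (a i * ((avg i (fun r => h i r ^+ 2) - x ^+ 2 * ((i * (i + 2))%:R / 12)) / 2))
          (a i * (x * avg i (fun r => h i r * (r%:R - i%:R / 2))))).
      apply: ccvg_prod_nat => i im.
      by apply: ccvg_avg_pow; [exact: h_centered|exact: La].
    rewrite -cexp_sum; congr cexp.
      rewrite /vh /sigma !mulr_sumr !mulr_suml -sumrN -big_split /=.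
      by apply: eq_bigr => i _; field.
    transitivity (x * 0); first by rewrite mulr0.
    by rewrite -[X in _ * X]h_orth mulr_sumr; apply: eq_bigr => i _; ring.
  by apply/funext => N; exact: E.
have [H1 _] := H.
by move: H1; rewrite /= cos0 mulr1 expRD.
Qed.

(** The dominating function: every factor has modulus at most [exp (C / N)], and
    the factors of kind [i0] moreover decay, uniformly over the whole period. *)
Let cf_dominated : exists2 D : R * R, 0 < D.2 & \forall N \near \oo, forall x : R,
  `|x| <= pi * rt N -> `|Re (cf N x)| <= D.1 * expR (- (D.2 * x ^+ 2)).
Proof.
pose Hb := \sum_(1 <= i < m.+1) \sum_(r < i.+1) `|h i r|.
have Hb0 : 0 <= Hb by rewrite sumr_ge0// => i _; rewrite sumr_ge0.
have hHb i (r : 'I_i.+1) : (1 <= i < m.+1)%N -> `|h i r| <= Hb.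
  move=> im; apply: (@le_trans _ _ (\sum_(r < i.+1) `|h i r|)).
    by rewrite (bigD1 r)//= lerDl sumr_ge0.
  rewrite /Hb (bigD1_seq i) ?mem_index_iota ?iota_uniq//= lerDl.
  by rewrite sumr_ge0// => j _; rewrite sumr_ge0.
pose e := expR 1 : R; have e0 : 0 < e by exact: expR_gt0.
pose C1 := e * Hb ^+ 2.
have C10 : 0 <= C1 by rewrite mulr_ge0 ?exprn_ge0// ltW.
pose q i N r := i.+1%:R^-1 * expR (h i r / rt N) : R.
have q0 i N r : 0 <= q i N r by rewrite mulr_ge0 ?expR_ge0 ?invr_ge0.
(* A lower bound for the masses of the values 0 and 1 in a summand of kind [i0]. *)
pose kap := e^-1 * i0.+1%:R^-1.
have kap0 : 0 < kap by rewrite mulr_gt0 ?invr_gt0.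
(* The constants of [normc_two_point] and [one_sub_cos_ge]: 256 = 2 * 128. *)
pose k2 := kap / 256.
have k20 : 0 < k2 by rewrite mulr_gt0 ?kap0 ?invr_gt0 ?ltr0n.
have small : \forall N \near \oo, Hb * (rt N)^-1 <= 1.
  apply: cvgn_near_le (_ : 0 < 1) => //; apply: cvgn0Ml; exact: cvgn_invsqrt.
have sumq : \forall N \near \oo, forall i, (1 <= i < m.+1)%N ->
    \sum_(r < i.+1) q i N r <= 1 + C1 / N%:R.
  near=> N => i im.
  have N0 : (0 < N)%N by near: N; exact: nbhs_infty_gt.
  have r0 := rt_gt0 N0; have rn0 : rt N != 0 by rewrite gt_eqF.
  have sm : Hb * (rt N)^-1 <= 1 by near: N; exact: small.
  rewrite -mulr_sumr -/(avg i (fun r => expR (h i r / rt N))).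
  have -> : avg i (fun r => expR (h i r / rt N)) =
      1 + avg i (fun r => expR (h i r / rt N) - 1 - h i r / rt N).
    rewrite (eq_avg i (g := fun r => 1 + ((rt N)^-1 * h i r +
     (expR (h i r / rt N) - 1 - h i r / rt N)))); last by move=> r; ring.
    rewrite (avgD i (fun=> 1)) avg_cst (avgD i (fun r => (rt N)^-1 * h i r)) avgZ.
    by rewrite h_centered// mulr0 add0r.
  rewrite lerD2l.
  rewrite -[leRHS](avg_cst i) /avg ler_wpM2l ?invr_ge0//; apply: ler_sum => r _.
  have hr : `|h i r / rt N| <= Hb * (rt N)^-1.
    by rewrite normrM normfV (ger0_norm (ltW r0)) ler_wpM2r ?invr_ge0 ?(ltW r0)// hHb.
  apply: le_trans (ler_norm _) _; apply: le_trans (expR_taylor2 _) _.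
  have -> : C1 / N%:R = (Hb * (rt N)^-1) ^+ 2 * e.
    by rewrite /C1 -(rt_sqr N); field.
  apply: ler_pM; rewrite ?exprn_ge0 ?expR_ge0//.
    by apply: lerXn2r; rewrite ?nnegrE// mulr_ge0// invr_ge0 ltW.
  by rewrite ler_expR (le_trans hr).
have facq i N x : normc (factor i N x) <= \sum_(r < i.+1) q i N r.
  apply: le_trans (normc_sum _ _ _) _; apply: ler_sum => r _.
  by rewrite normcM normc_cis mulr1 normc_real ger0_norm.
have fac0 : \forall N \near \oo, forall x : R, `|x| <= pi * rt N ->
    normc (factor i0 N x) <= expR (C1 / N%:R - k2 * x ^+ 2 / N%:R).
  near=> N => x xpi.
  have N0 : (0 < N)%N by near: N; exact: nbhs_infty_gt.
  have r0 := rt_gt0 N0; have rn0 : rt N != 0 by rewrite gt_eqF.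
  have sm : Hb * (rt N)^-1 <= 1 by near: N; exact: small.
  have sq : forall i, (1 <= i < m.+1)%N -> \sum_(r < i.+1) q i N r <= 1 + C1 / N%:R.
    by near: N.
  apply: le_trans (expR_ge1Dx _); have {sq} := sq _ i0m.
  have kq (r : 'I_i0.+1) : kap <= q i0 N r.
    rewrite /kap /q mulrC ler_wpM2l ?invr_ge0// -expRN ler_expR.
    have : `|h i0 r / rt N| <= 1.
      apply: le_trans sm; rewrite normrM normfV (ger0_norm (ltW r0)).
      by rewrite ler_wpM2r ?invr_ge0 ?(ltW r0)// hHb.
    by rewrite ler_norml => /andP[].
  have kq0 : kap <= q i0 N 0%N by exact: (kq ord0).
  have kq1 : kap <= q i0 N 1%N.
    have i1 : (1 < i0.+1)%N by case/andP: i0m.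
    exact: (kq (Ordinal i1)).
  have split2 (V : zmodType) (F : nat -> V) :
      \sum_(r < i0.+1) F r = F 0%N + F 1%N + \sum_(2 <= r < i0.+1) F r.
    have i01 : (1 < i0.+1)%N by case/andP: i0m.
    by rewrite -(big_mkord xpredT F) big_ltn// big_ltn// addrA.
  rewrite /factor (split2 _ (fun r => Complex (q i0 N r) 0 * cis (r%:R * (x / rt N)))).
  rewrite (split2 _ (q i0 N)) => sumle.
  apply: le_trans (le_normcD _ _) _.
  have t1 : normc (\sum_(2 <= r < i0.+1) Complex (q i0 N r) 0 *
      cis (r%:R * (x / rt N))) <= \sum_(2 <= r < i0.+1) q i0 N r.
    apply: le_trans (normc_sum _ _ _) _; apply: ler_sum => r _.
    by rewrite normcM normc_cis mulr1 normc_real ger0_norm.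
  have upi : `|x / rt N| <= pi.
    by rewrite normrM normfV (ger0_norm (ltW r0)) ler_pdivrMr.
  have t2 := normc_two_point (x / rt N) kap0 kq0 kq1.
  rewrite mul0r mul1r [cis 0]cisE cexp0 mulr1.
  have t3 := one_sub_cos_ge upi.
  have t4 : k2 * x ^+ 2 / N%:R <= kap / 2 * (1 - cos (x / rt N)).
    apply: le_trans (ler_wpM2l _ t3); last by rewrite divr_ge0// ltW.
    by apply: le_of_eq; rewrite /k2 -(rt_sqr N); field.
  lra.
pose A := \sum_(1 <= i < m.+1) a i.
have LA : (\sum_(1 <= i < m.+1) (L N i)%:R / N%:R) @[N --> \oo] --> A.
  exact: cvgn_sum_nat.
have A1 : A < A + 1 by lra.
have nLA := cvgn_near_le LA A1.
have nL0 : \forall N \near \oo, - ((L N i0)%:R / N%:R) <= - (a i0 / 2).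
  have a2 : - a i0 < - (a i0 / 2) by rewrite ltrN2 gtr_pMr// invf_lt1// ltr1n.
  by apply: cvgn_near_le a2; apply: cvgN; exact: La.
exists (expR (C1 * (A + 1)), k2 * (a i0 / 2)).
  by rewrite /= mulr_gt0// divr_gt0.
near=> N => x xpi /=.
have N0 : (0 < N)%N by near: N; exact: nbhs_infty_gt.
have r0 := rt_gt0 N0; have rn0 : rt N != 0 by rewrite gt_eqF.
have sq : forall i, (1 <= i < m.+1)%N -> \sum_(r < i.+1) q i N r <= 1 + C1 / N%:R.
  by near: N.
have f0 : forall x : R, `|x| <= pi * rt N ->
    normc (factor i0 N x) <= expR (C1 / N%:R - k2 * x ^+ 2 / N%:R) by near: N.
have LN : \sum_(1 <= i < m.+1) (L N i)%:R / N%:R <= A + 1 by near: N.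
have L0N : - ((L N i0)%:R / N%:R) <= - (a i0 / 2) by near: N.
apply: le_trans (Re_le_normc _) _.
rewrite cfE normcM normc_cis mulr1 normc_prod.
apply: (@le_trans _ _ (\prod_(1 <= i < m.+1) expR (C1 * ((L N i)%:R / N%:R) -
    (if i == i0 then k2 * x ^+ 2 * ((L N i)%:R / N%:R) else 0)))).
  rewrite big_nat_cond [leRHS]big_nat_cond; apply: ler_prod => i.
  rewrite andbT normcX => im; rewrite exprn_ge0 ?normc_ge0//=.
  case: eqP => [->|_].
    rewrite (_ : _ - _ = (L N i0)%:R * (C1 / N%:R - k2 * x ^+ 2 / N%:R)); last by ring.
    rewrite expRM_natl; apply: lerXn2r; rewrite ?nnegrE ?normc_ge0 ?expR_ge0//.
    exact: f0.
  rewrite subr0 (_ : C1 * _ = (L N i)%:R * (C1 / N%:R)); last by ring.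
  rewrite expRM_natl; apply: lerXn2r; rewrite ?nnegrE ?normc_ge0 ?expR_ge0//.
  by apply: le_trans (facq _ _ _) _; apply: le_trans (sq _ im) (expR_ge1Dx _).
rewrite -expR_sum sumrB -mulr_sumr -big_mkcond big_nat1_eq i0m expRD.
apply: ler_pM; rewrite ?expR_ge0// ler_expR; first by rewrite ler_wpM2l.
have := ler_wpM2l (mulr_ge0 (ltW k20) (sqr_ge0 x)) L0N; lra.
Unshelve. all: by end_near. Qed.

Let a_ge0 i : (1 <= i < m.+1)%N -> 0 <= a i.
Proof.
move=> im; apply: (cvgr_to_ge (La im)); apply: nearW => N.
by rewrite divr_ge0.
Qed.

Let sigma_gt0 : 0 < sigma.
Proof.
rewrite /sigma mulr_gt0 ?invr_gt0//.
rewrite (bigD1_seq i0) ?mem_index_iota ?iota_uniq//=.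
have i00 : (0 < i0)%N by case/andP: i0m.
rewrite ltr_wpDr//; last by rewrite mulr_gt0// ltr0n muln_gt0 i00 addn_gt0 orbT.
rewrite big_nat_cond sumr_ge0// => i /andP[im _].
by rewrite mulr_ge0// a_ge0.
Qed.

Let measurable_Re_cf N : measurable_fun setT (fun x => Re (cf N x)).
Proof.
under eq_fun do rewrite Re_cf.
apply: measurable_sum => k; apply: measurable_funM; first exact: measurable_cst.
apply: (@measurableT_comp _ _ _ _ _ _ (@cos R)).
  by apply: continuous_measurable_fun; exact: continuous_cos.
apply: measurable_funM; first exact: measurable_cst.
by apply: measurable_funM; [exact: measurable_id|exact: measurable_cst].
Qed.

(** Orthogonality of the characters recovers the coefficient. *)
Let Rintegral_cf N : (0 < N)%N ->
  \int[mu]_(x in `[- (pi * rt N), pi * rt N]) Re (cf N x) =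
  2 * pi * (rt N * (tilted_gf N)`_(s N)).
Proof.
move=> N0; have r0 := rt_gt0 N0; have rn0 : rt N != 0 by rewrite gt_eqF.
have A0 : 0 < pi * rt N by rewrite mulr_gt0// pi_gt0.
pose T k x := (tilted_gf N)`_k * cos ((k%:R - (s N)%:R) / rt N * x).
have iT k : mu.-integrable `[- (pi * rt N), pi * rt N]%classic (EFin \o T k).
  rewrite (_ : _ \o _ = fun x => (((tilted_gf N)`_k)%:E *
    (EFin \o (fun x => cos ((k%:R - (s N)%:R) / rt N * x))) x)%E)//.
  by apply: integrableZl => //; exact: integrable_cos.
have ev k : \int[mu]_(x in `[- (pi * rt N), pi * rt N]) T k x =
   if k == s N then 2 * pi * (rt N * (tilted_gf N)`_k) else 0.
  rewrite RintegralZl//; last exact: integrable_cos.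
  case: eqP => [->|/eqP ks].
    rewrite subrr mul0r; under eq_Rintegral do rewrite mul0r cos0.
    rewrite Rintegral_cst//= lebesgue_measure_itv/= lte_fin.
    by rewrite ifT; [rewrite -EFinD /=; ring|lra].
  have c0 : (k%:R - (s N)%:R) / rt N != 0.
    by rewrite mulf_neq0 ?invr_eq0// subr_eq0 eqr_nat.
  rewrite Rintegral_cos//.
  have -> : sin ((k%:R - (s N)%:R) / rt N * (pi * rt N)) = 0 :> R.
    rewrite (_ : _ * _ = (k%:R - (s N)%:R) * pi); last by field.
    have [sk|sk] := leqP (s N) k; first by rewrite -natrB// sin_natpi.
    by rewrite -opprB -natrB ?(ltnW sk)// mulNr sinN sin_natpi oppr0.
  by rewrite mulr0 mul0r mulr0.
transitivity (\sum_(k < size (tilted_gf N))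
    \int[mu]_(x in `[- (pi * rt N), pi * rt N]) T k x).
  transitivity (\int[mu]_(x in `[- (pi * rt N), pi * rt N])
     \sum_(k < size (tilted_gf N)) T k x).
    apply: eq_Rintegral => x _; rewrite Re_cf; apply: eq_bigr => k _.
    by rewrite /T; congr (_ * cos _); ring.
  elim: (index_enum _) => [|k l IH].
    rewrite big_nil; under eq_Rintegral do rewrite big_nil.
    by rewrite Rintegral_cst//= mul0r.
  rewrite big_cons; under eq_Rintegral do rewrite big_cons.
  rewrite RintegralD//; first by rewrite IH.
  rewrite (_ : _ \o _ = fun x => (\sum_(j <- l) (EFin \o T j) x)%E).
    by apply: integrable_sum => // ? _; exact: iT.
  by apply/funext => x; rewrite /= sumEFin.
under eq_bigr do rewrite ev.
rewrite -big_mkcond /=; have [sN|sN] := ltnP (s N) (size (tilted_gf N)).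
  by rewrite (big_pred1 (Ordinal sN)).
rewrite (nth_default _ sN) !mulr0 big1// => k /eqP ks.
by have := ltn_ord k; rewrite ks ltnNge sN.
Qed.

(** Up to the factor [expR (vh / 2)] the limit does not depend on the tilt [h],
    which is what makes ratios of such coefficients converge. *)
Theorem local_limit : rt N * (tilted_gf N)`_(s N) @[N --> \oo] -->
  expR (vh / 2) * ((\int[mu]_x expR (- (sigma / 2 * x ^+ 2))) / (2 * pi)).
Proof.
have [[D1 D2] /= D20 [N1 _ dom]] := cf_dominated.
have s2 : 0 < sigma / 2 by rewrite divr_gt0 ?sigma_gt0.
pose G N x := (Re (cf N x) * \1_(`[- (pi * rt N), pi * rt N]%classic : set R) x)%R.
pose N2 := N1.+1.
have GN N : (0 < N)%N -> \int[mu]_x G N x = 2 * pi * (rt N * (tilted_gf N)`_(s N)).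
  move=> N0; rewrite -Rintegral_cf// [RHS]Rintegral_mkcond; apply: eq_Rintegral => x _.
  by rewrite /G patchE indicE; case: ifP => _; rewrite ?mulr1 ?mulr0.
have mG N : measurable_fun setT (G N).
  by apply: measurable_funM => //; apply: measurable_indic; exact: measurable_itv.
have pG x : G N x @[N --> \oo] --> expR (vh / 2) * expR (- (sigma / 2 * x ^+ 2)).
  have -> : sigma / 2 * x ^+ 2 = sigma * x ^+ 2 / 2 by ring.
  apply: cvg_trans (@cf_cvg x); apply: near_eq_cvg.
  have xs : \forall N \near \oo, `|x| * (rt N)^-1 <= pi.
    by apply: cvgn_near_le (_ : 0 < pi); [apply: cvgn0Ml; exact: cvgn_invsqrt|exact: pi_gt0].
  near=> N; have N0 : (0 < N)%N by near: N; exact: nbhs_infty_gt.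
  have r0 := rt_gt0 N0.
  have : `|x| * (rt N)^-1 <= pi by near: N; exact: xs.
  rewrite ler_pdivrMr// ler_norml => xpi.
  by rewrite /G indicE mem_set ?mulr1//= in_itv.
have dG n x : `|G (n + N2)%N x| <= D1 * expR (- (D2 * x ^+ 2)).
  have D1_ge0 : 0 <= D1.
    have /dom : [set n | (N1 <= n)%N] N2 by rewrite /= /N2.
    move=> /(_ 0); rewrite normr0 mulr_ge0 ?pi_ge0 ?sqrtr_ge0// => /(_ isT).
    by rewrite expr0n mulr0 oppr0 expR0 mulr1; exact: le_trans.
  rewrite /G indicE; case: (boolP (x \in _)) => [|_]; last first.
    by rewrite mulr0 normr0 mulr_ge0 ?expR_ge0.
  rewrite inE /= in_itv/= -ler_norml mulr1 => xpi; apply: dom => //=.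
  by rewrite /N2 addnS leqW// leq_addl.
have lim_int : mu.-integrable setT
    (EFin \o (fun x => expR (vh / 2) * expR (- (sigma / 2 * x ^+ 2)))).
  rewrite (_ : _ \o _ = fun x => ((expR (vh / 2))%:E *
    (EFin \o (fun x => expR (- (sigma / 2 * x ^+ 2)))) x)%E)//.
  by apply: integrableZl => //; exact: integrable_gauss.
have H : (\int[mu]_x (G (n + N2)%N x)%:E)%E @[n --> \oo] -->
    (\int[mu]_x (expR (vh / 2) * expR (- (sigma / 2 * x ^+ 2)))%:E)%E.
  apply: (@dominated_cvg _ _ _ mu setT _ (fun n x => (G (n + N2)%N x)%:E) _
    (fun x => (D1 * expR (- (D2 * x ^+ 2)))%:E)) => //.
  - by move=> n; apply/measurable_EFinP; exact: mG.
  - move=> x _; apply: cvg_EFin; first exact: nearW.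
    exact: cvgn_shift (pG x).
  - rewrite (_ : (fun x => _) = fun x => (D1%:E *
      (EFin \o (fun x => expR (- (D2 * x ^+ 2)))) x)%E)//.
    by apply: integrableZl => //; exact: integrable_gauss.
  - by move=> n x _; rewrite lee_fin.
have {}H : \int[mu]_x G (n + N2)%N x @[n --> \oo] -->
    \int[mu]_x (expR (vh / 2) * expR (- (sigma / 2 * x ^+ 2))).
  apply: fine_cvg; rewrite [X in _ --> X]fineK//.
  exact: integrable_fin_num.
apply: (@cvgn_unshift _ N2).
have -> : expR (vh / 2) * ((\int[mu]_x expR (- (sigma / 2 * x ^+ 2))) / (2 * pi)) =
    (2 * pi)^-1 * \int[mu]_x (expR (vh / 2) * expR (- (sigma / 2 * x ^+ 2))).
  by rewrite RintegralZl//; [ring|exact: integrable_gauss].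
apply: (@cvgn_eq _ _ (fun n => (2 * pi)^-1 * \int[mu]_x G (n + N2)%N x)).
  move=> n; rewrite GN ?addnS// mulKf//.
  by rewrite mulf_neq0 ?pnatr_eq0// gt_eqF ?pi_gt0.
by apply: cvgM => //; exact: cvg_cst.
Unshelve. all: by end_near. Qed.

End ArrayOfSummands.
End LocalLimit.

(** * The generating function of the weights *)

Arguments ent : simpl never.

Section Entries.

Lemma ent_ord (V : nmodType) m (v : 'rV[V]_m) (i : 'I_m) : ent v i.+1 = v 0 i.
Proof.
rewrite /ent; case: insubP => [u _ ui|]; last by rewrite ltn_ord.
by congr (v _ _); exact: val_inj.
Qed.

Lemma ent_out (V : nmodType) m (v : 'rV[V]_m) i : (m < i)%N -> ent v i = 0.
Proof. by case: i => // i; rewrite ltnS => mi; rewrite /ent insubN //= -leqNgt. Qed.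

Lemma ent_map (U V : nmodType) (f : U -> V) m (v : 'rV[U]_m) i : f 0 = 0 ->
  ent (map_mx f v) i = f (ent v i).
Proof.
by move=> f0; rewrite /ent; case: i => [|i] //=; case: insubP => //= u _ _; rewrite mxE.
Qed.

Definition row_nat K m (j : 'rV['I_K.+1]_m) : 'rV[nat]_m := map_mx (@nat_of_ord K.+1) j.

Definition row_cons (T : Type) m (x : T) (v : 'rV[T]_m) : 'rV[T]_m.+1 :=
  \row_i (if unlift ord0 i is Some k then v 0 k else x).

Lemma row_cons0 (T : Type) m (x : T) (v : 'rV[T]_m) : row_cons x v 0 ord0 = x.
Proof. by rewrite mxE unlift_none. Qed.

Lemma row_consS (T : Type) m (x : T) (v : 'rV[T]_m) (i : 'I_m) :
  row_cons x v 0 (lift ord0 i) = v 0 i.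
Proof. by rewrite mxE liftK. Qed.

Lemma ent_row_cons1 K m (x : 'I_K.+1) (v : 'rV_m) : ent (row_nat (row_cons x v)) 1 = x.
Proof. by rewrite -[1%N]/(ord0 : 'I_m.+1).+1 ent_ord mxE row_cons0. Qed.

Lemma ent_row_consS K m (x : 'I_K.+1) (v : 'rV_m) i :
  ent (row_nat (row_cons x v)) i.+2 = ent (row_nat v) i.+1.
Proof.
have [im|im] := ltnP i m; last by rewrite !ent_out// ltnS.
rewrite -[i.+2]/(lift ord0 (Ordinal im) : 'I_m.+1).+1 ent_ord mxE row_consS.
by rewrite -[i.+1]/(Ordinal im : 'I_m).+1 ent_ord mxE.
Qed.

Lemma sum_row_cons (V : nmodType) (T : finType) m (F : 'rV[T]_m.+1 -> V) :
  \sum_(j : 'rV[T]_m.+1) F j = \sum_(v : 'rV[T]_m) \sum_(x : T) F (row_cons x v).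
Proof.
rewrite pair_big /=.
rewrite (reindex (fun p : 'rV[T]_m * T => row_cons p.2 p.1)) //=.
exists (fun j => (\row_i j 0 (lift ord0 i), j 0 ord0)) => [[v x] _|j _] /=.
  by congr pair; [apply/rowP => i; rewrite mxE row_consS|rewrite row_cons0].
apply/rowP => i; case: (unliftP ord0 i) => [k ->|->].
  by rewrite row_consS mxE.
by rewrite row_cons0.
Qed.

End Entries.

Section GeneratingFunction.
Variable R : realType.

(** The value at [q = 1] of the term of [J] in the supernomial.  It counts the
    choices of a number [r] in [0, ..., i] for each of [L i] copies of kind [i]
    such that exactly [J l] copies have [l <= i < r + l]; these are chosen among
    the [J l.+1] copies with [l.+1 <= i < r + l.+1] and the [L l] copies of
    kind [l]. *)
Definition weight (m : nat) (L J : nat -> nat) : nat :=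
  \prod_(1 <= l < m.+1) 'C(L l + J l.+1, J l).

(** For [Q = 1] the coefficient of ['X^r] is [t i * t i.-1 * ... * t (i - r).+1]:
    the choice of [r] in a copy of kind [i] adds one to the entries of [J] at the
    last [r] of the indices [1, ..., i]. *)
Fixpoint nested (t : nat -> R) (Q : {poly R}) (i : nat) : {poly R} :=
  if i is k.+1 then 1 + (t i *: 'X) * nested t Q k else Q.

Lemma nested_shift t Q i :
  nested (fun k => t k.+1) (1 + (t 1%N *: 'X) * Q) i = nested t Q i.+1.
Proof. by elim: i => [//|i IH] /=; rewrite IH. Qed.

Lemma coef_mull_eq (p q r : {poly R}) K : (forall s, (s <= K)%N -> p`_s = q`_s) ->
  forall s, (s <= K)%N -> (p * r)`_s = (q * r)`_s.
Proof.
move=> pq s sK; rewrite !coefM; apply: eq_bigr => i _; rewrite pq//.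
by rewrite (leq_trans _ sK)// -ltnS.
Qed.

Lemma binomial_truncated (u : R) (Q : {poly R}) n K s : (s <= K)%N ->
  (\sum_(x < K.+1) 'C(n, x)%:R *: ((u *: 'X) ^+ x * Q ^+ x))`_s =
  ((1 + (u *: 'X) * Q) ^+ n)`_s.
Proof.
move=> sK; rewrite exprDn.
have term x : 'C(n, x)%:R *: ((u *: 'X) ^+ x * Q ^+ x) =
    ('X^x * (u ^+ x *: Q ^+ x)) *+ 'C(n, x) :> {poly R}.
  by rewrite exprZn scaler_nat -scalerAl scalerAr.
have vanish x : (s < x)%N -> (('X^x * (u ^+ x *: Q ^+ x)) *+ 'C(n, x) : {poly R})`_s = 0.
  by move=> sx; rewrite coefMn coefXnM sx mul0rn.
have eq2 x : 1 ^+ (n - x) * (u *: 'X * Q) ^+ x *+ 'C(n, x) =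
    ('X^x * (u ^+ x *: Q ^+ x)) *+ 'C(n, x) :> {poly R}.
  by rewrite expr1n mul1r exprMn exprZn -scalerAl scalerAr.
rewrite (eq_bigr _ (fun (x : 'I_K.+1) _ => term x)) [in RHS](eq_bigr _ (fun (x : 'I_n.+1) _ => eq2 x)).
rewrite !coef_sum -2!(big_mkord xpredT (fun x => (('X^x * (u ^+ x *: Q ^+ x)) *+ 'C(n, x) : {poly R})`_s)).
have cut M : (s <= M)%N -> \sum_(0 <= x < M.+1) (('X^x * (u ^+ x *: Q ^+ x)) *+ 'C(n, x) : {poly R})`_s
    = \sum_(0 <= x < s.+1) (('X^x * (u ^+ x *: Q ^+ x)) *+ 'C(n, x) : {poly R})`_s.
  move=> sM; rewrite (@big_cat_nat _ _ _ s.+1)//= [X in _ + X]big_nat_cond.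
  by rewrite [X in _ + X]big1 ?addr0// => x /andP[/andP[sx _] _]; exact: vanish.
rewrite (cut K sK); have [sn|ns] := leqP s n; first by rewrite cut.
rewrite [in LHS](@big_cat_nat _ _ _ n.+1)//=; last by rewrite ltnW.
rewrite [X in _ + X]big_nat_cond [X in _ + X]big1 ?addr0//.
by move=> x /andP[/andP[nx _] _]; rewrite bin_small// mulr0n coef0.
Qed.

(** Summing the first entry by the binomial theorem shifts the problem to the
    remaining entries. *)
Lemma weight_gf_gen m K (L : nat -> nat) (t : nat -> R) (Q : {poly R}) s :
  (s <= K)%N ->
  (\sum_(j : 'rV['I_K.+1]_m) let J := ent (row_nat j) in
     (\prod_(1 <= l < m.+1) ('C(L l + J l.+1, J l)%:R *: (t l *: 'X) ^+ J l)) *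
     Q ^+ J 1%N)`_s =
  (\prod_(1 <= i < m.+1) nested t Q i ^+ L i)`_s.
Proof.
elim: m L t Q s => [|m IH] L t Q s sK.
  rewrite big_geq// (eq_bigr (fun=> 1)) => [|j _].
    by rewrite sumr_const card_mx muln0 expn0 mulr1n.
  by rewrite /= big_geq// ent_out// expr0 mulr1.
rewrite sum_row_cons big_ltn// big_add1 /=.
have E : forall (v : 'rV['I_K.+1]_m) s, (s <= K)%N ->
   (\sum_(x < K.+1) let J := ent (row_nat (row_cons x v)) in
     (\prod_(1 <= l < m.+2) ('C(L l + J l.+1, J l)%:R *: (t l *: 'X) ^+ J l)) *
     Q ^+ J 1%N)`_s =
   (nested t Q 1 ^+ L 1%N * (let J := ent (row_nat v) in
     (\prod_(1 <= l < m.+1) ('C(L l.+1 + J l.+1, J l)%:R *: (t l.+1 *: 'X) ^+ J l)) *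
     nested t Q 1 ^+ J 1%N))`_s.
  move=> v s' s'K /=; set J := ent (row_nat v).
  set P := \prod_(1 <= l < m.+1) _.
  rewrite (eq_bigr (fun x : 'I_K.+1 => ('C(L 1%N + J 1%N, x)%:R *:
     ((t 1%N *: 'X) ^+ x * Q ^+ x)) * P)) => [|x _].
    rewrite -mulr_suml (coef_mull_eq _ (q := nested t Q 1 ^+ (L 1%N + J 1%N)) (K := K))//.
      by rewrite exprD -mulrA [P * _]mulrC mulrA.
    by move=> s'' s''K; rewrite binomial_truncated.
  rewrite big_ltn// big_add1 /= ent_row_cons1 -!scalerAl mulrAC; congr (_ *: _).
    by case: m v @J @P {IH} => [|m] v J P; rewrite ?ent_row_consS//
      ent_out// /J ent_out.
  congr (_ * _); rewrite /P big_nat_cond [RHS]big_nat_cond; apply: eq_bigr => l.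
  by rewrite andbT => /andP[l1 lm]; case: l l1 lm => // l _ lm; rewrite !ent_row_consS.
rewrite coef_sum (eq_bigr _ (fun v _ => E v s sK)) -coef_sum -mulr_sumr.
rewrite mulrC [in RHS]mulrC.
rewrite (coef_mull_eq _ (q := \prod_(1 <= i < m.+1) nested t Q i.+1 ^+ L i.+1) (K := K))//.
move=> s' s'K; rewrite (IH (fun l => L l.+1) (fun l => t l.+1) (nested t Q 1))//.
rewrite (eq_bigr (fun i => nested t Q i.+1 ^+ L i.+1))// => i _.
by rewrite nested_shift.
Qed.

(** The weighted sum over a slice is a coefficient of a product over the copies,
    which is the independence of the copies before conditioning on the total. *)
Lemma weight_gf m K (L : nat -> nat) (t : nat -> R) s : (s <= K)%N ->
  \sum_(j : 'rV['I_K.+1]_m | (\sum_(i < m) j 0%R i == s)%N)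
    (let J := ent (row_nat j) in
     (weight m L J)%:R * \prod_(1 <= l < m.+1) t l ^+ J l) =
  (\prod_(1 <= i < m.+1) nested t 1 i ^+ L i)`_s.
Proof.
move=> sK; rewrite -(weight_gf_gen _ _ _ _ sK) coef_sum [LHS]big_mkcond.
apply: eq_bigr => j _ /=; rewrite expr1n mulr1.
set J := ent (row_nat j).
have -> : \prod_(1 <= l < m.+1) ('C(L l + J l.+1, J l)%:R *: (t l *: 'X) ^+ J l) =
   ((weight m L J)%:R * \prod_(1 <= l < m.+1) t l ^+ J l) *:
   'X^(\sum_(1 <= l < m.+1) J l) :> {poly R}.
  rewrite /weight natr_prod -big_split /= -prodrXr -scaler_prod.
  by apply: eq_bigr => l _; rewrite exprZn scalerA.
have -> : (\sum_(1 <= l < m.+1) J l = \sum_(i < m) j 0%R i)%N.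
  rewrite big_add1 big_mkord; apply: eq_bigr => i _.
  by rewrite /J ent_ord mxE.
by rewrite coefZ coefXn eq_sym; case: eqP => _; rewrite ?mulr1 ?mulr0.
Qed.

(** The sum of the last [r] of [y 1, ..., y i], which is what the choice of [r] in
    a copy of kind [i] contributes to the statistic [\sum_k y k * J k]. *)
Definition partial (y : nat -> R) (i r : nat) : R :=
  \sum_(1 <= k < i.+1 | (i < r + k)%N) y k.

Lemma partial0 y i : partial y i 0 = 0.
Proof.
rewrite /partial big_nat_cond big1// => k /andP[/andP[_ ki]].
by rewrite add0n ltnNge -ltnS ki.
Qed.

Lemma partialS y i r : partial y i.+1 r.+1 = y i.+1 + partial y i r.
Proof.
rewrite /partial [LHS]big_mkcond big_nat_recr//= -big_mkcond addrC.
by rewrite ifT ?addSn ?ltnS// addnS ltnS leq_addl.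
Qed.

Lemma nested_exp (y : nat -> R) (c : R) i :
  nested (fun k => expR (c * y k)) 1 i =
  \sum_(r < i.+1) expR (c * partial y i r) *: 'X^r.
Proof.
elim: i => [|i IH] /=.
  by rewrite big_ord1 partial0 mulr0 expR0 scale1r expr0.
rewrite IH [RHS]big_ord_recl /= partial0 mulr0 expR0 scale1r expr0; congr (_ + _).
rewrite mulr_sumr; apply: eq_bigr => r _.
by rewrite /bump leq0n add1n partialS mulrDr expRD -scalerAl -scalerAr scalerA exprS.
Qed.

End GeneratingFunction.

(** * Moments of one copy *)

Section IndicatorMoments.
Variable R : realType.

(** The centered contribution of one copy of kind [i] to the statistic
    [\sum_k eta k * J k]: [k] is among the last [r] indices for [k] of the
    [i.+1] values of [r]. *)
Definition tilt (eta : nat -> R) (i r : nat) : R :=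
  partial eta i r - \sum_(1 <= k < i.+1) eta k * (k%:R / i.+1%:R).

Lemma tiltE eta i r : tilt eta i r =
  \sum_(1 <= k < i.+1) eta k * ((i < r + k)%N%:R - k%:R / i.+1%:R).
Proof.
rewrite /tilt /partial big_mkcond -sumrB; apply: eq_bigr => k _.
by rewrite mulrBr; case: ifP => _; rewrite ?mulr1 ?mulr0.
Qed.

Lemma avg_sum i (s : seq nat) (P : pred nat) (F : nat -> nat -> R) :
  avg i (fun r => \sum_(k <- s | P k) F k r) = \sum_(k <- s | P k) avg i (F k).
Proof. by rewrite /avg exchange_big mulr_sumr. Qed.

Lemma sum_top (i k : nat) (F : nat -> R) : (k <= i.+1)%N ->
  \sum_(r < i.+1) F r * (i < r + k)%N%:R = \sum_(i.+1 - k <= r < i.+1) F r.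
Proof.
move=> ki; rewrite -(big_mkord xpredT (fun r => F r * (i < r + k)%N%:R)).
rewrite (@big_cat_nat _ _ _ (i.+1 - k))//= ?leq_subr//.
rewrite big_nat_cond big1 ?add0r.
  rewrite big_nat_cond [RHS]big_nat_cond; apply: eq_bigr => r.
  rewrite andbT leq_subLR addnC => /andP[->]; by rewrite mulr1.
move=> r; rewrite andbT /= ltn_subRL addnC => rk.
by rewrite ltnNge -ltnS rk mulr0.
Qed.

Lemma avg_top i k : (k <= i.+1)%N -> avg i (fun r => (i < r + k)%N%:R) = k%:R / i.+1%:R :> R.
Proof.
move=> ki; rewrite /avg (eq_bigr (fun r : 'I_i.+1 => 1 * (i < r + k)%N%:R)).
  by rewrite (sum_top (fun=> 1))// sumr_const_nat subKn// mulrC.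
by move=> r _; rewrite mul1r.
Qed.

Lemma avg_top2 i k l : (k <= i.+1)%N -> (l <= i.+1)%N ->
  avg i (fun r => (i < r + k)%N%:R * (i < r + l)%N%:R) = (minn k l)%:R / i.+1%:R :> R.
Proof.
move=> ki li; rewrite -avg_top ?geq_min ?ki//; apply: eq_avg => r.
by rewrite -natrM mulnb; congr (nat_of_bool _)%:R; rewrite addn_minr leq_min.
Qed.

Lemma avg_top_nat i k : (k <= i.+1)%N ->
  avg i (fun r => (i < r + k)%N%:R * (r%:R - i%:R / 2)) =
  k%:R * (i.+1 - k)%:R / (2 * i.+1%:R) :> R.
Proof.
move=> ki; rewrite /avg.
have -> : \sum_(r < i.+1) (i < r + k)%N%:R * (r%:R - i%:R / 2) =
    k%:R * (i.+1 - k)%:R / 2 :> R.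
  rewrite (eq_bigr (fun r : 'I_i.+1 => (r%:R - i%:R / 2) * (i < r + k)%N%:R)); last first.
    by move=> r _; rewrite mulrC.
  rewrite (sum_top (fun r => r%:R - i%:R / 2))//.
  elim: k ki => [|k IH] ki; first by rewrite subn0 big_geq// !mul0r.
  have Ei : (i.+1 - k = (i.+1 - k.+1).+1)%N by rewrite subnSK.
  rewrite (@big_cat_nat _ _ _ (i.+1 - k))//= ?leq_subr//; last by rewrite leq_sub2l.
  rewrite IH ?(ltnW ki)// {1}Ei big_nat1 !natrB//; last exact: ltnW.
  by rewrite -!natr1; field.
by field; rewrite ?nat1r ?natr1 pnatr_eq0.
Qed.

(** The covariance of the events that [k], and that [l], is among the last [r] of
    the indices [1, ..., i]. *)
Definition indcov i k l : R := (minn k l)%:R / i.+1%:R - (k * l)%:R / i.+1%:R ^+ 2.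

Lemma avg_tilt eta i : avg i (tilt eta i) = 0.
Proof.
rewrite (eq_avg i (tiltE eta i)) avg_sum big_nat_cond big1// => k.
rewrite andbT => /andP[_ ki]; rewrite avgZ avgD avg_cst avg_top ?subrr ?mulr0//.
exact: ltnW.
Qed.

Lemma avg_tilt_sqr eta i : avg i (fun r => tilt eta i r ^+ 2) =
  \sum_(1 <= k < i.+1) \sum_(1 <= l < i.+1) eta k * eta l * indcov i k l.
Proof.
rewrite (eq_avg i (g := fun r => \sum_(1 <= k < i.+1) \sum_(1 <= l < i.+1)
  eta k * eta l * (((i < r + k)%N%:R - k%:R / i.+1%:R) *
  ((i < r + l)%N%:R - l%:R / i.+1%:R)))); last first.
  move=> r; rewrite tiltE expr2 mulr_suml; apply: eq_bigr => k _.
  by rewrite mulr_sumr; apply: eq_bigr => l _; ring.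
rewrite avg_sum big_nat_cond [RHS]big_nat_cond; apply: eq_bigr => k.
rewrite andbT => /andP[_ ki]; rewrite avg_sum big_nat_cond [RHS]big_nat_cond.
apply: eq_bigr => l; rewrite andbT => /andP[_ li]; rewrite avgZ; congr (_ * _).
rewrite (eq_avg i (g := fun r => (i < r + k)%N%:R * (i < r + l)%N%:R +
  ((- (l%:R / i.+1%:R)) * (i < r + k)%N%:R + ((- (k%:R / i.+1%:R)) * (i < r + l)%N%:R
   + k%:R * l%:R / i.+1%:R ^+ 2)))); last first.
  by move=> r; field; rewrite ?nat1r ?natr1 pnatr_eq0.
have [k1 l1] := (ltnW ki, ltnW li).
rewrite (avgD i (fun r => (i < r + k)%N%:R * (i < r + l)%N%:R)) avg_top2//.
rewrite (avgD i (fun r => - (l%:R / i.+1%:R) * (i < r + k)%N%:R)).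
rewrite (avgD i (fun r => - (k%:R / i.+1%:R) * (i < r + l)%N%:R)).
by rewrite !avgZ !avg_top// avg_cst /indcov natrM; field; rewrite ?nat1r ?natr1 pnatr_eq0.
Qed.

Lemma avg_tilt_nat eta i : avg i (fun r => tilt eta i r * (r%:R - i%:R / 2)) =
  \sum_(1 <= k < i.+1) eta k * (k%:R * (i.+1 - k)%:R / (2 * i.+1%:R)).
Proof.
rewrite (eq_avg i (g := fun r => \sum_(1 <= k < i.+1) eta k *
  ((i < r + k)%N%:R * (r%:R - i%:R / 2) + (- (k%:R / i.+1%:R)) * (r%:R - i%:R / 2)))); last first.
  by move=> r; rewrite tiltE mulr_suml; apply: eq_bigr => k _; ring.
rewrite avg_sum big_nat_cond [RHS]big_nat_cond; apply: eq_bigr => k.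
rewrite andbT => /andP[_ ki]; rewrite avgZ; congr (_ * _).
rewrite (avgD i (fun r => (i < r + k)%N%:R * (r%:R - i%:R / 2))) avgZ avg_centered.
by rewrite mulr0 addr0 avg_top_nat// ltnW.
Qed.

Lemma partial_const i r : (r <= i)%N -> partial (fun=> 1) i r = r%:R :> R.
Proof.
elim: i r => [|i IH] [|r] ri //; rewrite ?partial0//.
by rewrite partialS IH// -nat1r.
Qed.

Lemma sum_id i : \sum_(1 <= k < i.+1) k%:R = i%:R * i.+1%:R / 2 :> R.
Proof.
elim: i => [|i IH]; first by rewrite big_geq// !mul0r.
by rewrite big_nat_recr//= IH -!natr1; field.
Qed.

Lemma tiltD eta (lam : R) i r : (r <= i)%N ->
  tilt (fun k => eta k + lam) i r = tilt eta i r + lam * (r%:R - i%:R / 2).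
Proof.
move=> ri; rewrite -(partial_const ri) /tilt /partial.
have -> : i%:R / 2 = \sum_(1 <= k < i.+1) (k%:R / i.+1%:R) :> R.
  by rewrite -mulr_suml sum_id; field; rewrite ?nat1r ?natr1 pnatr_eq0.
rewrite big_split /=.
have -> : \sum_(1 <= k < i.+1) (eta k + lam) * (k%:R / i.+1%:R) =
    \sum_(1 <= k < i.+1) eta k * (k%:R / i.+1%:R) +
    lam * \sum_(1 <= k < i.+1) (k%:R / i.+1%:R).
  by rewrite mulr_sumr -big_split /=; apply: eq_bigr => k _; ring.
have -> : \sum_(1 <= k < i.+1 | (i < r + k)%N) lam =
    lam * \sum_(1 <= k < i.+1 | (i < r + k)%N) 1.
  by rewrite mulr_sumr; apply: eq_bigr => k _; rewrite mulr1.
by ring.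
Qed.

End IndicatorMoments.

(** * Gaussian binomials near [q = 1] *)

Section GaussianBinomial.
Variable R : realType.

(** [rho n t] is the moment generating function at [t] of the uniform
    distribution on [0, ..., n], centered at its mean. *)
Definition rho (n : nat) (t : R) : R :=
  n.+1%:R^-1 * \sum_(i < n.+1) expR (t * (i%:R - n%:R / 2)).

Lemma rho_gt0 n t : 0 < rho n t.
Proof.
rewrite mulr_gt0 ?invr_gt0// big_ord_recl; apply: ltr_wpDr; last exact: expR_gt0.
by apply: sumr_ge0 => i _; exact: expR_ge0.
Qed.

Lemma horner_qint n t : (qint R n.+1).[expR t] =
  n.+1%:R * (expR (t * (n%:R / 2)) * rho n t).
Proof.
rewrite /rho mulrCA mulVKf ?pnatr_eq0// /qint horner_sum mulr_sumr.
apply: eq_bigr => i _; rewrite hornerXn -expRM_natr -expRD; congr expR; ring.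
Qed.

(** The linear term vanishes because [rho] is centered. *)
Lemma rho_taylor n t : n%:R * `|t| <= 1 ->
  `|rho n t - (1 + t ^+ 2 * (n%:R * (n%:R + 2)) / 24)| <=
    expR 1 * (n%:R * `|t|) ^+ 3.
Proof.
move=> nt1; pose u (i : nat) := t * (i%:R - n%:R / 2).
have nz : n.+1%:R != 0 :> R by rewrite pnatr_eq0.
have mean : n.+1%:R^-1 * \sum_(i < n.+1) (1 + u i + u i ^+ 2 / 2) =
    1 + t ^+ 2 * (n%:R * (n%:R + 2)) / 24.
  rewrite (eq_bigr (fun i : 'I_n.+1 => (1 - t * (n%:R / 2) + t ^+ 2 * n%:R ^+ 2 / 8)
     + ((t - t ^+ 2 * n%:R / 2) * i%:R + t ^+ 2 / 2 * i%:R ^+ 2))); last first.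
    by move=> i _; rewrite /u; field.
  rewrite big_split /= sumr_const card_ord big_split /= -!mulr_sumr sum_nat_ord sum_sqr_ord.
  rewrite -[_ *+ n.+1]mulr_natr.
  by field; rewrite ?nat1r ?natr1 pnatr_eq0.
rewrite -mean /rho -mulrBr -sumrB normrM ger0_norm ?invr_ge0//.
rewrite ler_pdivrMl//; apply: le_trans (ler_norm_sum _ _ _) _.
apply: (@le_trans _ _ (\sum_(i < n.+1) expR 1 * (n%:R * `|t|) ^+ 3)); last first.
  by rewrite sumr_const card_ord -[_ *+ n.+1]mulr_natl.
apply: ler_sum => i _.
have ui : `|u i| <= n%:R * `|t|.
  rewrite /u normrM mulrC ler_wpM2r// ler_norml; apply/andP.
  have : (i%:R : R) <= n%:R by rewrite ler_nat -ltnS.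
  have : 0 <= i%:R :> R by [].
  by split; lra.
rewrite (_ : _ - _ = expR (u i) - 1 - u i - u i ^+ 2 / 2); last by rewrite /u; ring.
apply: le_trans (expR_taylor3 _) _; rewrite mulrC; apply: ler_pM => //.
- by rewrite ler_expR (le_trans ui).
- by apply: lerXn2r; rewrite ?nnegrE// mulr_ge0.
Qed.

(** The logarithm of [rho n t] beyond its second cumulant. *)
Definition lnerr (n : nat) (t : R) : R :=
  ln (rho n t) - t ^+ 2 * (n%:R * (n%:R + 2)) / 24.

Lemma rhoE n t : rho n t =
  expR (t ^+ 2 * (n%:R * (n%:R + 2)) / 24 + lnerr n t).
Proof. by rewrite /lnerr addrC subrK lnK// posrE rho_gt0. Qed.

Lemma ln_bound (x d : R) : 0 <= x -> x <= 1 -> 0 <= d ->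
  forall y, 0 < y -> `|y - (1 + x)| <= d -> d <= 2^-1 ->
  `|ln y - x| <= 2 * d + x ^+ 2.
Proof.
move=> x0 x1 d0 y y0; rewrite ler_norml => /andP[l1 l2] d2.
have up : ln y <= x + d.
  have := @le_ln1Dx R (y - 1); rewrite addrCA subrr addr0; lra.
have low : x - x ^+ 2 - 2 * d <= ln y.
  have y12 : 0 < y^-1 by rewrite invr_gt0.
  have h : ln y^-1 <= y^-1 - 1.
    by have := @le_ln1Dx R (y^-1 - 1); rewrite addrCA subrr addr0; lra.
  rewrite lnV ?posrE// in h.
  have yy : y * y^-1 = 1 by rewrite divff// gt_eqF.
  have : y^-1 - 1 <= - x + x ^+ 2 + 2 * d.
    rewrite -(ler_pM2l y0) mulrBr yy mulr1.
    have z0 : 0 <= x ^+ 2 by rewrite sqr_ge0.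
    have zx : x ^+ 2 <= x by rewrite expr2 ler_piMl.
    have h1 : 0 <= (y - (1 + x) + d) * (1 - x + x ^+ 2) by apply: mulr_ge0; lra.
    have h2 : 0 <= d * (x - x ^+ 2) by apply: mulr_ge0; lra.
    have h3 : 0 <= d * (y - 2^-1) by apply: mulr_ge0; lra.
    have h4 : 0 <= x * x ^+ 2 by rewrite mulr_ge0.
    rewrite -subr_ge0 (_ : _ - _ = x * x ^+ 2 +
      (y - (1 + x) + d) * (1 - x + x ^+ 2) + d * (x - x ^+ 2) +
      2 * (d * (y - 2^-1))); last by field.
    lra.
  lra.
have := sqr_ge0 x; rewrite ler_norml => x2; apply/andP; split; lra.
Qed.

Lemma lnerr_bound : exists2 C : R, 0 <= C & forall n t,
  C * (n%:R * `|t|) ^+ 3 <= 1 -> n%:R * `|t| <= 1 ->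
  `|lnerr n t| <= C * (n%:R * `|t|) ^+ 3.
Proof.
pose e := expR 1 : R; have e0 : 0 <= e by exact: expR_ge0.
exists (2 * e + 1); first by lra.
move=> n t c1 nt1; set w := n%:R * `|t| in c1 nt1 *.
have w0 : 0 <= w by rewrite /w mulr_ge0.
have w3 : 0 <= w ^+ 3 by rewrite exprn_ge0.
have tt := rho_taylor nt1.
have [->|n0] := eqVneq n 0%N.
  rewrite /lnerr /rho big_ord1 !mul0r subr0 !mulr0 expR0 mulr1 invr1 ln1 mul0r subrr.
  by rewrite normr0 mulr_ge0//; lra.
set x := t ^+ 2 * (n%:R * (n%:R + 2)) / 24 in tt *.
have x0 : 0 <= x by rewrite /x divr_ge0// mulr_ge0 ?sqr_ge0// mulr_ge0// addr_ge0.
have xw : x <= w ^+ 2 / 8.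
  have -> : w ^+ 2 / 8 = t ^+ 2 * (n%:R * (3 * n%:R)) / 24.
    by rewrite /w exprMn real_normK ?num_real//; field.
  rewrite /x ler_pM2r ?invr_gt0//; apply: ler_wpM2l; first exact: sqr_ge0.
  apply: ler_wpM2l => //; have : 1 <= n%:R :> R by rewrite ler1n lt0n.
  lra.
have ww : w ^+ 2 <= 1 by rewrite exprn_ile1.
have w4 : w ^+ 2 * w ^+ 2 <= w ^+ 3.
  by rewrite -exprD (exprSr w 3) ler_piMr.
have xx : x ^+ 2 <= w ^+ 3 / 64.
  apply: (@le_trans _ _ ((w ^+ 2 / 8) ^+ 2)).
    by apply: lerXn2r; rewrite ?nnegrE//; lra.
  by rewrite (_ : _ ^+ 2 = w ^+ 2 * w ^+ 2 / 64); [lra|field].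
have ed : 0 <= e * w ^+ 3 by rewrite mulr_ge0.
have x1 : x <= 1 by lra.
have d2 : e * w ^+ 3 <= 2^-1 by lra.
have := ln_bound x0 x1 ed (rho_gt0 n t) tt d2.
by rewrite /lnerr -/x => h; apply: le_trans h _; lra.
Qed.

(** A [q]-factorial is a product of [q]-integers, each of which is the generating
    function of a uniform distribution; means and variances add up. *)
Lemma horner_qfact n t : (qfact R n).[expR t] =
  n`!%:R * expR (t * (n%:R * (n%:R - 1) / 4) +
    t ^+ 2 * (n%:R * (n%:R - 1) * (2 * n%:R + 5) / 144) + \sum_(i < n) lnerr i t).
Proof.
elim: n => [|n IH].
  by rewrite /qfact !big_ord0 hornerE fact0 !mul0r !mulr0 !addr0 expR0 mulr1.
rewrite qfactS hornerM IH horner_qint rhoE -!expRD mulrACA -expRD factS natrM.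
rewrite [n`!%:R * _]mulrC; congr (_ * expR _); rewrite big_ord_recr /= -!natr1.
by field.
Qed.

Lemma horner_qfact_gt0 n t : 0 < (qfact R n).[expR t].
Proof. by rewrite horner_qfact mulr_gt0 ?expR_gt0// ltr0n fact_gt0. Qed.

(** The terms in [t] and [t ^+ 2] come from the mean [k * (n - k) / 2] and the
    variance [k * (n - k) * (n + 1) / 12] of the Gaussian binomial distribution. *)
Definition qbinom_exponent (n k : nat) (t : R) : R :=
  t * (k%:R * (n%:R - k%:R) / 2) +
  t ^+ 2 * (k%:R * (n%:R - k%:R) * (n%:R + 1) / 24) +
  (\sum_(i < n) lnerr i t - \sum_(i < k) lnerr i t - \sum_(i < n - k) lnerr i t).

Lemma horner_qbinom n k t : (k <= n)%N -> (qbinom R n k).[expR t] =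
  'C(n, k)%:R * expR (qbinom_exponent n k t).
Proof.
move=> kn.
have := congr1 (fun p : {poly R} => p.[expR t]) (qbinom_fact R kn).
rewrite /= !hornerM => H.
have p1 := horner_qfact_gt0 k t; have p2 := horner_qfact_gt0 (n - k) t.
have p12 : (qfact R k).[expR t] * (qfact R (n - k)).[expR t] != 0.
  by rewrite gt_eqF// mulr_gt0.
apply: (mulIf p12); rewrite H !horner_qfact -(bin_fact kn) !natrM.
have perm (A B C E1 E2 E3 : R) :
  A * E1 * (B * E2 * (C * E3)) = A * (B * C) * (E1 * (E2 * E3)) by ring.
rewrite perm -!expRD; congr (_ * expR _).
by rewrite /qbinom_exponent natrB//; field.
Qed.

(** One constant controls, through a single size [M], all the Gaussian binomials
    that occur in a supernomial. *)
Definition qbinom_error_constant (C : R) : Prop := forall (M : R) n k t,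
  (k <= n)%N -> n%:R <= M -> C * (M * `|t|) ^+ 3 <= 1 -> M * `|t| <= 1 ->
  `|qbinom_exponent n k t - (t * (k%:R * (n%:R - k%:R) / 2) +
     t ^+ 2 * (k%:R * (n%:R - k%:R) * (n%:R + 1) / 24))| <=
  3 * M * (C * (M * `|t|) ^+ 3).

Lemma qbinom_exponent_error : exists2 C : R, 0 <= C & qbinom_error_constant C.
Proof.
have [C C0 cb] := lnerr_bound; exists C => // M n k t kn nM c1 c2.
have M0 : 0 <= M by apply: le_trans nM.
have w0 : 0 <= M * `|t| by rewrite mulr_ge0.
have B0 : 0 <= C * (M * `|t|) ^+ 3 by rewrite mulr_ge0// exprn_ge0.
have sumb l : (l <= n)%N -> `|\sum_(i < l) lnerr i t| <= M * (C * (M * `|t|) ^+ 3).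
  move=> ln; apply: le_trans (ler_norm_sum _ _ _) _.
  apply: (@le_trans _ _ (\sum_(i < l) C * (M * `|t|) ^+ 3)).
    apply: ler_sum => i _.
    have it : i%:R * `|t| <= M * `|t|.
      rewrite ler_wpM2r// (le_trans _ nM)// ler_nat.
      by rewrite (leq_trans _ ln)// ltnW.
    have it0 : 0 <= i%:R * `|t| by rewrite mulr_ge0.
    have it3 : C * (i%:R * `|t|) ^+ 3 <= C * (M * `|t|) ^+ 3.
      by rewrite ler_wpM2l//; apply: lerXn2r; rewrite ?nnegrE.
    by apply: (le_trans _ it3); apply: cb; [exact: (le_trans it3 c1)|exact: (le_trans it c2)].
  rewrite sumr_const card_ord -[_ *+ l]mulr_natl ler_wpM2r// (le_trans _ nM)//.
  by rewrite ler_nat.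
rewrite /qbinom_exponent [_ - _](_ : _ = \sum_(i < n) lnerr i t -
  \sum_(i < k) lnerr i t - \sum_(i < n - k) lnerr i t); last by ring.
have := sumb n (leqnn n); have := sumb k kn; have := sumb (n - k)%N (leq_subr k n).
set B := M * (C * _) => b1 b2 b3.
apply: le_trans (ler_normB _ _) _; have := ler_normB (\sum_(i < n) lnerr i t) (\sum_(i < k) lnerr i t).
rewrite -mulrA -/B; lra.
Qed.

Lemma lnerr0 n : lnerr n 0 = 0.
Proof.
have [C C0 H] := lnerr_bound; apply/eqP; rewrite -normr_le0.
by have := H n 0; rewrite normr0 mulr0 expr0n !mulr0 ler01 => /(_ isT isT).
Qed.

Lemma qbinom_exponent0 n k : qbinom_exponent n k 0 = 0.
Proof.
rewrite /qbinom_exponent expr0n !mul0r !add0r.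
by rewrite !big1 ?subrr// => i _; exact: lnerr0.
Qed.

Lemma horner_qbinom_gen n k (t : R) : (qbinom R n k).[expR t] =
  'C(n, k)%:R * expR (qbinom_exponent n k t).
Proof.
have [kn|nk] := leqP k n; first exact: horner_qbinom.
by rewrite /qbinom leqNgt nk horner0 bin_small// mul0r.
Qed.

End GaussianBinomial.

(** * Moment generating function of the conditioned tuple *)

Section TriangularSums.
Variable R : realType.

Lemma exchange_triangle m (F : nat -> nat -> R) :
  \sum_(1 <= i < m.+1) \sum_(1 <= k < i.+1) F i k =
  \sum_(1 <= k < m.+1) \sum_(k <= i < m.+1) F i k.
Proof.
rewrite (eq_big_nat _ _ (F2 := fun i => \sum_(1 <= k < m.+1 | (k < i.+1)%N) F i k)); last first.
  by move=> i /andP[_ im]; rewrite (big_nat_widen _ _ m.+1)//.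
rewrite (exchange_big_dep_nat xpredT)//=.
apply: eq_big_nat => k /andP[k1 _].
by rewrite (big_nat_widenl k 1)//.
Qed.

Lemma exchange_triangle2 m (F : nat -> nat -> nat -> R) :
  \sum_(1 <= i < m.+1) \sum_(1 <= k < i.+1) \sum_(1 <= l < i.+1) F i k l =
  \sum_(1 <= k < m.+1) \sum_(1 <= l < m.+1) \sum_(maxn k l <= i < m.+1) F i k l.
Proof.
rewrite exchange_triangle; apply: eq_big_nat => k /andP[k1 _].
rewrite (eq_big_nat _ _ (F2 := fun i => \sum_(1 <= l < m.+1 | (l < i.+1)%N) F i k l)); last first.
  by move=> i /andP[_ im]; rewrite (big_nat_widen _ _ m.+1)//.
rewrite (exchange_big_dep_nat xpredT)//=.
apply: eq_big_nat => l /andP[l1 _].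
by rewrite (big_nat_widenl (maxn k l) k) ?leq_maxl//; rewrite [LHS]big_nat_cond [RHS]big_nat_cond;
  apply: eq_bigl => i; rewrite geq_max ltnS; case: (k <= i)%N; rewrite ?andbF ?andbT.
Qed.

Lemma eq_avg_le i (f g : nat -> R) : (forall r, (r <= i)%N -> f r = g r) ->
  avg i f = avg i g.
Proof.
by move=> fg; rewrite /avg; congr (_ * _); apply: eq_bigr => r _; rewrite fg// -ltnS.
Qed.

Lemma le_sum_term m (F : nat -> R) k : (forall i, 0 <= F i) -> (0 < k <= m)%N ->
  F k <= \sum_(1 <= i < m.+1) F i.
Proof.
move=> F0 km; rewrite (bigD1_seq k) ?mem_index_iota ?iota_uniq//= lerDl.
by rewrite sumr_ge0.
Qed.

End TriangularSums.

Section QuadraticForm.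
Variables (R : realType) (m : nat) (av : 'rV[R]_m).
Local Notation a := (ent av).

(** The covariance with the total, per unit of [N], of the statistic
    [\sum_k y k * J k] before conditioning. *)
Definition covtotal (y : nat -> R) : R :=
  \sum_(1 <= k < m.+1) y k * (k%:R / 2 * c_ av k).

(** The variance of that statistic before conditioning, per unit of [N]. *)
Definition varsum (y : nat -> R) : R :=
  \sum_(1 <= i < m.+1) a i * avg i (fun r => tilt y i r ^+ 2).

(** Its variance after conditioning on the total. *)
Definition quad (y : nat -> R) : R :=
  \sum_(1 <= k < m.+1) \sum_(1 <= l < m.+1) y k * y l * Sigma av k l.

Lemma covtotalE y : \sum_(1 <= i < m.+1)
    a i * avg i (fun r => tilt y i r * (r%:R - i%:R / 2)) = covtotal y.
Proof.
under eq_bigr do rewrite avg_tilt_nat mulr_sumr.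
rewrite exchange_triangle; apply: eq_bigr => k _.
rewrite /c_ !mulr_sumr; apply: eq_bigr => i _.
by field; rewrite ?nat1r ?natr1 pnatr_eq0.
Qed.

(** The first term of [Sigma] is the part of the variance that is explained by the
    total. *)
Lemma varsumE y : varsum y = quad y + covtotal y ^+ 2 / sigma2 av.
Proof.
rewrite /varsum.
under eq_bigr do rewrite avg_tilt_sqr mulr_sumr.
under eq_bigr do under eq_bigr do rewrite mulr_sumr.
rewrite exchange_triangle2 /quad /covtotal expr2 !mulr_suml -big_split /=.
apply: eq_bigr => k _; rewrite mulr_sumr mulr_suml -big_split /=.
apply: eq_bigr => l _.
have -> : \sum_(maxn k l <= i < m.+1) a i * (y k * y l * indcov R i k l) =
  y k * y l * ((minn k l)%:R * (\sum_(maxn k l <= i < m.+1) a i / i.+1%:R) -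
    (k * l)%:R * (\sum_(maxn k l <= i < m.+1) a i / i.+1%:R ^+ 2)).
  rewrite !mulr_sumr -sumrB mulr_sumr; apply: eq_bigr => i _.
  by rewrite /indcov; ring.
rewrite /Sigma natrM invfM.
have -> : (4 : R)^-1 = 2^-1 * 2^-1 by rewrite -invfM -natrM.
by ring.
Qed.

Lemma covtotalD y lam : covtotal (fun k => y k + lam) = covtotal y + lam * sigma2 av.
Proof.
rewrite -!covtotalE /sigma2 mulrA mulr_sumr -big_split /=; apply: eq_bigr => i _.
rewrite (eq_avg_le (g := fun r => tilt y i r * (r%:R - i%:R / 2) +
   lam * (r%:R - i%:R / 2) ^+ 2)); last by move=> r ri; rewrite tiltD//; ring.
by rewrite avgD avgZ avg_sqr; field.
Qed.

Lemma varsumD y lam : varsum (fun k => y k + lam) =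
  varsum y + 2 * lam * covtotal y + lam ^+ 2 * sigma2 av.
Proof.
rewrite -covtotalE /varsum /sigma2 !mulr_sumr -!big_split /=; apply: eq_bigr => i _.
rewrite (eq_avg_le (g := fun r => tilt y i r ^+ 2 + 2 * lam * (tilt y i r * (r%:R - i%:R / 2)) +
   lam ^+ 2 * (r%:R - i%:R / 2) ^+ 2)); last by move=> r ri; rewrite tiltD//; ring.
by rewrite !avgD !avgZ avg_sqr; field.
Qed.

Lemma sigma2_gt0 : (forall i, 0 <= a i) -> av != 0 -> 0 < sigma2 av.
Proof.
move=> a0 /rV0Pn[k ak]; rewrite /sigma2 mulr_gt0 ?invr_gt0//.
apply: (lt_le_trans (y := (k.+1 * (k.+1 + 2))%:R * a k.+1)).
  by rewrite mulr_gt0 ?ltr0n// lt0r a0 ent_ord ak.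
apply: (le_sum_term (F := fun k => (k * (k + 2))%:R * a k)); last exact: ltn_ord.
by move=> i; rewrite mulr_ge0.
Qed.

Hypothesis sigma_gt0 : 0 < sigma2 av.

(** Shifting [y] by a constant does not change anything on the slice where the
    total is fixed; this shift makes the statistic uncorrelated with the total. *)
Definition decorrelated (y : nat -> R) (k : nat) : R := y k - covtotal y / sigma2 av.

Lemma covtotal_decorrelated y : covtotal (decorrelated y) = 0.
Proof.
rewrite (covtotalD y (- (covtotal y / sigma2 av))).
by rewrite mulNr divfK ?subrr// gt_eqF.
Qed.

Lemma varsum_decorrelated y : varsum (decorrelated y) = quad y.
Proof.
rewrite (varsumD y (- (covtotal y / sigma2 av))) varsumE.
by field; rewrite gt_eqF.
Qed.

Lemma quad_ge0 y : (forall i, 0 <= a i) -> 0 <= quad y.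
Proof.
move=> a0; rewrite -varsum_decorrelated /varsum sumr_ge0// => i _.
by rewrite mulr_ge0// /avg mulr_ge0 ?invr_ge0// sumr_ge0// => r _; rewrite sqr_ge0.
Qed.

End QuadraticForm.

Section ConditionedTuple.
Variables (R : realType) (m : nat) (L : nat -> 'rV[nat]_m) (av : 'rV[R]_m).
Hypothesis La : (N%:R^-1 : R) *: map_mx (fun n : nat => n%:R : R) (L N)
  @[N --> \oo] --> av.
Hypothesis av_neq0 : av != 0.
Local Notation a := (ent av).

Definition copies (N i : nat) : nat := ent (L N) i.
Definition realL (N : nat) : 'rV[R]_m := map_mx (fun n : nat => n%:R : R) (L N).

Lemma ent_realL N i : ent (realL N) i = (copies N i)%:R.
Proof. by rewrite /realL ent_map. Qed.

Lemma copies_cvg i : (copies N i)%:R / N%:R @[N --> \oo] --> a i.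
Proof.
have [im|im] := ltnP m i.
  rewrite ent_out//; apply: (@cvgn_eq _ _ (fun=> 0)); last exact: cvg_cst.
  by move=> N; rewrite /copies ent_out// mul0r.
case: i im => [|i] im.
  apply: (@cvgn_eq _ _ (fun=> 0)); last exact: cvg_cst.
  by move=> N; rewrite /copies /ent mul0r.
rewrite -[i.+1]/((Ordinal im) : 'I_m).+1 ent_ord.
apply: (@cvgn_eq _ _ (fun N => (N%:R^-1 *: map_mx (fun n : nat => n%:R : R) (L N)) 0 (Ordinal im))).
  by move=> N; rewrite /copies ent_ord !mxE mulrC.
exact: (cvg_comp _ _ La (@coord_continuous R 1 m 0 (Ordinal im) av)).
Qed.

Lemma a_ge0 i : 0 <= a i.
Proof.
have H := @copies_cvg i.
by apply: (cvgr_to_ge H); apply: nearW => N; rewrite divr_ge0.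
Qed.

Lemma a_gt0 : exists2 i, (1 <= i < m.+1)%N & 0 < a i.
Proof.
have /rV0Pn[k ak] := av_neq0.
exists k.+1; last by rewrite lt0r a_ge0 ent_ord ak.
by apply/andP; split => //; rewrite ltnS; exact: ltn_ord.
Qed.

Definition midsum (N : nat) : nat := central_index (L N).

Lemma total_mid : ((midsum N)%:R - (\sum_(1 <= i < m.+1) (i * copies N i)%N%:R) / 2) / rt R N
  @[N --> \oo] --> (0 : R).
Proof.
apply: (@cvgn_norm0 _ _ (fun N => (rt R N)^-1)); first exact: cvgn_invsqrt.
move=> N; rewrite normrM [`|_^-1|]ger0_norm ?invr_ge0 ?sqrtr_ge0//.
rewrite ler_piMl ?invr_ge0 ?sqrtr_ge0//.
rewrite -natr_sum /midsum /central_index; set n := (\sum_(1 <= i < m.+1) i * _)%N.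
have {2}-> : n = (odd n + n./2.*2)%N by rewrite odd_double_half.
rewrite natrD -mul2n natrM; case: odd => /=; rewrite ler_norml; apply/andP; split; lra.
Qed.

(** The sum over the tuples with the prescribed total; dividing by
    [slicesum N (fun=> 1)] gives the conditional expectation. *)
Definition slicesum (N : nat) (phi : (nat -> nat) -> R) : R :=
  \sum_(j : 'rV['I_(midsum N).+1]_m | (\sum_(i < m) j 0%R i == midsum N)%N)
    (weight m (copies N) (ent (row_nat j)))%:R * phi (ent (row_nat j)).

Definition lin (y x : nat -> R) : R := \sum_(1 <= k < m.+1) y k * x k.

Definition dev (N : nat) (J : nat -> nat) (k : nat) : R := (J k)%:R - b_ (realL N) k.

(** A linear statistic is a sum over the copies, so its exponential can be
    distributed over the factors of the generating function. *)
Lemma coef_tilted_gf eta N :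
  (tilted_gf m copies (tilt eta) N)`_(midsum N) =
  (\prod_(1 <= i < m.+1) i.+1%:R^-1 ^+ copies N i) *
  slicesum N (fun J => expR ((rt R N)^-1 * lin eta (dev N J))).
Proof.
have factor i : \sum_(r < i.+1) (i.+1%:R^-1 * expR (tilt eta i r / rt R N)) *: 'X^r =
    (i.+1%:R^-1 * expR (- ((rt R N)^-1 * \sum_(1 <= k < i.+1) eta k * (k%:R / i.+1%:R)))) *:
      nested (fun k => expR ((rt R N)^-1 * eta k)) 1 i.
  rewrite nested_exp scaler_sumr; apply: eq_bigr => r _.
  rewrite scalerA -mulrA -expRD; congr ((_ * expR _) *: _).
  by rewrite /tilt; ring.
rewrite /tilted_gf; under eq_bigr do rewrite factor exprZn.
rewrite scaler_prod coefZ -(weight_gf _ _ _ (leqnn _)) /slicesum !mulr_sumr.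
apply: eq_bigr => j _; set J := ent (row_nat j).
under eq_bigr do rewrite exprMn.
rewrite big_split /= -!mulrA; congr (_ * _).
rewrite mulrCA; congr (_ * _).
have -> : \prod_(1 <= l < m.+1) expR ((rt R N)^-1 * eta l) ^+ J l =
    expR ((rt R N)^-1 * \sum_(1 <= l < m.+1) eta l * (J l)%:R).
  rewrite mulr_sumr expR_sum; apply: eq_bigr => l _.
  by rewrite -expRM_natr mulrA.
have -> : \prod_(1 <= i < m.+1) expR (- ((rt R N)^-1 *
     \sum_(1 <= k < i.+1) eta k * (k%:R / i.+1%:R))) ^+ copies N i =
   expR (- ((rt R N)^-1 * \sum_(1 <= k < m.+1) eta k * b_ (realL N) k)).
  rewrite (eq_bigr (fun i => expR (- ((rt R N)^-1 *
     \sum_(1 <= k < i.+1) eta k * (k%:R / i.+1%:R) * (copies N i)%:R)))); last first.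
    by move=> i _; rewrite -expRM_natr mulNr -mulrA mulr_suml.
  rewrite -expR_sum sumrN -mulr_sumr exchange_triangle; congr (expR (- (_ * _))).
  apply: eq_bigr => k _; rewrite /b_ !mulr_sumr; apply: eq_bigr => i _.
  by rewrite ent_realL; ring.
rewrite -expRD; congr expR; rewrite /lin /dev.
under [in RHS]eq_bigr do rewrite mulrBr.
by rewrite sumrB; ring.
Qed.

Lemma sum_b N : \sum_(1 <= k < m.+1) b_ (realL N) k =
  (\sum_(1 <= i < m.+1) (i * copies N i)%N%:R) / 2.
Proof.
rewrite /b_; under eq_bigr do rewrite mulr_sumr.
rewrite -exchange_triangle mulr_suml; apply: eq_bigr => i _.
rewrite -mulr_suml sum_id ent_realL natrM.
by field; rewrite ?nat1r ?natr1 pnatr_eq0.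
Qed.

Lemma slice_total N (j : 'rV['I_(midsum N).+1]_m) :
  (\sum_(i < m) j 0%R i == midsum N)%N ->
  \sum_(1 <= k < m.+1) (ent (row_nat j) k)%:R = (midsum N)%:R :> R.
Proof.
move=> /eqP jt; rewrite -natr_sum -[in RHS]jt; congr _%:R.
by rewrite big_add1 big_mkord; apply: eq_bigr => i _; rewrite ent_ord mxE.
Qed.

Lemma slicesum_cvg_decorrelated eta : covtotal av eta = 0 ->
  rt R N * ((\prod_(1 <= i < m.+1) i.+1%:R^-1 ^+ copies N i) *
    slicesum N (fun J => expR ((rt R N)^-1 * lin eta (dev N J)))) @[N --> \oo] -->
  expR (varsum av eta / 2) *
   ((\int[lebesgue_measure]_x expR (- (sigma2 av / 2 * x ^+ 2))) / (2 * pi)).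
Proof.
move=> orth; have [i0 im ai0] := a_gt0.
apply: (@cvgn_eq _ _ (fun N => rt R N * (tilted_gf m copies (tilt eta) N)`_(midsum N))).
  by move=> N; rewrite coef_tilted_gf.
apply: (@local_limit R m a copies midsum i0) => //.
- by move=> i _; exact: copies_cvg.
- exact: total_mid.
- by move=> i _; exact: avg_tilt.
- by rewrite covtotalE.
Qed.

Lemma lin0 x : lin (fun=> 0) x = 0.
Proof. by rewrite /lin big1// => k _; rewrite mul0r. Qed.

Lemma varsum0 : varsum av (fun=> 0) = 0.
Proof.
rewrite /varsum big1// => i _.
rewrite (eq_avg i (g := fun=> 0)); first by rewrite avg_cst mulr0.
move=> r; rewrite tiltE big1 ?expr0n// => k _; exact: mul0r.
Qed.

Lemma covtotal0 : covtotal av (fun=> 0) = 0.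
Proof. by rewrite /covtotal big1// => k _; rewrite mul0r. Qed.

Let K0 : R := (\int[lebesgue_measure]_x expR (- (sigma2 av / 2 * x ^+ 2))) / (2 * pi).

Let K0_gt0 : 0 < K0.
Proof.
rewrite /K0 divr_gt0 ?mulr_gt0 ?pi_gt0//; apply: Rintegral_gauss_gt0.
by rewrite divr_gt0// (sigma2_gt0 a_ge0).
Qed.

Let mass_cvg : rt R N * ((\prod_(1 <= i < m.+1) i.+1%:R^-1 ^+ copies N i) *
    slicesum N (fun=> 1)) @[N --> \oo] --> K0.
Proof.
have := slicesum_cvg_decorrelated covtotal0.
rewrite varsum0 mul0r expR0 mul1r; apply: cvg_trans; apply: near_eq_cvg; apply: nearW => N.
congr (_ * (_ * slicesum N _)); apply/funext => J.
by rewrite lin0 mulr0 expR0.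
Qed.

Lemma slicesum1_gt0 : \forall N \near \oo, 0 < slicesum N (fun=> 1).
Proof.
have h : - K0 < - (K0 / 2) by rewrite ltrN2 gtr_pMr// invf_lt1// ltr1n.
have H := cvgn_near_le (cvgN mass_cvg) h; near=> N.
have HN : - (rt R N * ((\prod_(1 <= i < m.+1) i.+1%:R^-1 ^+ copies N i) *
    slicesum N (fun=> 1))) <= - (K0 / 2) by near: N; exact: H.
have pos : 0 <= slicesum N (fun=> 1).
  by rewrite /slicesum sumr_ge0// => j _; rewrite mulr1.
rewrite lt_neqAle pos andbT eq_sym; apply/eqP => s0.
move: HN; rewrite s0 !mulr0 oppr0; have : 0 < K0 / 2 by rewrite divr_gt0.
lra.
Unshelve. all: by end_near. Qed.

(** On the slice [y] may be replaced by its decorrelated version, at the cost of a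
    factor that tends to 1 because the slice is within 1 of the middle.  The
    local limit theorem then applies to the numerator and to the denominator,
    and all that depends on the total cancels in the ratio. *)
Theorem slice_mgf_cvg y :
  slicesum N (fun J => expR ((rt R N)^-1 * lin y (dev N J))) / slicesum N (fun=> 1)
    @[N --> \oo] --> expR (quad av y / 2).
Proof.
pose eta := decorrelated av y.
pose lam := covtotal av y / sigma2 av.
have c1 := slicesum_cvg_decorrelated (covtotal_decorrelated (sigma2_gt0 a_ge0 av_neq0) y).
have sh N : slicesum N (fun J => expR ((rt R N)^-1 * lin y (dev N J))) =
  expR (lam * (((midsum N)%:R - (\sum_(1 <= i < m.+1) (i * copies N i)%N%:R) / 2) / rt R N)) *
  slicesum N (fun J => expR ((rt R N)^-1 * lin eta (dev N J))).
  rewrite /slicesum mulr_sumr; apply: eq_bigr => j jt; rewrite mulrCA -expRD.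
  congr (_ * expR _); rewrite -(slice_total jt) -sum_b -sumrB.
  rewrite [X in _ = X + _](_ : _ = (rt R N)^-1 *
    (lam * \sum_(1 <= k < m.+1) ((ent (row_nat j) k)%:R - b_ (realL N) k))); last by ring.
  rewrite -mulrDr; congr (_ * _).
  rewrite /lin mulr_sumr -big_split /=; apply: eq_bigr => k _.
  by rewrite /eta /decorrelated /dev -/lam; ring.
rewrite -(varsum_decorrelated (sigma2_gt0 a_ge0 av_neq0)) -/eta.
rewrite -[X in _ --> X](_ : expR (lam * 0) * (expR (varsum av eta / 2) * K0 / K0) = _); last first.
  by rewrite mulr0 expR0 mul1r mulfK// gt_eqF.
have c2 : (rt R N * ((\prod_(1 <= i < m.+1) i.+1%:R^-1 ^+ copies N i) *
    slicesum N (fun J => expR ((rt R N)^-1 * lin eta (dev N J))))) /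
   (rt R N * ((\prod_(1 <= i < m.+1) i.+1%:R^-1 ^+ copies N i) *
    slicesum N (fun=> 1))) @[N --> \oo] --> expR (varsum av eta / 2) * K0 / K0.
  by apply: cvgM => //; apply: cvgV => //; rewrite gt_eqF.
have c3 : expR (lam * (((midsum N)%:R -
    (\sum_(1 <= i < m.+1) (i * copies N i)%N%:R) / 2) / rt R N)) @[N --> \oo] --> expR (lam * 0).
  by apply: cvg_expR_comp; apply: cvgM; [exact: cvg_cst|exact: total_mid].
refine (cvg_trans (near_eq_cvg _) (cvgM c3 c2)).
near=> N; have N0 : (0 < N)%N by near: N; exact: nbhs_infty_gt.
rewrite sh -mulrA; congr (_ * _).
have r0 : rt R N != 0 by rewrite gt_eqF// rt_gt0.
have p0 : \prod_(1 <= i < m.+1) (i.+1%:R^-1 : R) ^+ copies N i != 0.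
  rewrite prodf_seq_neq0; apply/allP => i _; apply/implyP => _.
  by rewrite expf_neq0// invr_eq0 pnatr_eq0.
by rewrite !invfM mulrACA divff// mul1r mulrACA divff// mul1r.
Unshelve. all: by end_near. Qed.

End ConditionedTuple.

(** * The exponent near the centre of the slice *)

Section Energy.
Variables (R : realType) (m : nat) (v : 'rV[R]_m).
Local Notation a := (ent v).
Local Notation b := (b_ v).

(** The mean and the leading part of the variance of the distribution on the
    exponents of [q] in the term of a tuple, extended to real tuples.  The
    variance comes from the Gaussian binomials only. *)
Definition energy (x : nat -> R) : R :=
  \sum_(1 <= i < m.+1) x i * (x i + \sum_(1 <= l < i) a l + (a i + x i.+1 - x i) / 2).

Definition spread (x : nat -> R) : R :=
  12^-1 * \sum_(1 <= i < m.+1) (a i + x i.+1 - x i) * x i * (a i + x i.+1).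

Definition energy_quad (D : nat -> R) : R :=
  \sum_(1 <= i < m.+1) D i * (D i + D i.+1) / 2.

Lemma b_out i : (m < i)%N -> b i = 0.
Proof. by move=> mi; rewrite /b_ big_geq// mulr0. Qed.

(** [b i] and [b i.+1 + a i] are [i] times and [i.+1] times the same sum. *)
Lemma b_succ i : (0 < i <= m)%N -> b i.+1 = i.+1%:R / i%:R * b i - a i.
Proof.
move=> /andP[i0 im]; rewrite /b_ (big_ltn (m := i))// [i.+1%:R / _ * _]mulrA divfK ?pnatr_eq0 -?lt0n//.
by field; rewrite ?nat1r ?natr1 pnatr_eq0.
Qed.

Lemma energy_b : energy b = limit_mean v.
Proof.
apply: eq_big_nat => i /andP[i0 im]; rewrite (b_succ (i := i)) ?i0//.
rewrite /b_; set A := \sum_(1 <= l < i) _; set B := \sum_(i <= l < _) _.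
by rewrite -natr1; field; rewrite pnatr_eq0 -lt0n.
Qed.

Lemma sum_shift (F D : nat -> R) : F 0%N = 0 -> D m.+1 = 0 ->
  \sum_(1 <= i < m.+1) F i * D i.+1 = \sum_(1 <= i < m.+1) F i.-1 * D i.
Proof.
move=> F0 D0.
transitivity (\sum_(0 <= i < m.+1) F i * D i.+1).
  by rewrite [RHS]big_ltn// F0 mul0r add0r.
rewrite big_nat_recr//= D0 mulr0 addr0 [RHS]big_add1 /=.
by apply: eq_bigr => i _.
Qed.

(** The energy is a quadratic function, whose value at [b] is the mean and whose
    gradient there is [f_ v / 2]. *)
Lemma energy_expand (x : nat -> R) : x m.+1 = 0 ->
  energy x = limit_mean v + lin m (f_ v) (fun k => x k - b k) / 2
             + energy_quad (fun k => x k - b k).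
Proof.
move=> xm; rewrite -energy_b; pose D k := x k - b k.
have xE k : x k = b k + D k by rewrite /D addrC subrK.
have D0 : D m.+1 = 0 by rewrite /D xm b_out ?subrr.
have b0 : b 0%N = 0 by rewrite /b_ mul0r.
have -> : lin m (f_ v) D = \sum_(1 <= i < m.+1) ((a i + b i.+1 + 2 * b i + 2 * \sum_(1 <= l < i) a l) * D i) +
    \sum_(1 <= i < m.+1) b i * D i.+1.
  by rewrite sum_shift// -big_split /=; apply: eq_bigr => i _; rewrite /f_; ring.
rewrite /energy /energy_quad -!big_split /= mulr_suml -!big_split /=.
by apply: eq_bigr => i _; rewrite !xE; field.
Qed.

Lemma le_sum_succ (F : nat -> R) : (forall i, 0 <= F i) -> F m.+1 = 0 ->
  \sum_(1 <= i < m.+1) F i.+1 <= \sum_(1 <= i < m.+1) F i.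
Proof.
move=> F0 Fm; have [->|m0] := posnP m; first by rewrite !big_geq.
have -> : \sum_(1 <= i < m.+1) F i.+1 = \sum_(2 <= i < m.+2) F i by rewrite [RHS]big_add1.
by rewrite big_nat_recr//= Fm addr0 [leRHS]big_ltn// lerDr.
Qed.

Lemma energy_quad_le (D : nat -> R) : D m.+1 = 0 ->
  `|energy_quad D| <= (\sum_(1 <= i < m.+1) `|D i|) ^+ 2.
Proof.
move=> D0; set S := \sum_(1 <= i < m.+1) `|D i|.
have S0 : 0 <= S by exact: sumr_ge0.
have DS k : (0 < k <= m.+1)%N -> `|D k| <= S.
  move=> /andP[k0]; rewrite leq_eqVlt => /predU1P[->|km].
    by rewrite D0 normr0.
  by apply: (le_sum_term (F := fun k => `|D k|)) => //; rewrite k0.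
apply: le_trans (ler_norm_sum _ _ _) _.
rewrite expr2 mulr_suml; apply: ler_sum_nat => i /andP[i0 im].
rewrite -mulrA normrM ler_wpM2l// normrM [`|2^-1|]ger0_norm ?invr_ge0//.
rewrite ler_pdivrMr//; apply: le_trans (ler_normD _ _) _.
have h1 : `|D i| <= S by apply: DS; rewrite i0 ltnW.
have h2 : `|D i.+1| <= S by apply: DS.
by move: h1 h2; set x := `|D i|; set y := `|D i.+1|; lra.
Qed.

Lemma cubic_lipschitz (M k n k' n' : R) : 0 <= k <= M -> 0 <= k' <= M ->
  0 <= n <= M -> 0 <= n' <= M ->
  `|(n - k) * k * n - (n' - k') * k' * n'| <= 6 * M ^+ 2 * (`|k - k'| + `|n - n'|).
Proof.
move=> /andP[k0 kM] /andP[k'0 k'M] /andP[n0 nM] /andP[n'0 n'M].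
have -> : (n - k) * k * n - (n' - k') * k' * n' =
    (k - k') * (n ^+ 2 - (k + k') * n) + (n - n') * (k' * (n + n') - k' ^+ 2) by ring.
apply: le_trans (ler_normD _ _) _; rewrite (normrM (k - k')) (normrM (n - n')) [leRHS]mulrDr.
by apply: lerD; rewrite mulrC ler_wpM2r// ler_norml; apply/andP; split; nra.
Qed.

Lemma spread_lipschitz (M : R) (x y : nat -> R) :
  (forall i, (0 < i <= m)%N -> 0 <= a i + x i.+1 <= M) ->
  (forall i, (0 < i <= m)%N -> 0 <= a i + y i.+1 <= M) ->
  (forall i, (0 < i <= m)%N -> 0 <= x i <= M) ->
  (forall i, (0 < i <= m)%N -> 0 <= y i <= M) ->
  x m.+1 = 0 -> y m.+1 = 0 ->
  `|spread x - spread y| <= M ^+ 2 * \sum_(1 <= i < m.+1) `|x i - y i|.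
Proof.
move=> ax ay x0 y0 xm ym; rewrite /spread -mulrBr -sumrB normrM ger0_norm ?invr_ge0//.
rewrite mulrC ler_pdivrMr//; apply: le_trans (ler_norm_sum _ _ _) _.
apply: (@le_trans _ _ (\sum_(1 <= i < m.+1)
    6 * M ^+ 2 * (`|x i - y i| + `|x i.+1 - y i.+1|))).
  apply: ler_sum_nat => i /andP[i0 im].
  have -> : x i.+1 - y i.+1 = a i + x i.+1 - (a i + y i.+1) by ring.
  by apply: cubic_lipschitz; [apply: x0|apply: y0|apply: ax|apply: ay]; rewrite i0.
rewrite -mulr_sumr big_split /=.
have := @le_sum_succ (fun i => `|x i - y i|) (fun=> normr_ge0 _).
rewrite xm ym subrr normr0 => /(_ erefl).
set A := \sum_(1 <= i < _) _; set B := \sum_(1 <= i < _) _ => BA.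
have M0 : 0 <= M ^+ 2 by rewrite sqr_ge0.
nra.
Qed.

End Energy.

Section Scaling.
Variables (R : realType) (m : nat).
Implicit Types v : 'rV[R]_m.

Lemma entZ c v i : ent (c *: v) i = c * ent v i.
Proof. have [im|im] := ltnP m i; first by rewrite !ent_out// mulr0.
case: i im => [|i] im; first by rewrite /ent mulr0.
by rewrite -[i.+1]/((Ordinal im) : 'I_m).+1 !ent_ord mxE. Qed.

Lemma betaZ c v i : \sum_(i <= l < m.+1) ent (c *: v) l / l.+1%:R =
  c * \sum_(i <= l < m.+1) ent v l / l.+1%:R.
Proof. by rewrite mulr_sumr; apply: eq_bigr => l _; rewrite entZ mulrA. Qed.

Lemma prefixZ c v i : \sum_(1 <= l < i) ent (c *: v) l = c * \sum_(1 <= l < i) ent v l.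
Proof. by rewrite mulr_sumr; apply: eq_bigr => l _; rewrite entZ. Qed.

Lemma b_Z c v i : b_ (c *: v) i = c * b_ v i.
Proof. by rewrite /b_ betaZ mulrCA. Qed.

Lemma f_Z c v i : f_ (c *: v) i = c * f_ v i.
Proof. by rewrite /f_ entZ !b_Z prefixZ; ring. Qed.

Lemma limit_meanZ c v : limit_mean (c *: v) = c ^+ 2 * limit_mean v.
Proof. by rewrite /limit_mean mulr_sumr; apply: eq_bigr => i _; rewrite betaZ prefixZ; ring. Qed.

Lemma v_Z c v : v_ (c *: v) = c ^+ 3 * v_ v.
Proof.
rewrite /v_ mulrCA; congr (_ * _); rewrite mulr_sumr; apply: eq_bigr => i _.
by rewrite entZ !b_Z; ring.
Qed.

Variables (u : nat -> 'rV[R]_m) (v : 'rV[R]_m).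
Hypothesis uv : forall i, ent (u N) i @[N --> \oo] --> ent v i.

Lemma beta_cvg i : \sum_(i <= l < m.+1) ent (u N) l / l.+1%:R @[N --> \oo] -->
  \sum_(i <= l < m.+1) ent v l / l.+1%:R.
Proof. by apply: cvgn_sum_nat => l _; apply: cvgM; [exact: uv|exact: cvg_cst]. Qed.

Lemma prefix_cvg i : \sum_(1 <= l < i) ent (u N) l @[N --> \oo] --> \sum_(1 <= l < i) ent v l.
Proof. by apply: cvgn_sum_nat => l _; exact: uv. Qed.

Lemma b_cvg i : b_ (u N) i @[N --> \oo] --> b_ v i.
Proof. by apply: cvgM; [exact: cvg_cst|exact: beta_cvg]. Qed.

Lemma f_cvg i : f_ (u N) i @[N --> \oo] --> f_ v i.
Proof.
apply: cvgD; last by apply: cvgM; [exact: cvg_cst|exact: prefix_cvg].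
apply: cvgD; last by apply: cvgM; [exact: cvg_cst|exact: b_cvg].
by apply: cvgD; [apply: cvgD; [exact: uv|exact: b_cvg]|exact: b_cvg].
Qed.

Lemma limit_mean_cvg : limit_mean (u N) @[N --> \oo] --> limit_mean v.
Proof.
apply: cvgn_sum_nat => i _; have B := @beta_cvg i.
apply: cvgD; last by apply: cvgM; [apply: cvgM => //; exact: cvg_cst|exact: prefix_cvg].
by apply: cvgM; [exact: cvg_cst|rewrite expr2; apply: cvgM].
Qed.

Lemma v_cvg : v_ (u N) @[N --> \oo] --> v_ v.
Proof.
apply: cvgM; first exact: cvg_cst.
apply: cvgn_sum_nat => i _.
have Bi := @b_cvg i; have Bj := @b_cvg i.+1; have A := @uv i.
have n : ent (u N) i + b_ (u N) i.+1 @[N --> \oo] --> ent v i + b_ v i.+1 by exact: cvgD.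
by apply: cvgM => //; apply: cvgM => //; apply: cvgB.
Qed.

End Scaling.

(** * The limit variance *)

Section Positivity.
Variables (R : realType) (m : nat) (av : 'rV[R]_m).

Lemma quad_scale (c : R) y : quad av (fun k => c * y k) = c ^+ 2 * quad av y.
Proof.
rewrite /quad !mulr_sumr; apply: eq_bigr => k _; rewrite !mulr_sumr.
by apply: eq_bigr => l _; ring.
Qed.

Lemma quad_f : quad av (f_ av) = (f_row av *m Sigma_mx av *m (f_row av)^T) 0 0.
Proof.
rewrite /quad big_add1 big_mkord !mxE.
under [RHS]eq_bigr do rewrite !mxE mulr_suml.
rewrite [RHS]exchange_big /=; apply: eq_bigr => k _; rewrite big_add1 big_mkord.
by apply: eq_bigr => l _; rewrite !mxE; ring.
Qed.

Lemma limit_varianceE theta : theta ^+ 2 / 2 * v_ av + quad av (fun k => theta / 2 * f_ av k) / 2 =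
  theta ^+ 2 / 2 * limit_variance av.
Proof. by rewrite quad_scale /limit_variance -quad_f; field. Qed.

Hypothesis a0 : forall i, 0 <= ent av i.
Hypothesis av_neq0 : av != 0.

(** With [beta i] the inner sum, the factors [a i + b i.+1 - b i], [b i] and
    [a i + b i.+1] of the summand are [beta i], [i * beta i] and
    [i.+1 * beta i]. *)
Lemma v_cubeE : v_ av = 12^-1 * \sum_(1 <= i < m.+1) i%:R * i.+1%:R *
  (\sum_(i <= l < m.+1) ent av l / l.+1%:R) ^+ 3.
Proof.
rewrite /v_; congr (_ * _); apply: eq_big_nat => i /andP[i0 im].
rewrite (@b_succ _ _ av i) ?i0// /b_ -natr1; field.
by rewrite pnatr_eq0 -lt0n.
Qed.

(** The first term is a variance and the second, by [v_cubeE], is positive as soon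
    as one [a i] is. *)
Lemma limit_variance_gt0 : 0 < limit_variance av.
Proof.
have /rV0Pn[k ak] := av_neq0.
have sg := sigma2_gt0 a0 av_neq0.
rewrite /limit_variance -quad_f ltr_wpDl//.
  by rewrite mulr_ge0 ?invr_ge0//; exact: quad_ge0.
have b0 i : 0 <= \sum_(i <= l < m.+1) ent av l / l.+1%:R.
  by apply: sumr_ge0 => l _; rewrite divr_ge0.
rewrite v_cubeE mulr_gt0 ?invr_gt0//.
apply: (lt_le_trans (y := k.+1%:R * k.+2%:R * (\sum_(k.+1 <= l < m.+1) ent av l / l.+1%:R) ^+ 3)).
  apply: mulr_gt0; first by rewrite mulr_gt0// ltr0n.
  apply: exprn_gt0; rewrite big_ltn; last by rewrite ltnS; exact: ltn_ord.
  rewrite ltr_pwDl//.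
  by rewrite divr_gt0// lt0r a0 ent_ord ak.
apply: (le_sum_term (F := fun i => i%:R * i.+1%:R * (\sum_(i <= l < m.+1) ent av l / l.+1%:R) ^+ 3)) .
  by move=> i; rewrite mulr_ge0 ?exprn_ge0// mulr_ge0.
exact: ltn_ord.
Qed.

End Positivity.

(** * Moment generating function of the central string function *)

Section CentralString.
Variables (R : realType) (m : nat) (L : nat -> 'rV[nat]_m) (av : 'rV[R]_m).
Hypothesis La : (N%:R^-1 : R) *: map_mx (fun n : nat => n%:R : R) (L N)
  @[N --> \oo] --> av.
Hypothesis av_neq0 : av != 0.
Local Notation copies := (copies L).
Local Notation midsum := (midsum L).
Local Notation slicesum := (slicesum L).
Local Notation realL := (realL R L).
Local Notation dev := (dev R L).
Local Notation s N := ((rt R N)^-1).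

Definition exponent (N : nat) (J : nat -> nat) (t : R) : R :=
  t * (\sum_(1 <= i < m.+1) J i * (J i + \sum_(1 <= l < i) copies N l))%N%:R +
  \sum_(1 <= l < m.+1) qbinom_exponent (copies N l + J l.+1) (J l) t.

Lemma exponent0 N J : exponent N J 0 = 0.
Proof. by rewrite /exponent mul0r big1 ?addr0// => l _; exact: qbinom_exponent0. Qed.

(** A Gaussian binomial and the corresponding factor of the weight vanish
    together, so this holds for all terms of the supernomial. *)
Lemma horner_central N t : (central_string R (L N)).[expR t] =
  slicesum N (fun J => expR (exponent N J t)).
Proof.
rewrite /central_string /supernomial /slicesum horner_sum.
apply: eq_bigr => j _ /=; rewrite -/(row_nat j); set J := ent (row_nat j).
rewrite hornerM hornerXn horner_prod /exponent expRD expRM_natr mulrCA; congr (_ * _).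
rewrite /weight natr_prod expR_sum -big_split /=.
by apply: eq_bigr => l _; rewrite horner_qbinom_gen.
Qed.

Lemma horner_central1 N : (central_string R (L N)).[1] = slicesum N (fun=> 1).
Proof.
rewrite -[X in _.[X] = _](@expR0 R) horner_central; apply: eq_bigr => j _.
by rewrite exponent0 expR0.
Qed.

(** The tuples that contribute to the sum over the slice. *)
Definition admissible (N : nat) (J : nat -> nat) : Prop :=
  [/\ J m.+1 = 0%N,
      \sum_(1 <= k < m.+1) (J k)%:R = (midsum N)%:R :> R &
      forall l, (0 < l <= m)%N -> (J l <= copies N l + J l.+1)%N].

Lemma slicesum_norm_le N phi psi :
  (forall J, admissible N J -> `|phi J| <= psi J :> R) ->
  `|slicesum N phi| <= slicesum N psi.
Proof.
move=> pp; apply: le_trans (ler_norm_sum _ _ _) _; apply: ler_sum => j js.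
rewrite normrM normr_nat; set J := ent (row_nat j).
have [->|w0] := eqVneq (weight m (copies N) J) 0%N; first by rewrite !mul0r.
apply: ler_wpM2l => //; apply: pp; split.
- by rewrite /J ent_out.
- exact: slice_total.
move=> l lm; rewrite leqNgt; apply/negP => /bin_small C0.
case/negP: w0; rewrite /weight (bigD1_seq l) ?mem_index_iota ?iota_uniq//=.
by rewrite C0 mul0n.
Qed.

Definition mass (N : nat) : R := \sum_(1 <= i < m.+1) (i * copies N i)%N%:R.

Lemma mass_ge0 N : 0 <= mass N. Proof. exact: sumr_ge0. Qed.

Lemma copies_le_mass N i : (0 < i <= m)%N -> (copies N i)%:R <= mass N.
Proof.
move=> im; apply: (@le_trans _ _ (i * copies N i)%N%:R).
  by rewrite ler_nat leq_pmull//; case/andP: im.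
by apply: (le_sum_term (F := fun i => (i * copies N i)%N%:R)).
Qed.

Lemma midsum_le_mass N : (midsum N)%:R <= mass N.
Proof.
rewrite /mass -natr_sum ler_nat /midsum /central_index.
set n := (\sum_(1 <= i < m.+1) i * _)%N; rewrite -[leqRHS]/n.
by rewrite -[leqRHS]odd_double_half -addnn addnA leq_addl.
Qed.

Lemma b_realL_ge0 N i : 0 <= b_ (realL N) i.
Proof.
rewrite /b_ mulr_ge0// sumr_ge0// => l _.
by rewrite ent_realL divr_ge0.
Qed.

Lemma b_le_mass N i : (0 < i <= m)%N -> b_ (realL N) i <= mass N.
Proof.
move=> im; apply: (@le_trans _ _ (\sum_(1 <= k < m.+1) b_ (realL N) k)).
  by apply: le_sum_term => // k; exact: b_realL_ge0.
rewrite sum_b -/(mass N); have := mass_ge0 N; lra.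
Qed.

Section AdmissibleBounds.
Variables (N : nat) (J : nat -> nat).
Hypothesis JN : admissible N J.

Lemma admissible_le i : (0 < i <= m.+1)%N -> (J i)%:R <= mass N.
Proof.
have [Jm Js _] := JN; move=> /andP[i0]; rewrite leq_eqVlt => /predU1P[->|im].
  by rewrite Jm mass_ge0.
apply: le_trans (midsum_le_mass N); rewrite -Js.
by apply: (le_sum_term (F := fun i => (J i)%:R)) => //; rewrite i0.
Qed.

Lemma sum_dev_le : \sum_(1 <= k < m.+1) `|dev N J k| <= 2 * mass N.
Proof.
have [Jm Js _] := JN.
apply: (@le_trans _ _ (\sum_(1 <= k < m.+1) ((J k)%:R + b_ (realL N) k))).
  apply: ler_sum => k _; apply: le_trans (ler_normB _ _) _.
  by rewrite normr_nat ger0_norm// b_realL_ge0.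
rewrite big_split /= Js sum_b -/(mass N).
have := mass_ge0 N; have := midsum_le_mass N; lra.
Qed.

Lemma dev_out : dev N J m.+1 = 0.
Proof. by have [Jm _ _] := JN; rewrite /dev Jm b_out ?subrr. Qed.

Lemma exponent_approx (M C t : R) : 0 <= C -> qbinom_error_constant C ->
  2 * mass N <= M -> C * (M * `|t|) ^+ 3 <= 1 -> M * `|t| <= 1 ->
  `|exponent N J t - (t * energy (realL N) (fun k => (J k)%:R) +
     t ^+ 2 / 2 * spread (realL N) (fun k => (J k)%:R))| <=
  m%:R * (3 * M * (C * (M * `|t|) ^+ 3) + t ^+ 2 * M ^+ 2).
Proof.
move=> C0 HC mM CM Mt; have [Jm Js Jle] := JN.
pose n l := (copies N l + J l.+1)%N.
have -> : exponent N J t - (t * energy (realL N) (fun k => (J k)%:R) +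
     t ^+ 2 / 2 * spread (realL N) (fun k => (J k)%:R)) =
  \sum_(1 <= l < m.+1) ((qbinom_exponent (n l) (J l) t -
     (t * ((J l)%:R * ((n l)%:R - (J l)%:R) / 2) +
       t ^+ 2 * ((J l)%:R * ((n l)%:R - (J l)%:R) * ((n l)%:R + 1) / 24))) +
     t ^+ 2 * ((J l)%:R * ((n l)%:R - (J l)%:R) / 24)).
  rewrite /exponent /energy /spread natr_sum !mulr_sumr -!big_split /= -sumrB.
  apply: eq_bigr => l _; rewrite natrM natrD natr_sum ent_realL /n natrD.
  have -> : \sum_(1 <= i < l) ent (realL N) i = \sum_(1 <= i < l) (copies N i)%:R :> R.
    by apply: eq_bigr => i _; rewrite ent_realL.
  set A := \sum_(1 <= i < l) _; set q := qbinom_exponent _ _ _.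
  by field.
apply: le_trans (ler_norm_sum _ _ _) _.
set E := 3 * M * _ + _.
have -> : m%:R * E = \sum_(1 <= l < m.+1) E by rewrite sumr_const_nat subn1 mulr_natl.
apply: ler_sum_nat => l /andP[l0 lm].
have Jn := Jle l; rewrite l0 -ltnS lm in Jn; have {}Jn := Jn isT.
have nM : (n l)%:R <= M.
  apply: le_trans mM; rewrite natrD mulr2n mulrDl mul1r lerD//.
    by apply: copies_le_mass; rewrite l0.
  by apply: admissible_le.
apply: le_trans (ler_normD _ _) _; apply: lerD; first exact: HC.
have kn : (J l)%:R <= (n l)%:R :> R by rewrite ler_nat.
have k0 : 0 <= (J l)%:R :> R by [].
rewrite normrM ger0_norm ?sqr_ge0// ler_wpM2l ?sqr_ge0// ger0_norm; last first.
  by rewrite divr_ge0// mulr_ge0// subr_ge0.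
rewrite ler_pdivrMr//; move: nM kn k0; set x := (J l)%:R; set y := (n l)%:R; nra.
Qed.

End AdmissibleBounds.

Let u (N : nat) : 'rV[R]_m := N%:R^-1 *: realL N.

Let u_cvg i : ent (u N) i @[N --> \oo] --> ent av i.
Proof.
apply: (@cvgn_eq _ _ (fun N => (copies N i)%:R / N%:R)); last exact: (copies_cvg La).
by move=> N; rewrite entZ ent_realL mulrC.
Qed.

Definition dev_size (N : nat) (J : nat -> nat) : R :=
  s N * \sum_(1 <= k < m.+1) `|dev N J k|.

Lemma dev_size_ge0 N J : 0 <= dev_size N J.
Proof. by rewrite mulr_ge0 ?invr_ge0 ?sqrtr_ge0 ?sumr_ge0. Qed.

Lemma mass_bound : exists2 c : R, 0 < c & \forall N \near \oo, 2 * mass N <= c * N%:R.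
Proof.
pose sg : R := \sum_(1 <= i < m.+1) i%:R * ent av i.
have mc : mass N / N%:R @[N --> \oo] --> sg.
  apply: (@cvgn_eq _ _ (fun N => \sum_(1 <= i < m.+1) i%:R * ((copies N i)%:R / N%:R))).
    by move=> N; rewrite mulr_suml; apply: eq_bigr => i _; rewrite natrM mulrA.
  by apply: cvgn_sum_nat => i _; apply: cvgM; [exact: cvg_cst|exact: (copies_cvg La)].
have sg0 : 0 <= sg.
  by apply: sumr_ge0 => i _; rewrite mulr_ge0// (a_ge0 La).
exists (2 * (sg + 1)); first lra.
have h : sg < sg + 1 by lra.
have H := cvgn_near_le mc h; near=> N.
have N0 : (0 < N)%N by near: N; exact: nbhs_infty_gt.
rewrite -mulrA ler_pM2l// -ler_pdivrMr ?ltr0n//.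
by near: N; exact: H.
Unshelve. all: by end_near. Qed.

Definition fdiff (N : nat) : R := \sum_(1 <= k < m.+1) `|f_ (u N) k - f_ av k|.

Lemma fdiff_cvg : fdiff N @[N --> \oo] --> 0.
Proof.
rewrite -[X in _ --> X](_ : \sum_(1 <= k < m.+1) `|f_ av k - f_ av k| = 0); last first.
  by rewrite big1// => k _; rewrite subrr normr0.
apply: cvgn_sum_nat => k _; apply: cvg_norm; apply: cvgB; last exact: cvg_cst.
exact: f_cvg.
Qed.

Lemma lin_diff_le (x y D : nat -> R) : `|lin m x D - lin m y D| <=
  (\sum_(1 <= k < m.+1) `|x k - y k|) * \sum_(1 <= k < m.+1) `|D k|.
Proof.
rewrite /lin -sumrB mulr_suml; apply: le_trans (ler_norm_sum _ _ _) _.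
apply: ler_sum_nat => k km; rewrite -mulrBl normrM ler_wpM2l//.
by apply: (le_sum_term (F := fun k => `|D k|)).
Qed.

(** What is left of the exponent at [t = theta / N ^ (3/2)] after the constant and
    the linear term in the deviation from the centre. *)
Definition remainder (theta : R) (N : nat) (J : nat -> nat) : R :=
  exponent N J (theta * s N ^+ 3) -
  (theta * s N ^+ 3 * limit_mean (realL N) + theta ^+ 2 / 2 * v_ av +
   s N * lin m (fun k => theta / 2 * f_ av k) (dev N J)).

(** The quadratic term of the energy has order [dev_size ^ 2 / sqrt N] and all
    other errors have a coefficient that tends to 0.  As [dev_size] is
    [O (sqrt N)], the remainder is also at most linear in it, with a bounded
    coefficient; this keeps its exponential under control. *)
Lemma remainder_le theta : exists eps : nat -> R, exists2 K : R, 0 <= K &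
  eps @ \oo --> 0 /\ \forall N \near \oo, forall J, admissible N J ->
    `|remainder theta N J| <= eps N * (1 + dev_size N J) + `|theta| * s N * dev_size N J ^+ 2
    /\ s N * dev_size N J <= K.
Proof.
have [c c0 mc] := mass_bound.
have [C C0 HC] := @qbinom_exponent_error R.
pose th := `|theta|; have th0 : 0 <= th by exact: normr_ge0.
(* In order: the error of the Gaussian binomials, the Lipschitz bound for the
   spread, and the passage to the limit in [v_] and in [f_]. *)
pose eps N := m%:R * (3 * c * C * (c * th) ^+ 3 * s N + (c * th) ^+ 2 * s N ^+ 2) +
  (th ^+ 2 / 2 * c ^+ 2 * s N + (th ^+ 2 / 2 * `|v_ (u N) - v_ av| + th / 2 * fdiff N)).
have s0 : s N @[N --> \oo] --> 0 by exact: cvgn_invsqrt.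
have v0 : `|v_ (u N) - v_ av| @[N --> \oo] --> 0.
  rewrite -(normr0 R) -(subrr (v_ av)); apply: cvg_norm; apply: cvgB; last exact: cvg_cst.
  exact: v_cvg.
exists eps, c; first exact: ltW.
split.
  apply: cvgn0D.
    apply: cvgn0Ml; apply: cvgn0D; apply: cvgn0Ml => //.
    by apply: (cvgn_eq (fun N => expr2 (s N))); exact: (cvgn0M s0 s0).
  apply: cvgn0D; first exact: cvgn0Ml.
  by apply: cvgn0D; apply: cvgn0Ml => //; exact: fdiff_cvg.
have c1 : C * (c * th * s N) ^+ 3 @[N --> \oo] --> 0.
  apply: cvgn0Ml; apply: (cvgn_eq (fun N => exprS (c * th * s N) 2)).
  have H := cvgn0Ml (c * th) s0.
  by apply: cvgn0M (H) _; apply: (cvgn_eq (fun N => expr2 _)); apply: cvgM; exact: H.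
have near1 := cvgn_near_le c1 ltr01.
have near2 := cvgn_near_le (cvgn0Ml (c * th) s0) ltr01.
near=> N => J JN.
have N0 : (0 < N)%N by near: N; exact: nbhs_infty_gt.
have mcN : 2 * mass N <= c * N%:R by near: N; exact: mc.
have n1 : C * (c * th * s N) ^+ 3 <= 1 by near: N; exact: near1.
have n2 : c * th * s N <= 1 by near: N; exact: near2.
have sp : 0 < s N by rewrite invr_gt0 rt_gt0.
have s2 : s N ^+ 2 * N%:R = 1 by rewrite -(rt_sqr R N) -exprMn mulVf ?expr1n// gt_eqF// rt_gt0.
have s2V : N%:R^-1 = s N ^+ 2.
  by apply: (mulfI (x := N%:R)); rewrite ?pnatr_eq0 -?lt0n// divff ?pnatr_eq0 -?lt0n// mulrC s2.
set S := \sum_(1 <= k < m.+1) `|dev N J k|.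
have rS : dev_size N J = s N * S by [].
have S0 : 0 <= S by exact: sumr_ge0.
have SM : S <= c * N%:R by apply: le_trans mcN; exact: sum_dev_le.
have Mt : c * N%:R * `|theta * s N ^+ 3| = c * th * s N.
  rewrite normrM normrX (gtr0_norm sp) -/th.
  transitivity (c * th * s N * (s N ^+ 2 * N%:R)); last by rewrite s2 mulr1.
  by ring.
have sr : s N * dev_size N J <= c.
  rewrite rS mulrA -expr2; apply: le_trans (ler_wpM2l (sqr_ge0 _) SM) _.
  by rewrite mulrCA s2 mulr1.
split=> //.
have e1 : `|exponent N J (theta * s N ^+ 3) -
    (theta * s N ^+ 3 * energy (realL N) (fun k => (J k)%:R) +
     (theta * s N ^+ 3) ^+ 2 / 2 * spread (realL N) (fun k => (J k)%:R))| <=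
   m%:R * (3 * c * C * (c * th) ^+ 3 * s N + (c * th) ^+ 2 * s N ^+ 2).
  apply: le_trans (exponent_approx JN C0 HC mcN _ _) _; rewrite ?Mt//.
  apply: ler_wpM2l => //; apply: lerD.
    apply: le_of_eq.
    transitivity (3 * c * C * (c * th) ^+ 3 * s N * (s N ^+ 2 * N%:R)); first by ring.
    by rewrite s2 mulr1.
  have -> : (theta * s N ^+ 3) ^+ 2 = `|theta * s N ^+ 3| ^+ 2 by rewrite real_normK ?num_real.
  by rewrite -exprMn mulrC Mt exprMn.
have e2 : (theta * s N ^+ 3) * energy (realL N) (fun k => (J k)%:R) =
   theta * s N ^+ 3 * limit_mean (realL N) +
   s N * (theta / 2 * lin m (f_ (u N)) (dev N J)) +
   theta * s N ^+ 3 * energy_quad m (dev N J).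
  have [Jm _ _] := JN.
  rewrite energy_expand ?Jm// -/(dev N J).
  have -> : lin m (f_ (u N)) (dev N J) = s N ^+ 2 * lin m (f_ (realL N)) (dev N J).
    rewrite /lin mulr_sumr; apply: eq_bigr => k _.
    by rewrite /u f_Z s2V mulrA.
  by move: (rt R N)^-1 => w; field.
have e3 : `|s N * (theta / 2 * lin m (f_ (u N)) (dev N J)) -
    s N * lin m (fun k => theta / 2 * f_ av k) (dev N J)| <= th / 2 * fdiff N * dev_size N J.
  have -> : lin m (fun k => theta / 2 * f_ av k) (dev N J) = theta / 2 * lin m (f_ av) (dev N J).
    by rewrite /lin mulr_sumr; apply: eq_bigr => k _; rewrite mulrA.
  rewrite -!mulrBr !normrM (gtr0_norm sp) -/th [`|2^-1|]ger0_norm ?invr_ge0// rS.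
  rewrite mulrCA -mulrA ler_wpM2l ?divr_ge0//.
  by rewrite mulrCA ler_wpM2l ?(ltW sp)//; exact: lin_diff_le.
have e4 : `|theta * s N ^+ 3 * energy_quad m (dev N J)| <= th * s N * dev_size N J ^+ 2.
  rewrite normrM normrM -/th ger0_norm ?exprn_ge0 ?(ltW sp)// rS exprMn.
  have := energy_quad_le (dev_out JN); rewrite -/S => H.
  rewrite -mulrA [leRHS](_ : _ = th * (s N ^+ 3 * S ^+ 2)); last by ring.
  by rewrite !ler_wpM2l// exprn_ge0// ltW.
have e5 : `|(theta * s N ^+ 3) ^+ 2 / 2 * spread (realL N) (fun k => (J k)%:R) -
    theta ^+ 2 / 2 * v_ av| <= th ^+ 2 / 2 * c ^+ 2 * s N * dev_size N J +
    th ^+ 2 / 2 * `|v_ (u N) - v_ av|.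
  have -> : v_ (u N) = (s N ^+ 2) ^+ 3 * v_ (realL N) by rewrite /u v_Z s2V.
  have -> : (theta * s N ^+ 3) ^+ 2 / 2 * spread (realL N) (fun k => (J k)%:R) -
      theta ^+ 2 / 2 * v_ av =
    theta ^+ 2 / 2 * ((s N ^+ 2) ^+ 3 * (spread (realL N) (fun k => (J k)%:R) -
       spread (realL N) (b_ (realL N)))) +
    theta ^+ 2 / 2 * ((s N ^+ 2) ^+ 3 * v_ (realL N) - v_ av).
    by rewrite -[v_ (realL N)]/(spread (realL N) (b_ (realL N))); ring.
  have thE : `|theta ^+ 2 / 2| = th ^+ 2 / 2.
    by rewrite normrM normrX -/th [`|2^-1|]ger0_norm ?invr_ge0.
  apply: le_trans (ler_normD _ _) _; apply: lerD; last by rewrite normrM thE.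
    rewrite normrM thE [leRHS](_ : _ = th ^+ 2 / 2 * (c ^+ 2 * s N * dev_size N J)); last by ring.
    rewrite ler_wpM2l ?divr_ge0 ?sqr_ge0// normrM ger0_norm; last by rewrite exprn_ge0// sqr_ge0.
    have H : `|spread (realL N) (fun k => (J k)%:R) - spread (realL N) (b_ (realL N))| <=
       (c * N%:R) ^+ 2 * S.
      have M1 : mass N <= c * N%:R by have := mass_ge0 N; lra.
      have [Jm _ _] := JN.
      apply: spread_lipschitz => [i im|i im|i im|i im||].
      - rewrite ent_realL addr_ge0//=; apply: le_trans mcN.
        rewrite mulr2n mulrDl mul1r lerD ?copies_le_mass//.
        by apply: admissible_le JN _ _; case/andP: im.
      - rewrite ent_realL addr_ge0 ?b_realL_ge0//=; apply: le_trans mcN.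
        rewrite mulr2n mulrDl mul1r lerD ?copies_le_mass//.
        have [i1m|] := ltnP i m; first by apply: b_le_mass.
        by move=> mi; rewrite b_out ?mass_ge0// ltnS.
      - rewrite ler0n/=; apply: le_trans M1; apply: admissible_le JN _ _.
        by case/andP: im => -> /= /leqW.
      - by rewrite b_realL_ge0/=; apply: le_trans M1; exact: b_le_mass.
      - by rewrite Jm.
      - by rewrite b_out.
    apply: le_trans (ler_wpM2l _ H) _; first by rewrite exprn_ge0// sqr_ge0.
    rewrite rS; apply: le_of_eq.
    transitivity (c ^+ 2 * s N ^+ 2 * S * (s N ^+ 2 * N%:R) ^+ 2).
      by move: (rt R N)^-1 => w; ring.
    by rewrite s2 expr1n mulr1; move: (rt R N)^-1 => w; ring.
rewrite /remainder.
set E := exponent _ _ _ in e1 *; set G := theta * s N ^+ 3 * energy _ _ in e1 e2.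
set V := _ / 2 * spread _ _ in e1 e5; set Y := s N * (theta / 2 * _) in e2 e3.
set Q := theta * s N ^+ 3 * energy_quad _ _ in e2 e4.
set Z := s N * lin _ _ _ in e3 *; set mu := theta * s N ^+ 3 * limit_mean _ in e2 *.
have -> : E - (mu + theta ^+ 2 / 2 * v_ av + Z) =
   (E - (G + V)) + (Y - Z) + Q + (V - theta ^+ 2 / 2 * v_ av) by rewrite e2; ring.
have r0 := dev_size_ge0 N J.
have p0 : 0 <= m%:R * (3 * c * C * (c * th) ^+ 3 * s N + (c * th) ^+ 2 * s N ^+ 2).
  exact: le_trans e1.
have p1 : 0 <= th ^+ 2 / 2 * `|v_ (u N) - v_ av| by rewrite mulr_ge0// divr_ge0// sqr_ge0.
have p2 : 0 <= th / 2 * fdiff N by rewrite mulr_ge0 ?divr_ge0//; exact: sumr_ge0.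
have p3 : 0 <= th ^+ 2 / 2 * c ^+ 2 * s N.
  by rewrite mulr_ge0 ?(ltW sp)// mulr_ge0 ?sqr_ge0// divr_ge0// sqr_ge0.
rewrite /eps -/th.
move: e1 e3 e4 e5 p0 p1 p2 p3 r0.
set E1 := m%:R * _; set A1 := th ^+ 2 / 2 * `|_|; set A2 := th / 2 * fdiff N.
set A3 := th ^+ 2 / 2 * c ^+ 2 * s N; set r := dev_size N J; set W := th * s N * r ^+ 2.
move=> e1 e3 e4 e5 p0 p1 p2 p3 r0.
apply: (@le_trans _ _ (E1 + A2 * r + W + (A3 * r + A1))).
  apply: le_trans (ler_normD _ _) _; apply: lerD => //.
  apply: le_trans (ler_normD _ _) _; apply: lerD => //.
  by apply: le_trans (ler_normD _ _) _; apply: lerD.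
by have := mulr_ge0 p0 r0; have := mulr_ge0 p1 r0; nra.
Unshelve. all: by end_near. Qed.

(** Exponential moments of the size of the deviation stay bounded.  Each absolute
    value is absorbed by two tilts of opposite signs, so the claim reduces to
    [slice_mgf_cvg] by induction on the number of absolute values. *)
Lemma slice_exp_bounded K n y : (n <= m)%N -> exists2 C : R, 0 <= C &
  \forall N \near \oo, slicesum N (fun J => expR (s N * lin m y (dev N J) +
    K * (s N * \sum_(1 <= k < n.+1) `|dev N J k|))) <= C * slicesum N (fun=> 1).
Proof.
elim: n y => [|n IH] y nm.
  have H := slice_mgf_cvg La av_neq0 (y := y).
  exists (expR (quad av y / 2) + 1); first by rewrite addr_ge0// expR_ge0.
  have h : expR (quad av y / 2) < expR (quad av y / 2) + 1 by lra.
  have H1 := cvgn_near_le H h; have H2 := slicesum1_gt0 La av_neq0; near=> N.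
  rewrite -ler_pdivrMr; last by near: N; exact: H2.
  have -> : slicesum N (fun J => expR (s N * lin m y (dev N J) +
      K * (s N * \sum_(1 <= k < 1) `|dev N J k|))) =
    slicesum N (fun J => expR (s N * lin m y (dev N J))).
    by apply: eq_bigr => j _; rewrite big_geq// !mulr0 addr0.
  by near: N; exact: H1.
pose d (k : nat) : R := (k == n.+1)%:R.
have linD c x : lin m (fun k => y k + c * d k) x = lin m y x + c * x n.+1.
  rewrite /lin (bigD1_seq n.+1) ?mem_index_iota ?iota_uniq//=.
  rewrite [in RHS](bigD1_seq n.+1) ?mem_index_iota ?iota_uniq//=.
  rewrite /d eqxx /= [X in _ + X = _](eq_bigr (fun k => y k * x k)).
    by ring.
  by move=> k /negPf->; rewrite mulr0 addr0.
have [C1 C10 H1] := IH (fun k => y k + K * d k) (ltnW nm).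
have [C2 C20 H2] := IH (fun k => y k + - K * d k) (ltnW nm).
exists (C1 + C2); first by rewrite addr_ge0.
near=> N; rewrite mulrDl.
apply: (@le_trans _ _ (slicesum N (fun J => expR (s N * lin m (fun k => y k + K * d k) (dev N J) +
    K * (s N * \sum_(1 <= k < n.+1) `|dev N J k|))) +
  slicesum N (fun J => expR (s N * lin m (fun k => y k + - K * d k) (dev N J) +
    K * (s N * \sum_(1 <= k < n.+1) `|dev N J k|))))); last first.
  by apply: lerD; near: N; [exact: H1|exact: H2].
rewrite /slicesum -big_split /=; apply: ler_sum => j _; rewrite -mulrDr ler_wpM2l//.
set J := ent _; rewrite !linD big_nat_recr//=.
set A := lin m y _; set B := \sum_(1 <= k < _) _; set x := dev N J n.+1.
have -> : s N * A + K * (s N * (B + `|x|)) = (s N * A + K * (s N * B)) + (K * s N) * `|x| by ring.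
have -> : s N * (A + K * x) + K * (s N * B) = (s N * A + K * (s N * B)) + (K * s N) * x by ring.
have -> : s N * (A + - K * x) + K * (s N * B) = (s N * A + K * (s N * B)) + - (K * s N) * x by ring.
by rewrite !(expRD (s N * A + _)) -mulrDr ler_wpM2l ?expR_ge0// expR_norm_le.
Unshelve. all: by end_near. Qed.

(** After the remainder is dropped, the moment generating function of the
    conditioned tuple is left.  The error made is at most a null sequence times
    an exponential moment of the size of the deviation. *)
Theorem central_string_mgf_cvg (theta : R) :
  (central_string R (L N)).[expR (theta * s N ^+ 3)] / (central_string R (L N)).[1] *
    expR (- (theta * s N ^+ 3 * limit_mean (realL N))) @[N --> \oo] -->
  expR (theta ^+ 2 / 2 * limit_variance av).
Proof.
pose y k := theta / 2 * f_ av k; pose E := expR (theta ^+ 2 / 2 * v_ av).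
have main := cvgM (cvg_cst E) (slice_mgf_cvg La av_neq0 (y := y)).
have {main} main : E * (slicesum N (fun J => expR (s N * lin m y (dev N J))) /
   slicesum N (fun=> 1)) @[N --> \oo] --> expR (theta ^+ 2 / 2 * limit_variance av).
  by rewrite -limit_varianceE expRD; exact: main.
have [eps [K K0 [eps0 rem]]] := remainder_le theta.
pose K1 := 1 + `|theta| * K; have K10 : 0 <= K1 by rewrite addr_ge0// mulr_ge0.
have [C C0 HC] := slice_exp_bounded (K1 + 2) y (leqnn m).
have near1 := slicesum1_gt0 La av_neq0.
pose del N := `|eps N| + `|theta| * s N.
have del0 : del @ \oo --> 0.
  apply: cvgn0D; first by rewrite -(normr0 R); exact: cvg_norm.
  by apply: cvgn0Ml; exact: cvgn_invsqrt.
have near2 := cvgn_near_le eps0 ltr01.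
have diff : ((central_string R (L N)).[expR (theta * s N ^+ 3)] / (central_string R (L N)).[1] *
    expR (- (theta * s N ^+ 3 * limit_mean (realL N))) -
   E * (slicesum N (fun J => expR (s N * lin m y (dev N J))) / slicesum N (fun=> 1)))
   @[N --> \oo] --> 0.
  apply: (@cvgn_dist0 _ _ (fun N => E * expR 1 * C * del N)); first exact: cvgn0Ml.
  near=> N; have S0 : 0 < slicesum N (fun=> 1) :> R by near: N; exact: near1.
  have rN : forall J, admissible N J -> `|remainder theta N J| <=
      eps N * (1 + dev_size N J) + `|theta| * s N * dev_size N J ^+ 2 /\
      s N * dev_size N J <= K by near: N; exact: rem.
  have bN : slicesum N (fun J => expR (s N * lin m y (dev N J) +
    (K1 + 2) * dev_size N J)) <= C * slicesum N (fun=> 1) by near: N; exact: HC.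
  have e1 : eps N <= 1 by near: N; exact: near2.
  rewrite subr0 horner_central horner_central1.
  set mu := theta * s N ^+ 3 * limit_mean _.
  have -> : slicesum N (fun J => expR (exponent N J (theta * s N ^+ 3))) / slicesum N (fun=> 1) *
      expR (- mu) - E * (slicesum N (fun J => expR (s N * lin m y (dev N J))) / slicesum N (fun=> 1)) =
    slicesum N (fun J => E * expR (s N * lin m y (dev N J)) * (expR (remainder theta N J) - 1)) /
    slicesum N (fun=> 1).
    rewrite mulrAC (mulrA E) -mulrBl; congr (_ / _).
    rewrite /slicesum mulr_suml mulr_sumr -sumrB; apply: eq_bigr => j _.
    set w := _%:R; rewrite mulrBr mulr1 -mulrA -expRD mulrBr; congr (_ - _); last by rewrite mulrCA.
    congr (_ * _); rewrite /E -!expRD; congr expR; rewrite /remainder -/mu /y; ring.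
  rewrite normrM [`|_^-1|]gtr0_norm ?invr_gt0// ler_pdivrMr//.
  apply: (@le_trans _ _ (slicesum N (fun J => E * expR 1 * del N * expR (s N * lin m y (dev N J) +
    (K1 + 2) * dev_size N J)))); last first.
    rewrite [leLHS](_ : _ = E * expR 1 * del N * slicesum N (fun J =>
      expR (s N * lin m y (dev N J) + (K1 + 2) * dev_size N J))); last first.
      by rewrite /slicesum mulr_sumr; apply: eq_bigr => j _; rewrite mulrCA.
    apply: le_trans (ler_wpM2l _ bN) _.
      by rewrite mulr_ge0 ?mulr_ge0 ?expR_ge0// /del addr_ge0// mulr_ge0// invr_ge0 sqrtr_ge0.
    by apply: le_of_eq; ring.
  apply: slicesum_norm_le => J JN; have [R1 R2] := rN J JN.
  have r0 := dev_size_ge0 N J; move: R1 R2 r0; rewrite /del.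
  set rm := remainder theta N J; set r := dev_size N J; set q := (rt R N)^-1.
  have q0 : 0 <= q by rewrite invr_ge0 sqrtr_ge0.
  move=> R1 R2 r0; have t0 := normr_ge0 theta.
  have bd1 : `|rm| <= (`|eps N| + `|theta| * q) * (1 + r) ^+ 2.
    apply: le_trans R1 _; have h1 := ler_norm (eps N).
    have h2 : eps N * (1 + r) <= `|eps N| * (1 + r) ^+ 2.
      apply: (@le_trans _ _ (`|eps N| * (1 + r))); first by rewrite ler_wpM2r// addr_ge0.
      by rewrite ler_wpM2l// expr2 ler_peMr ?addr_ge0// lerDl.
    rewrite mulrDl lerD// ler_wpM2l ?mulr_ge0//; nra.
  have bd2 : `|rm| <= 1 + K1 * r.
    apply: le_trans R1 _; rewrite /K1.
    have h1 : eps N * (1 + r) <= 1 + r by rewrite ler_piMl// addr_ge0.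
    have h2 : `|theta| * q * r ^+ 2 <= `|theta| * K * r.
      rewrite -!mulrA ler_wpM2l//; have := ler_wpM2r r0 R2; lra.
    lra.
  rewrite normrM ger0_norm ?mulr_ge0 ?expR_ge0//.
  have h3 : `|expR rm - 1| <= (`|eps N| + `|theta| * q) * expR 1 * expR ((K1 + 2) * r).
    apply: le_trans (expR_taylor1 _) _.
    apply: (@le_trans _ _ (((`|eps N| + `|theta| * q) * expR (2 * r)) * expR (1 + K1 * r))).
      apply: ler_pM; rewrite ?expR_ge0 ?ler_expR//.
      apply: le_trans bd1 _; apply: ler_wpM2l; first by rewrite addr_ge0// mulr_ge0.
      rewrite expRM_natl; apply: lerXn2r; rewrite ?nnegrE ?addr_ge0 ?expR_ge0//.
      exact: expR_ge1Dx.
    apply: le_of_eq.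
    by rewrite -!mulrA -!expRD; congr (_ * expR _); ring.
  apply: le_trans (ler_wpM2l _ h3) _; first by rewrite mulr_ge0 ?expR_ge0.
  by rewrite expRD; apply: le_of_eq; ring.
rewrite -[X in _ --> X]add0r; refine (cvg_trans (near_eq_cvg _) (cvgD diff main)).
by apply: nearW => N; exact: subrK.
Unshelve. all: by end_near. Qed.

End CentralString.

(** * Random variables with a polynomial generating function *)

Section PolynomialDecay.
Variable R : realType.

Lemma horner_le_norm (p : {poly R}) (q : R) : 0 <= q <= 1 ->
  `|p.[q]| <= \sum_(i < size p) `|p`_i|.
Proof.
move=> /andP[q0 q1]; rewrite horner_coef; apply: le_trans (ler_norm_sum _ _ _) _.
apply: ler_sum => i _; rewrite normrM ler_piMr// normrX ger0_norm//.
exact: exprn_ile1.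
Qed.

(** The constant coefficient is bounded by a multiple of [q], hence vanishes, and
    one power of [q] can be divided out. *)
Lemma poly_eq0_of_small n (C : R) (p : {poly R}) : (size p <= n)%N ->
  (forall q, 0 < q <= 1 -> `|p.[q]| <= C * q ^+ n) -> p = 0.
Proof.
elim: n p => [|n IH] p; first by rewrite leqn0 size_poly_eq0 => /eqP.
elim/poly_ind: p => [//|p c _] sp pC.
have sp' : (size p <= n)%N.
  by move: sp; rewrite size_MXaddC; case: eqP => [->|_]; rewrite ?size_poly0.
pose K := C + \sum_(i < size p) `|p`_i|.
have C0 : 0 <= C by have := pC 1; rewrite ltr01 lexx expr1n mulr1 => /(_ isT); exact: le_trans.
have cK q : 0 < q <= 1 -> `|c| <= K * q.
  move=> q01; have := pC q q01; have /andP[q0 q1] := q01; rewrite hornerMXaddC => H.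
  have -> : c = (p.[q] * q + c) - p.[q] * q by ring.
  apply: le_trans (ler_normB _ _) _; rewrite mulrDl; apply: lerD.
    apply: le_trans H _; rewrite exprS ler_wpM2l// ler_piMr ?(ltW q0)//.
    by apply: exprn_ile1; rewrite ?(ltW q0).
  rewrite normrM (gtr0_norm q0) ler_wpM2r ?(ltW q0)//.
  by apply: horner_le_norm; rewrite (ltW q0).
have c0 : c = 0.
  have H : K * n.+1%:R^-1 @[n --> \oo] --> 0.
    by apply: cvgn0Ml; exact: cvg_harmonic.
  apply/eqP; rewrite -normr_le0; apply: (cvgr_to_ge H).
  apply: nearW => k; apply: cK; rewrite invr_gt0 ltr0n/= invf_le1 ?ltr0n// ler1n//.
have -> : p = 0.
  apply: (IH p sp') => q q01; have := pC q q01; have /andP[q0 q1] := q01.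
  rewrite hornerMXaddC c0 addr0 normrM (gtr0_norm q0) exprSr mulrA.
  by rewrite ler_pM2r.
by rewrite c0 mul0r add0r.
Qed.

End PolynomialDecay.

Section NatRandomVariable.
Context d (T : measurableType d) (R : realType) (P : probability T R).
Variable X : {RV P >-> nat}.

Definition atom (k : nat) : R := fine (P (X @^-1` [set k])).

Lemma measurable_atom k : measurable (X @^-1` [set k]).
Proof. by rewrite -[X @^-1` _]setTI; exact: measurable_funP. Qed.

Lemma measurable_tail n : measurable [set w | (n <= X w)%N].
Proof.
have mX : measurable_fun setT (X : T -> nat) by exact: measurable_funP.
by have := mX measurableT [set k | (n <= k)%N] I; rewrite setTI.
Qed.

Lemma measurable_nat_comp (f : nat -> R) : measurable_fun setT (fun w => f (X w)).
Proof. by apply: measurableT_comp => //. Qed.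

Lemma truncateE n (f : nat -> R) w : \sum_(k < n) f k * \1_(X @^-1` [set (k : nat)]) w =
  if (X w < n)%N then f (X w) else 0.
Proof.
have one (k : nat) : \1_(X @^-1` [set k]) w = (X w == k)%:R :> R.
  by rewrite indicE; congr (nat_of_bool _)%:R; apply/idP/eqP; rewrite inE.
case: ifP => Xn.
  rewrite (bigD1 (Ordinal Xn))//= one eqxx mulr1 big1 ?addr0// => k kX.
  by rewrite one; case: eqP => [e|]; rewrite ?mulr0//; case/eqP: kX; exact: val_inj.
rewrite big1// => k _; rewrite one; case: eqP => [e|]; rewrite ?mulr0//.
by move: Xn; rewrite e ltn_ord.
Qed.

Lemma integrable_truncate n (f : nat -> R) :
  P.-integrable setT (fun w => (\sum_(k < n) f k * \1_(X @^-1` [set (k : nat)]) w)%:E).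
Proof.
under eq_fun do rewrite -sumEFin; apply: integrable_sum => // k _.
under eq_fun do rewrite EFinM; apply: integrableZl => //.
exact/integrable_indic/measurable_atom.
Qed.

Lemma integral_truncate n (f : nat -> R) :
  (\int[P]_w (\sum_(k < n) f k * \1_(X @^-1` [set (k : nat)]) w)%:E =
  (\sum_(k < n) f k * atom k)%:E)%E.
Proof.
under eq_integral do rewrite -sumEFin.
rewrite integral_sum//; last first.
  move=> k; under eq_fun do rewrite EFinM; apply: integrableZl => //.
  exact/integrable_indic/measurable_atom.
rewrite -sumEFin; apply: eq_bigr => k _.
under eq_integral do rewrite EFinM.
rewrite integralZl//; last exact/integrable_indic/measurable_atom.
rewrite integral_indic//; last exact: measurable_atom.
by rewrite setIT EFinM /atom fineK// fin_num_measure//; exact: measurable_atom.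
Qed.

Section PolynomialPgf.
Variable g : {poly R}.
Hypothesis pgf : has_pgf X (fun q => g.[q]).

(** The part of the expectation of [q ^ X] where [n <= X] is at most [q ^ n].  So
    the two generating functions, cut at degree [n], differ by [O (q ^ n)] on
    ]0, 1], and [poly_eq0_of_small] applies. *)
Lemma atom_coef k : atom k = g`_k.
Proof.
pose n := k.+1; pose p : {poly R} := \poly_(i < n) (atom i - g`_i).
suff p0 : p = 0.
  have := coef0 R k; rewrite -p0 coef_poly ltnSn => /eqP; rewrite subr_eq0 => /eqP.
  by [].
pose C := 1 + \sum_(i < size (drop_poly n g)) `|(drop_poly n g)`_i|.
apply: (@poly_eq0_of_small _ n C); first exact: size_poly.
move=> q q01; have /andP[q0 q1] := q01.
have q01' : 0 <= q <= 1 by rewrite (ltW q0).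
have gE : g.[q] = \sum_(i < n) q ^+ i * g`_i + (drop_poly n g).[q] * q ^+ n.
  rewrite -{1}(poly_take_drop n g) hornerD hornerM hornerXn; congr (_ + _).
  by rewrite /take_poly horner_poly; apply: eq_bigr => i _; rewrite mulrC.
have pE : p.[q] = \sum_(i < n) q ^+ i * atom i - \sum_(i < n) q ^+ i * g`_i.
  by rewrite /p horner_poly -sumrB; apply: eq_bigr => i _; ring.
have mq : measurable_fun setT (fun w => (q ^+ X w)%:E).
  by apply/measurable_EFinP; exact: measurable_nat_comp.
have mt : measurable_fun setT (fun w => (\sum_(k < n) q ^+ k * \1_(X @^-1` [set (k : nat)]) w)%:E).
  exact: measurable_int (integrable_truncate n (fun k => q ^+ k)).
have lo : \sum_(i < n) q ^+ i * atom i <= g.[q].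
  rewrite -lee_fin -(pgf q01') expectation.unlock -(integral_truncate n (fun k => q ^+ k)); apply: ge0_le_integral => //.
    by move=> w _; rewrite truncateE lee_fin; case: ifP => // _; rewrite exprn_ge0// ltW.
  by move=> w _; rewrite truncateE lee_fin; case: ifP => // _; rewrite exprn_ge0// ltW.
have up : g.[q] <= \sum_(i < n) q ^+ i * atom i + q ^+ n.
  rewrite -lee_fin -(pgf q01') expectation.unlock EFinD -(integral_truncate n (fun k => q ^+ k)).
  have -> : ((q ^+ n)%:E = \int[P]_w (cst (q ^+ n)%:E w))%E.
    by rewrite -[LHS](expectation_cst P) expectation.unlock.
  rewrite -ge0_integralD//.
  - apply: ge0_le_integral => //.
    + by move=> w _; rewrite lee_fin exprn_ge0// ltW.
    + by apply: emeasurable_funD.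
    move=> w _; rewrite truncateE /= -EFinD lee_fin; case: ifP => Xn.
      by rewrite lerDl exprn_ge0// ltW.
    rewrite add0r -(subnK (leq_trans (leqnn n) _) : (X w - n + n)%N = X w); last by rewrite leqNgt Xn.
    by rewrite exprD ler_piMl ?exprn_ge0 ?(ltW q0)// exprn_ile1// ltW.
  - by move=> w _; rewrite truncateE lee_fin; case: ifP => // _; rewrite exprn_ge0// ltW.
  - by move=> w _; rewrite lee_fin exprn_ge0// ltW.
have dr := horner_le_norm (drop_poly n g) q01'.
have qn : 0 <= q ^+ n by rewrite exprn_ge0// ltW.
rewrite pE /C mulrDl mul1r; set D := (drop_poly n g).[q] in gE dr.
have h : `|D * q ^+ n| <= (\sum_(i < size (drop_poly n g)) `|(drop_poly n g)`_i|) * q ^+ n.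
  by rewrite normrM (ger0_norm qn) ler_wpM2r.
move: lo up; rewrite gE; move: h; rewrite !ler_norml => /andP[h1 h2] lo up.
by apply/andP; split; lra.
Qed.

Lemma pgf1 : g.[1] = 1.
Proof.
have q1 : 0 <= (1 : R) <= 1 by rewrite ler01 lexx.
have := pgf q1; rewrite (_ : (fun w => 1 ^+ X w) = cst 1).
  by rewrite expectation_cst => -[].
by apply/funext => w; rewrite expr1n.
Qed.

Lemma sum_coef : \sum_(k < size g) g`_k = 1.
Proof.
by rewrite -pgf1 horner_coef; apply: eq_bigr => k _; rewrite expr1n mulr1.
Qed.

Lemma null_tail : P [set w | (size g <= X w)%N] = 0.
Proof.
have mA := measurable_tail (size g).
have := integral_truncate (size g) (fun=> 1).
rewrite (eq_bigr (fun k : 'I__ => g`_k)); last by move=> k _; rewrite mul1r atom_coef.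
rewrite sum_coef => H.
have : (P (~` [set w | (size g <= X w)%N]) = 1)%E.
  rewrite -H -[X in P X]setIT -integral_indic//; last exact: measurableC.
  apply: eq_integral => w _; rewrite (truncateE _ (fun=> 1)) indicE in_setC.
  have -> : (w \in [set w | (size g <= X w)%N]) = (size g <= X w)%N by apply/idP/idP; rewrite inE.
  by rewrite -ltnNge; case: ifP.
rewrite probability_setC//; have /fineK <- := fin_num_measure P _ mA.
by rewrite -EFinB => -[r1]; congr _%:E; move: r1; set r := fine _; lra.
Qed.

Lemma ae_truncate (f : nat -> R) : ae_eq P setT (fun w => (f (X w))%:E)
  (fun w => (\sum_(k < size g) f k * \1_(X @^-1` [set (k : nat)]) w)%:E).
Proof.
exists [set w | (size g <= X w)%N]; split.
- exact: measurable_tail.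
- exact: null_tail.
move=> w /=; apply: contra_notP => /negP; rewrite -ltnNge => Xn _.
by rewrite truncateE Xn.
Qed.

Lemma integral_nat_comp (f : nat -> R) :
  (\int[P]_w (f (X w))%:E = (\sum_(k < size g) f k * g`_k)%:E)%E.
Proof.
rewrite (ae_eq_integral _ _ _ _ _ (ae_truncate f))//.
- by rewrite integral_truncate; congr (_%:E); apply: eq_bigr => k _; rewrite atom_coef.
- by apply/measurable_EFinP; exact: measurable_nat_comp.
- exact: measurable_int (integrable_truncate _ f).
Qed.

Lemma integrable_nat_comp (f : nat -> R) : P.-integrable setT (fun w => (f (X w))%:E).
Proof.
apply/integrableP; split; first by apply/measurable_EFinP; exact: measurable_nat_comp.
rewrite (eq_integral (fun w => (`|f (X w)|)%:E))//.
by rewrite (integral_nat_comp (fun k => `|f k|)) ltry.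
Qed.

(** This is the expectation of [f X], because [X < size g] almost surely. *)
Definition fmean (f : nat -> R) : R := \sum_(k < size g) f k * g`_k.

Lemma fmeanD f h : fmean (fun k => f k + h k) = fmean f + fmean h.
Proof. by rewrite /fmean -big_split /=; apply: eq_bigr => k _; rewrite mulrDl. Qed.

Lemma fmeanZ c f : fmean (fun k => c * f k) = c * fmean f.
Proof. by rewrite /fmean mulr_sumr; apply: eq_bigr => k _; rewrite mulrA. Qed.

Lemma fmean_cst c : fmean (fun=> c) = c.
Proof. by rewrite /fmean -mulr_sumr sum_coef mulr1. Qed.

Lemma fmean_exp t : fmean (fun k => expR (t * k%:R)) = g.[expR t].
Proof. by rewrite horner_coef; apply: eq_bigr => k _; rewrite expRM_natr mulrC. Qed.

Lemma expectation_toR : ('E_P[toR X] = (fmean (fun k => k%:R))%:E)%E.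
Proof. by rewrite unlock; exact: (integral_nat_comp (fun k => k%:R)). Qed.

Lemma variance_toR : ('V_P[toR X] =
  (fmean (fun k => (k%:R - fmean (fun k => k%:R)) ^+ 2))%:E)%E.
Proof.
rewrite /variance unlock expectation_toR unlock.
by rewrite -(integral_nat_comp (fun k => (k%:R - fmean (fun k => k%:R)) ^+ 2)).
Qed.

Variables (mu c : R).
Hypothesis c_gt0 : 0 < c.

Definition rescaled (w : T) : R := ((X w)%:R - mu) / c.

Lemma Ex_rescaled (f : R -> R) : Ex P rescaled f = fmean (fun k => f ((k%:R - mu) / c)).
Proof. by rewrite /Ex /Rintegral (integral_nat_comp (fun k => f ((k%:R - mu) / c))). Qed.

Lemma expmom_rescaled : expmom P rescaled.
Proof.
split; first exact: (measurable_nat_comp (fun k => (k%:R - mu) / c)).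
by move=> t; exact: (integrable_nat_comp (fun k => expR (t * ((k%:R - mu) / c)))).
Qed.

Lemma mgf_rescaled t : Ex P rescaled (fun x => expR (t * x)) =
  g.[expR (t / c)] * expR (- (t / c * mu)).
Proof.
rewrite Ex_rescaled -fmean_exp mulrC -fmeanZ; congr fmean; apply/funext => k.
by rewrite -expRD; congr expR; ring.
Qed.

Lemma expectation_rescaled :
  ('E_P[toR X] = (mu + c * Ex P rescaled id)%:E)%E.
Proof.
rewrite expectation_toR Ex_rescaled -fmeanZ -[X in X + _]fmean_cst -fmeanD.
by congr (fmean _)%:E; apply/funext => k /=; field; rewrite gt_eqF.
Qed.

Lemma variance_rescaled : ('V_P[toR X] =
  (c ^+ 2 * (Ex P rescaled (fun x => x ^+ 2) - Ex P rescaled id ^+ 2))%:E)%E.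
Proof.
rewrite variance_toR; congr (_%:E).
have mE : fmean (fun k => k%:R) = mu + c * Ex P rescaled id.
  by have := expectation_rescaled; rewrite expectation_toR => -[].
rewrite mE; set e := Ex P rescaled id; rewrite Ex_rescaled.
have eE : e = fmean (fun k => (k%:R - mu) / c) by rewrite /e Ex_rescaled.
have -> : (fun k => (k%:R - (mu + c * e)) ^+ 2) =
   (fun k => c ^+ 2 * (((k%:R - mu) / c) ^+ 2 + (- (2 * e) * ((k%:R - mu) / c) + e ^+ 2))).
  by apply/funext => k; field; rewrite gt_eqF.
by rewrite fmeanZ fmeanD fmeanD fmeanZ fmean_cst -eE; ring.
Qed.

Lemma standardize_le x :
  0 < Ex P rescaled (fun x => x ^+ 2) - Ex P rescaled id ^+ 2 ->
  standardize P (toR X) @^-1` `]-oo, x]%classic =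
  rescaled @^-1` `]-oo, (x * Num.sqrt (Ex P rescaled (fun x => x ^+ 2) - Ex P rescaled id ^+ 2)
                + Ex P rescaled id)]%classic.
Proof.
set e := Ex P rescaled id; set v := _ - _ => v0.
apply/seteqP; split => w /=; rewrite !in_itv/= /standardize expectation_rescaled variance_rescaled
  -/e -/v /= sqrtrM ?sqr_ge0// sqrtr_sqr gtr0_norm// /toR /rescaled.
- rewrite ler_pdivrMr ?mulr_gt0 ?sqrtr_gt0// => H.
  by rewrite ler_pdivrMr//; lra.
- rewrite ler_pdivrMr// => H.
  by rewrite ler_pdivrMr ?mulr_gt0 ?sqrtr_gt0//; lra.
Qed.

End PolynomialPgf.

End NatRandomVariable.

(** * The standard normal law *)

Section StandardNormal.
Variable R : realType.
Local Notation gauss := (normal_prob (0 : R) 1).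
Local Notation mu := (@lebesgue_measure R).

(** The density of the normal law is its Radon-Nikodym derivative. *)
Lemma integral_normal_prob (f : R -> R) : measurable_fun setT f -> (forall x, 0 <= f x) ->
  (\int[gauss]_x (f x)%:E = \int[mu]_x (f x * normal_pdf 0 1 x)%:E)%E.
Proof.
move=> mf f0; have dom := @normal_prob_dominates R 0 1.
rewrite -(Radon_Nikodym_SigmaFinite.change_of_variables dom)//; last first.
  exact/measurable_EFinP.
have mpdf : measurable_fun setT (fun x : R => (normal_pdf 0 1 x)%:E).
  by apply/measurable_EFinP; exact: measurable_normal_pdf.
apply: ae_eq_integral => //.
- apply: emeasurable_funM; first exact/measurable_EFinP.
  by apply: (measurable_int mu); exact: Radon_Nikodym_SigmaFinite.f_integrable.
- by apply/measurable_EFinP/measurable_funM => //; exact: measurable_normal_pdf.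
under [X in ae_eq _ _ _ X]eq_fun do rewrite EFinM.
apply: ae_eqe_mul2l.
apply: integral_ae_eq => //.
- exact: Radon_Nikodym_SigmaFinite.f_integrable.
by move=> E _ mE; rewrite -Radon_Nikodym_SigmaFinite.f_integral.
Qed.

(** Completing the square turns the tilted density into that of the normal law
    of mean [t]. *)
Lemma integral_exp_normal t : (\int[gauss]_x (expR (t * x))%:E = (expR (t ^+ 2 / 2))%:E)%E.
Proof.
rewrite integral_normal_prob; last 2 first.
- exact: (tame_exp t).1.
- by move=> x; exact: expR_ge0.
under eq_integral => x _.
  have -> : expR (t * x) * normal_pdf 0 1 x = expR (t ^+ 2 / 2) * normal_pdf t 1 x.
    rewrite /normal_pdf !oner_eq0 /normal_fun mulrCA [RHS]mulrCA; congr (_ * _).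
    by rewrite -!expRD; congr expR; rewrite expr1n -mulr_natl mulr1; field.
  rewrite EFinM; over.
rewrite ge0_integralZl//.
- by rewrite integral_normal_pdf mule1.
- by apply/measurable_EFinP; exact: measurable_normal_pdf.
- by move=> x _; rewrite lee_fin normal_pdf_ge0.
Qed.

Lemma expmom_normal : expmom gauss (id : R -> R).
Proof.
split; first exact: measurable_id.
move=> t; apply/integrableP; split; first by apply/measurable_EFinP; exact: (tame_exp t).1.
under eq_integral do rewrite /= ger0_norm ?expR_ge0//.
by rewrite integral_exp_normal ltry.
Qed.

Lemma mgf_normal t : Ex gauss id (fun x => expR (t * x)) = expR (t ^+ 2 / 2).
Proof. by rewrite /Ex /Rintegral integral_exp_normal. Qed.

End StandardNormal.

Section GaussianMoments.
Context d (T : measurableType d) (R : realType) (P : probability T R) (Z : T -> R).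
Hypothesis eZ : expmom P Z.
Hypothesis mgf : forall t : R, Ex P Z (fun x => expR (t * x)) = expR (t ^+ 2 / 2).

(** Comparing the Taylor expansions of both sides of [mgf] at 0. *)
Lemma gaussian_moments : Ex P Z id = 0 /\ Ex P Z (fun x => x ^+ 2) = 1.
Proof.
set e := Ex P Z id; set v := Ex P Z _.
pose h (x : R) := x * x * (expR (2 * x) + expR (- 2 * x)).
have tX : tame (fun x : R => x * x) by apply: tameM; exact: tame_id.
have th : tame h by apply: tameM => //; apply: tameD; exact: tame_exp.
have h0 x : 0 <= h x by rewrite mulr_ge0 ?addr_ge0 ?expR_ge0// -expr2 sqr_ge0.
have key (q : R) : 0 < q <= 1 ->
    `|q * e + q ^+ 2 * ((v - 1) / 2)| <= (Ex P Z h + expR 1) * q ^+ 3.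
  move=> /andP[q0 q1].
  pose lhs x := expR (q * x) + (-1 + (- q * x + (- (q ^+ 2 / 2)) * (x * x))).
  have tl1 : tame (fun x : R => (- q) * x) by apply: tameM; [exact: tame_cst|exact: tame_id].
  have tl2 : tame (fun x : R => (- (q ^+ 2 / 2)) * (x * x)) by apply: tameM => //; exact: tame_cst.
  have tl : tame lhs.
    apply: tameD; first exact: tame_exp.
    by apply: tameD; [exact: tame_cst|exact: tameD].
  have El : Ex P Z lhs = expR (q ^+ 2 / 2) - 1 - q * e - q ^+ 2 / 2 * v.
    rewrite /lhs ExD//; last by apply: tameD; [exact: tame_cst|exact: tameD].
      rewrite ExD//; last exact: tameD.
        rewrite ExD// mgf Ex_cst// (ExZ eZ _ (@tame_id _)) (ExZ eZ _ tX).
        have -> : Ex P Z (fun x => x * x) = v by [].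
        by rewrite -/e; ring.
      exact: tame_cst.
    exact: tame_exp.
  have lh x : `|lhs x| <= q ^+ 3 * h x.
    have -> : lhs x = expR (q * x) - 1 - q * x - (q * x) ^+ 2 / 2 by rewrite /lhs; field.
    apply: le_trans (expR_taylor3 _) _.
    have qx : `|q * x| <= `|x| by rewrite normrM (gtr0_norm q0) ler_piMl.
    have xe : `|x| * expR `|x| <= expR (2 * `|x|).
      rewrite [2 * _]mulr_natl mulr2n expRD ler_wpM2r ?expR_ge0//.
      by apply: le_trans (expR_ge1Dx _); rewrite lerDr.
    apply: (@le_trans _ _ (q ^+ 3 * (`|x| ^+ 2 * (`|x| * expR `|x|)))).
      rewrite normrM exprMn (gtr0_norm q0) -mulrA ler_wpM2l ?exprn_ge0 ?(ltW q0)//.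
      rewrite mulrA -exprSr ler_wpM2l ?exprn_ge0// ler_expR.
      by rewrite -[q in q * _](gtr0_norm q0) -normrM.
    rewrite ler_wpM2l ?exprn_ge0 ?(ltW q0)// /h -expr2 real_normK ?num_real//.
    rewrite ler_wpM2l ?sqr_ge0//; apply: le_trans xe _; exact: expR_norm_le.
  have b1 : `|Ex P Z lhs| <= q ^+ 3 * Ex P Z h.
    have tq : tame (fun x => q ^+ 3 * h x) by apply: tameM => //; exact: tame_cst.
    rewrite ler_norml; apply/andP; split.
      rewrite -mulNr -ExZ//; apply: ler_Ex => //; first by apply: tameM => //; exact: tame_cst.
      by move=> x; rewrite mulNr; have := lh x; rewrite ler_norml => /andP[].
    rewrite -ExZ//; apply: ler_Ex => // x.
    by have := lh x; rewrite ler_norml => /andP[].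
  have b2 : `|expR (q ^+ 2 / 2) - 1 - q ^+ 2 / 2| <= q ^+ 3 * expR 1.
    have q2 : 0 <= q ^+ 2 / 2 by rewrite divr_ge0// sqr_ge0.
    apply: le_trans (expR_taylor2 _) _; rewrite (ger0_norm q2).
    apply: ler_pM; rewrite ?expR_ge0 ?exprn_ge0// ?ler_expR; last by nra.
    have q3 : 0 <= q ^+ 3 by rewrite exprn_ge0// ltW.
    rewrite (_ : (q ^+ 2 / 2) ^+ 2 = q ^+ 3 * (q / 4)); last by field.
    by rewrite ler_piMr//; lra.
  have -> : q * e + q ^+ 2 * ((v - 1) / 2) =
     (expR (q ^+ 2 / 2) - 1 - q ^+ 2 / 2) - Ex P Z lhs by rewrite El; field.
  by apply: le_trans (ler_normB _ _) _; rewrite [leRHS]mulrC mulrDr [leRHS]addrC lerD.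
have p0 : Poly [:: 0; e; (v - 1) / 2] = 0.
  apply: (@poly_eq0_of_small _ 3 (Ex P Z h + expR 1)); first exact: size_Poly.
  move=> q q01; rewrite horner_Poly /= [X in `|X|](_ : _ = q * e + q ^+ 2 * ((v - 1) / 2)).
    exact: key.
  by ring.
have := coef_Poly [:: 0; e; (v - 1) / 2] 1; have := coef_Poly [:: 0; e; (v - 1) / 2] 2.
by rewrite p0 !coef0 /= => v1 <-; split => //; lra.
Qed.

End GaussianMoments.

(** * Asymptotic normality *)

Theorem theorem3p2 (R : realType) (m : nat)
  (L : nat -> 'rV[nat]_m) (a : 'rV[R]_m)
  (La : (N%:R^-1 : R) *: map_mx (fun n : nat => n%:R : R) (L N)
          @[N --> \oo] --> a)
  (a_neq0 : a != 0)
  (d : nat -> measure_display) (Omega : forall N, measurableType (d N))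
  (P : forall N, probability (Omega N) R)
  (X : forall N, {RV (P N) >-> nat})
  (pgfX : forall N, (0 < N)%N ->
     has_pgf (X N) (fun q => (central_string R (L N)).[q]
                             / (central_string R (L N)).[1])) :
  [/\ cvg_in_distribution P (fun N => standardize (P N) (toR (X N)))
        (normal_prob (0 : R) 1),
      ((N%:R ^- 2)%:E * 'E_(P N)[toR (X N)])%E @[N --> \oo]
        --> (limit_mean a)%:E
    & ((N%:R ^- 3)%:E * 'V_(P N)[toR (X N)])%E @[N --> \oo]
        --> (limit_variance a)%:E].
Proof.
have V0 : 0 < limit_variance a := limit_variance_gt0 (a_ge0 La) a_neq0.
set V := limit_variance a in V0 *.
pose g N := (central_string R (L N)).[1]^-1 *: central_string R (L N).
have pgf N : has_pgf (X N.+1) (fun q => (g N.+1).[q]).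
  by move=> q q01; rewrite (pgfX N.+1 isT q q01) hornerZ mulrC.
(* Predicted mean and standard deviation; the exact ones are [mu + c * e] and
   [c * sqrt (w - e ^ 2)] for the sequences [e] and [w] below, whose index is
   shifted by one. *)
pose mu N := limit_mean (realL R L N).
pose c N := rt R N ^+ 3 * Num.sqrt V.
have sV : 0 < Num.sqrt V by rewrite sqrtr_gt0.
have c0 N : 0 < c N.+1 by rewrite mulr_gt0// exprn_gt0// rt_gt0.
pose W N := rescaled (X N.+1) (mu N.+1) (c N.+1).
have eW N : expmom (P N.+1) (W N) := expmom_rescaled (pgf N) _ _.
have eZ := expmom_normal R.
have mgf t : Ex (P N.+1) (W N) (fun x => expR (t * x)) @[N --> \oo] -->
    Ex (normal_prob (0 : R) 1) id (fun x => expR (t * x)).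
  rewrite mgf_normal.
  have H := cvgn_shift 1 (central_string_mgf_cvg La a_neq0 (theta := t / Num.sqrt V)).
  have -> : t ^+ 2 / 2 = (t / Num.sqrt V) ^+ 2 / 2 * limit_variance a.
    rewrite -/V exprMn exprVn sqr_sqrtr ?(ltW V0)//; field.
    by rewrite gt_eqF.
  apply: cvgn_eq H => N; rewrite addn1 (mgf_rescaled (pgf N)) hornerZ.
  have -> : t / c N.+1 = t / Num.sqrt V * (rt R N.+1)^-1 ^+ 3.
    by rewrite /c invfM exprVn; ring.
  by rewrite [_^-1 * _]mulrC.
have [EZ VZ] := gaussian_moments eZ (@mgf_normal R).
pose e N := Ex (P N.+1) (W N) id; pose w N := Ex (P N.+1) (W N) (fun x => x ^+ 2).
have e_cvg : e N @[N --> \oo] --> (0 : R) by rewrite -EZ; exact: (Ex_id_cvg eW eZ mgf).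
have w_cvg : w N @[N --> \oo] --> (1 : R) by rewrite -VZ; exact: (Ex_sqr_cvg eW eZ mgf).
have v_cvg : w N - e N ^+ 2 @[N --> \oo] --> (1 : R).
  rewrite -[X in _ --> X]subr0 -[X in _ - X](mulr0 0); apply: cvgB => //.
  by apply: (cvgn_eq (fun N => expr2 (e N))); exact: cvgM.
have rt4 N : rt R N ^+ 4 = N%:R ^+ 2 by rewrite -(rt_sqr R N) -exprM.
have rt6 N : rt R N ^+ 6 = N%:R ^+ 3 by rewrite -(rt_sqr R N) -exprM.
split.
- move=> x cx; rewrite -(cvg_shiftn 1).
  have fin y : (normal_prob (0 : R) 1 `]-oo, y]%classic) \is a fin_num.
    exact: fin_num_measure.
  have cx' : {for x, continuous (fun y => fine (normal_prob (0 : R) 1 (id @^-1` `]-oo, y]%classic)))}.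
    have cxE : normal_prob (0 : R) 1 `]-oo, y]%classic @[y --> x] -->
        (fine (normal_prob (0 : R) 1 `]-oo, x]%classic))%:E by rewrite (fineK (fin x)); exact: cx.
    exact: (fine_cvg cxE).
  have x_cvg : x * Num.sqrt (w N - e N ^+ 2) + e N @[N --> \oo] --> x.
    rewrite -[X in _ --> X](_ : x * Num.sqrt 1 + 0 = x); last by rewrite sqrtr1 mulr1 addr0.
    apply: cvgD => //; apply: cvgM; first exact: cvg_cst.
    by apply: continuous_cvg v_cvg; exact: sqrt_continuous.
  have H := cdf_cvg eW eZ mgf x_cvg cx'.
  have {}H : P N.+1 (W N @^-1` `]-oo, (x * Num.sqrt (w N - e N ^+ 2) + e N)]%classic) @[N --> \oo]
      --> normal_prob (0 : R) 1 `]-oo, x]%classic.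
    rewrite -(fineK (fin x)); apply: cvg_EFin => //.
    apply: nearW => N; apply: fin_num_measure.
    by rewrite -[W N @^-1` _]setTI; exact: (eW N).1.
  apply: cvg_trans H; apply: near_eq_cvg.
  have h : -1 < - (1 / 2) :> R by lra.
  have pos : \forall n \near \oo, - (w n - e n ^+ 2) <= - (1 / 2).
    exact: (cvgn_near_le (cvgN v_cvg) h).
  near=> N; rewrite /= addn1.
  rewrite (standardize_le (mu := mu N.+1) (pgf N) (c0 N))//.
  have : - (w N - e N ^+ 2) <= - (1 / 2) by near: N; exact: pos.
  by rewrite -/(W N) -/(e N) -/(w N); lra.
- rewrite -(cvg_shiftn 1).
  have mean_cvg : N%:R ^- 2 * mu N @[N --> \oo] --> limit_mean a.
    apply: (@cvgn_eq _ _ (fun N => limit_mean (N%:R^-1 *: realL R L N))).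
      by move=> N; rewrite limit_meanZ exprVn.
    apply: limit_mean_cvg => i; apply: (cvgn_eq _ (copies_cvg La (i := i))) => N.
    by rewrite entZ ent_realL mulrC.
  have c_cvg : (rt R N.+1)^-1 * (Num.sqrt V * e N) @[N --> \oo] --> 0.
    apply: cvgn0M (cvgM (cvg_cst _) e_cvg).
    apply: (cvgn_eq _ (cvgn_shift 1 (@cvgn_invsqrt R))) => N; by rewrite addn1.
  have H : (N + 1)%:R ^- 2 * mu (N + 1)%N + (rt R N.+1)^-1 * (Num.sqrt V * e N) @[N --> \oo]
      --> limit_mean a.
    by rewrite -[X in _ --> X]addr0; exact: cvgD (cvgn_shift 1 mean_cvg) c_cvg.
  apply: cvg_EFin.
    by apply: nearW => N; rewrite /= addn1 (expectation_rescaled (pgf N) (mu N.+1) (c0 N)) -EFinM.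
  apply: cvgn_eq H => N; rewrite /= addn1 (expectation_rescaled (pgf N) (mu N.+1) (c0 N)) /=.
  rewrite mulrDr; congr (_ + _); rewrite -/(W N) -/(e N) /c -rt4.
  by field; rewrite gt_eqF// rt_gt0.
- rewrite -(cvg_shiftn 1).
  have H : V * (w N - e N ^+ 2) @[N --> \oo] --> V.
    by rewrite -[X in _ --> X]mulr1; apply: cvgM => //; exact: cvg_cst.
  apply: cvg_EFin.
    by apply: nearW => N; rewrite /= addn1 (variance_rescaled (pgf N) (mu N.+1) (c0 N)) -EFinM.
  apply: cvgn_eq H => N; rewrite /= addn1 (variance_rescaled (pgf N) (mu N.+1) (c0 N)) /=.
  rewrite mulrA -/(W N) -/(e N) -/(w N); congr (_ * _).
  rewrite /c exprMn sqr_sqrtr ?(ltW V0)// -rt6.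
  by field; rewrite gt_eqF// rt_gt0.
Unshelve. all: by end_near. Qed.
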